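(* Let $\alpha>0$, $k,\omega_0,\omega_1\in\mathbb R$ with $\cos\omega_0\neq0$, and put $\gamma=\alpha\tan\omega_0$. The matrix Schrödinger operator $L=-D_x^2+U(x)$, $x\in\mathbb R$, with $$U=(\alpha^2x^2+k^2-\alpha)I+\frac{2\alpha kx}{\cos\omega_0}\begin{pmatrix}\cos\chi&\sin\chi\\ \sin\chi&-\cos\chi\end{pmatrix},\qquad \chi=\gamma x^2+\omega_1-\omega_0,$$ has the discrete spectrum $$\lambda=2n\alpha,\qquad n\in\mathbb Z_{\ge0},$$ and, when $k\ne0$ and $\gamma\neq0$, its eigenfunctions are expressed in terms of the Weber (parabolic cylinder) functions.
   Context: $D_x=d/dx$, $I$ is the $2\times2$ identity matrix, and $L$ acts on $\mathbb C^2$-valued functions in $L_2(\mathbb R)$. ''Expressed in terms of Weber functions'' means by means of algebraic operations, differentiation, elementary functions and (complex) linear changes of the argument applied to Weber (parabolic cylinder) functions, equivalently to solutions of the Hermite equation $y_{zz}-2zy_z+2\nu y=0$ with complex parameter $\nu$. *)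

(* Defs.v *)
From HB Require Import structures.
From mathcomp Require Import all_boot all_order all_algebra.
From mathcomp Require Import complex.
From mathcomp Require Import all_classical all_reals all_analysis.
Import Order.TTheory GRing.Theory Num.Theory.
Import numFieldNormedType.Exports.

Set Implicit Arguments.
Unset Strict Implicit.
Unset Printing Implicit Defensive.

Local Open Scope classical_set_scope.
Local Open Scope ring_scope.
Local Open Scope complex_scope.

Section L2.
Variables (R : realType) (m : nat).
Implicit Types (psi g : R -> 'cV[R[i]]_m) (f : R -> R[i]).

(* psi is square integrable on the line: so are the real and imaginary parts of
   all its components. Functions are not identified almost everywhere. *)
Definition in_L2 psi : Prop :=
  forall j : 'I_m,
    ((fun x => complex.Re (psi x j 0)) \in Lfun (@lebesgue_measure R) 2%:E) /\
    ((fun x => complex.Im (psi x j 0)) \in Lfun (@lebesgue_measure R) 2%:E).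

Definition vnorm (v : 'cV[R[i]]_m) : R :=
  Num.sqrt (\sum_(j < m)
    (complex.Re (v j 0) ^+ 2 + complex.Im (v j 0) ^+ 2)).

Definition L2norm psi : \bar R :=
  Lnorm (@lebesgue_measure R) 2%:E (fun x => (vnorm (psi x))%:E).

Definition has_derivative f (df : R -> R[i]) : Prop :=
  forall x : R,
    is_derive x (1 : R) (fun t => complex.Re (f t)) (complex.Re (df x)) /\
    is_derive x (1 : R) (fun t => complex.Im (f t)) (complex.Im (df x)).

Definition cintegral (a b : R) f : R[i] :=
  (\int[@lebesgue_measure R]_(x in `[a, b]) complex.Re (f x))%R +i*
  (\int[@lebesgue_measure R]_(x in `[a, b]) complex.Im (f x))%R.

(* The graph of L = - D_x^2 + U on its maximal domain in L_2: psi and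
   g = - psi'' + U psi are in L_2 and psi, psi' are locally absolutely
   continuous, psi'' being taken almost everywhere. The last point is expressed
   by: psi' is an indefinite Lebesgue integral of U psi - g. Thus g matters only
   up to a null set, while psi is the C^1 representative of its class, so that
   psi = 0 in L_2 iff psi vanishes identically. *)
Definition schrodinger (U : R -> 'M[R[i]]_m) psi g : Prop :=
  [/\ in_L2 psi, in_L2 g &
    exists dpsi : R -> 'cV[R[i]]_m, forall j : 'I_m,
      has_derivative (fun x => psi x j 0) (fun x => dpsi x j 0) /\
      forall a b : R, a <= b ->
        dpsi b j 0 - dpsi a j 0 =
        cintegral a b (fun x => (U x *m psi x - g x) j 0)].

End L2.

(* Below, an operator L in L_2 is given by its graph: L psi h means that psi is
   in the domain and L psi = h; hence (L - lambda) psi = g is written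
   L psi (g + lambda psi). *)
Section Spectrum.
Variables (R : realType) (m : nat).
Variable L : (R -> 'cV[R[i]]_m) -> (R -> 'cV[R[i]]_m) -> Prop.
Implicit Types (psi g : R -> 'cV[R[i]]_m) (lambda : R[i]).

Definition shifted lambda psi g : Prop :=
  L psi (fun x => g x + lambda *: psi x).

Definition resolvent_set : set R[i]^o := [set lambda |
  (forall g, in_L2 g -> exists! psi, shifted lambda psi g) /\
  exists M : R, forall psi g, shifted lambda psi g ->
    (L2norm psi <= M%:E * L2norm g)%E].

Definition spectrum : set R[i]^o := ~` resolvent_set.

Definition eigenfunction lambda psi : Prop :=
  L psi (fun x => lambda *: psi x) /\ exists x, psi x != 0.

Definition finite_multiplicity lambda : Prop :=
  exists (d : nat) (e : 'I_d -> R -> 'cV[R[i]]_m),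
    forall psi, eigenfunction lambda psi ->
      exists c : 'I_d -> R[i], forall x, psi x = \sum_(l < d) c l *: e l x.

Definition discrete_spectrum : set R[i]^o := [set lambda |
  [/\ isolated spectrum lambda,
      exists psi, eigenfunction lambda psi &
      finite_multiplicity lambda]].

End Spectrum.

Section Weber.
Variable R : realType.
Local Notation C := (R[i]^o).

Definition cexp (z : C) : C :=
  (expR (complex.Re z) * cos (complex.Im z)) +i*
  (expR (complex.Re z) * sin (complex.Im z)).

Definition cmod (z : C) : R :=
  Num.sqrt (complex.Re z ^+ 2 + complex.Im z ^+ 2).

(* Principal argument, in ]-pi, pi]; the value at 0 is irrelevant. *)
Definition carg (z : C) : R :=
  if 0 <= complex.Im z then acos (complex.Re z / cmod z)
  else - acos (complex.Re z / cmod z).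

Definition clog (z : C) : C := ln (cmod z) +i* carg z.

Definition entire_derivative (f df : C -> C) : Prop :=
  forall z : C, is_derive z (1 : C) f (df z).

(* Entire solutions of y'' - 2 z y' + 2 nu y = 0; every solution of this
   equation extends to an entire function. *)
Definition hermite_solution (nu : C) (y : C -> C) : Prop :=
  exists dy ddy : C -> C,
    [/\ entire_derivative y dy, entire_derivative dy ddy &
        forall z : C, ddy z - 2 * z * dy z + 2 * nu * y z = 0].

(* Functions expressed in terms of Weber functions. Powers, trigonometric and
   inverse trigonometric functions are obtained from exp, log, roots and field
   operations. Only everywhere differentiable functions are differentiated,
   so that no junk derivative enters. *)
Inductive weber_expressible : (C -> C) -> Prop :=
| weber_hermite nu y : hermite_solution nu y -> weber_expressible y
| weber_const c : weber_expressible (fun=> c)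
| weber_id : weber_expressible (fun z => z)
| weber_add f g : weber_expressible f -> weber_expressible g ->
    weber_expressible (fun z => f z + g z)
| weber_mul f g : weber_expressible f -> weber_expressible g ->
    weber_expressible (fun z => f z * g z)
| weber_inv f : weber_expressible f -> weber_expressible (fun z => (f z)^-1)
| weber_root (n : nat) f : weber_expressible f ->
    weber_expressible (fun z => n.-root (f z : R[i]))
| weber_exp f : weber_expressible f -> weber_expressible (fun z => cexp (f z))
| weber_log f : weber_expressible f -> weber_expressible (fun z => clog (f z))
| weber_derive f df : weber_expressible f -> entire_derivative f df ->
    weber_expressible df
| weber_linear a b f : weber_expressible f ->
    weber_expressible (fun z => f (a * z + b)).

End Weber.

Section Potential.
Variable R : realType.

(* The symmetric matrix ((cos t, sin t), (sin t, - cos t)). *)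
Definition reflection (t : R) : 'M[R]_2 :=
  \matrix_(i < 2, j < 2)
    if i == j then (if i == 0 then cos t else - cos t) else sin t.

Definition potential (alpha k omega0 omega1 : R) (x : R) : 'M[R]_2 :=
  let gamma := alpha * tan omega0 in
  let chi := gamma * x ^+ 2 + omega1 - omega0 in
  (alpha ^+ 2 * x ^+ 2 + k ^+ 2 - alpha)%:M
  + (2 * alpha * k * x / cos omega0) *: reflection chi.

Definition operatorL (alpha k omega0 omega1 : R) :
    (R -> 'cV[R[i]]_2) -> (R -> 'cV[R[i]]_2) -> Prop :=
  schrodinger
    (fun x => map_mx (real_complex R) (potential alpha k omega0 omega1 x)).

End Potential.

(* Main.v *)
(* With W = alpha x + k R(gamma x^2 + omega1), where R is [reflection], one has
   L = A^* A for A = D + W, and the trigonometric identity behind the choice of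
   gamma gives shape invariance: A A^* = L' + 2 alpha, where L' is the operator
   with omega1 replaced by omega1 + 2 omega0. Hence L - z is invertible as soon
   as z <> 0 and L' - (z - 2 alpha) is, and after finitely many steps the
   spectral parameter lies so far to the left that L - z is a small perturbation
   of an explicitly invertible scalar operator. Eigenfunctions for 2 n alpha are
   likewise obtained from those of L' for 2 (n - 1) alpha by A^*, starting from
   A psi = 0: there the factor exp (- alpha x^2 / 2) splits off, and in the
   coordinates psi_1 + i psi_2 and psi_1 - i psi_2 the remaining system is
   equivalent to p'' = 2 i gamma x p' + k^2 p, a rotated Hermite equation.
   A C^2-valued function is represented by the real 2 x 2 matrix whose columns
   are its real and imaginary parts. *)

Require Import Defs.
From HB Require Import structures.
From mathcomp Require Import all_boot all_order all_algebra.
From mathcomp Require Import complex.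
From mathcomp Require Import all_classical all_reals all_analysis.
From mathcomp Require Import measurable_realfun.
From mathcomp Require Import zify ring lra.
Import Order.TTheory GRing.Theory Num.Theory.
Import numFieldNormedType.Exports.

Set Implicit Arguments.
Unset Strict Implicit.
Unset Printing Implicit Defensive.

Local Open Scope classical_set_scope.
Local Open Scope ring_scope.
Local Open Scope complex_scope.

(** * Primitives of locally integrable functions *)

Section Primitives.
Variable R : realType.
Implicit Types (F G f g : R -> R) (a b x : R).
Local Notation mu := (@lebesgue_measure R).

(** The domain of L is maximal: of psi in it, neither psi' nor W psi is known to be in L_2. Hence
    derivatives enter only through primitives, L psi = f becomes a first-order system for psi and A
    psi, and integration by parts is done with a cut-off. The resulting energy estimates show that A
    psi, and likewise A^* applied to solutions of the next problem, stay in L_2; every step of the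
    induction needs this.

    In passing from L' back to L, A cannot be applied to the right-hand side g, which need not be
    differentiable; one resolvent point far to the left serves as a detour.

    The explicit scalar operator is (- D + v)(D + v) with v^2 = alpha^2 x^2 - Re z. Its difference
    from L - z still grows linearly in x, so it is not a bounded perturbation. It is however at most
    c v with c <= m / 2, m = min v, and inverting either factor gains a division by v in the sup
    norm. The fixed point is therefore sought among bounded functions, and an energy estimate puts
    it in L_2 afterwards. How far left is far enough depends on Im z only, which the shifts by 2
    alpha preserve. *)

Definition locint f : Prop :=
  measurable_fun setT f /\ forall a b, mu.-integrable `[a, b] (EFin \o f).

(** Local absolute continuity of [F] with derivative [f] almost everywhere, in the form in which
    [schrodinger] states it. The rules of calculus are proved for this relation, so that almost
    everywhere derivatives never have to be handled. *)
Definition prim F f : Prop :=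
  locint f /\ forall a b, a <= b -> F b - F a = \int[mu]_(x in `[a, b]) f x.

Lemma locint_cont f : continuous f -> locint f.
Proof.
move=> cf; split; first exact: continuous_measurable_fun.
move=> a b; apply: continuous_compact_integrable; first exact: segment_compact.
exact: continuous_subspaceT.
Qed.

Lemma locintD f g : locint f -> locint g -> locint (fun x => f x + g x).
Proof.
move=> [mf lf] [mg lg]; split; first exact: measurable_funD.
by move=> a b; have := @integrableD _ _ _ mu `[a, b] (measurable_itv _) _ _ (lf a b) (lg a b).
Qed.

Lemma locintZ (c : R) f : locint f -> locint (fun x => c * f x).
Proof.
move=> [mf lf]; split; first exact: measurable_funM.
by move=> a b; have := @integrableZl _ _ _ mu `[a, b] (measurable_itv _) c _ (lf a b).
Qed.

Lemma locint_le f g : measurable_fun setT f -> locint g ->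
  (forall x, `|f x| <= g x) -> locint f.
Proof.
move=> mf [mg lg] fg; split=> // a b.
apply: le_integrable (lg a b) => //.
  by apply/measurable_EFinP; apply: measurable_funTS.
by move=> x _ /=; rewrite lee_fin (le_trans (fg x)) // ler_norm.
Qed.

Lemma locint_abs f : locint f -> locint (fun x => `|f x|).
Proof.
move=> [mf lf]; split; first exact: measurableT_comp.
by move=> a b; have := @integrable_norm _ _ _ mu `[a, b] _ (lf a b).
Qed.

Lemma locintM (u : R -> R) f : continuous u -> locint f -> locint (fun x => u x * f x).
Proof.
move=> cu [mf lf]; split.
  by apply: measurable_funM => //; exact: continuous_measurable_fun.
move=> a b.
apply: (@integrableMr _ _ _ mu `[a, b] (measurable_itv _) u (EFin \o f)).
- by apply: measurable_funTS; exact: continuous_measurable_fun.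
- have : compact (u @` `[a, b]).
    apply: continuous_compact; last exact: segment_compact.
    exact: continuous_subspaceT.
  move/compact_bounded; rewrite /bounded_set /= => -[M [Mr HM]].
  exists M; split => // N MN x xab; apply: (HM _ MN); by exists x.
- exact: lf.
Qed.

Lemma Rint_chasles f a b c : locint f -> a <= c -> c <= b ->
  \int[mu]_(x in `[a, b]) f x =
  \int[mu]_(x in `[a, c]) f x + \int[mu]_(x in `[c, b]) f x.
Proof.
move=> [mf lf] ac cb.
have := @Rintegral_itvB R f (BLeft a) (BRight b) c (lf a b).
rewrite !bnd_simp => /(_ ac cb) E.
rewrite -[X in _ = _ + X](@Rintegral_itv_obnd_cbnd R c (BRight b) f); last first.
  apply: integrableS (lf c b) => //.
  by apply: subset_itvr; rewrite bnd_simp.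
by rewrite -E addrC subrK.
Qed.

Lemma prim_exists f : locint f -> exists F, prim F f.
Proof.
move=> lf.
pose I a b := \int[mu]_(x in `[a, b]) f x.
have I0 a b : b <= a -> I a b = 0.
  rewrite /I le_eqVlt => /predU1P[->|ba].
    by rewrite set_itv1 Rintegral_set1.
  by rewrite set_itv_ge ?Rintegral_set0 // bnd_simp -ltNge.
(* At least one of the two integrals is over an empty interval or a point and vanishes; the
   difference is the oriented integral from 0 to x. *)
exists (fun x => I 0 x - I x 0); split => // a b ab.
rewrite -[RHS]/(I a b).
have C u v w : u <= v -> v <= w -> I u w = I u v + I v w.
  by move=> *; apply: Rint_chasles.
case: (leP 0 a) => a0.
  by rewrite (I0 a) // (I0 b) ?(le_trans a0) // (C 0 a b) // !subr0 addrC addKr.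
case: (leP 0 b) => b0.
  by rewrite (I0 0 a) ?(I0 b) // ?(C a 0 b) // ?ltW //; ring.
by rewrite (I0 0 a) ?(I0 0 b) ?(C a b 0) // ?ltW //; ring.
Qed.

Lemma primD F f G g : prim F f -> prim G g ->
  prim (fun x => F x + G x) (fun x => f x + g x).
Proof.
move=> [lf Ff] [lg Gg]; split; first exact: locintD.
move=> a b ab; rewrite RintegralD //; [|exact: lf.2|exact: lg.2].
by rewrite -Ff // -Gg //; ring.
Qed.

Lemma primZ c F f : prim F f -> prim (fun x => c * F x) (fun x => c * f x).
Proof.
move=> [lf Ff]; split; first exact: locintZ.
move=> a b ab; rewrite RintegralZl //; last exact: lf.2.
by rewrite -Ff //; ring.
Qed.

Lemma prim_ext F f G g : prim F f -> F =1 G -> f =1 g -> prim G g.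
Proof. by move=> Ff /funext <- /funext <-. Qed.

Lemma primN F f : prim F f -> prim (fun x => - F x) (fun x => - f x).
Proof. by move=> /(primZ (-1)) /prim_ext; apply => x; rewrite mulN1r. Qed.

Lemma primB F f G g : prim F f -> prim G g ->
  prim (fun x => F x - G x) (fun x => f x - g x).
Proof. by move=> Ff /primN Gg; exact: primD. Qed.

Lemma prim_cst c : prim (fun=> c) (fun=> 0).
Proof.
split; first by apply: locint_cont => x; exact: cst_continuous.
by move=> a b _; rewrite Rintegral_cst //= mul0r subrr.
Qed.

Lemma prim_sum (I : Type) (s : seq I) (F f : I -> R -> R) :
  (forall i, prim (F i) (f i)) ->
  prim (fun x => \sum_(i <- s) F i x) (fun x => \sum_(i <- s) f i x).
Proof.
move=> Ff; elim: s => [|i s IH].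
  by apply: prim_ext (prim_cst 0) _ _ => x; rewrite big_nil.
by apply: prim_ext (primD (Ff i) IH) _ _ => x; rewrite big_cons.
Qed.

Lemma prim_le F f G g a b : prim F f -> prim G g -> a <= b ->
  (forall x, a <= x <= b -> f x <= g x) -> F b - F a <= G b - G a.
Proof.
move=> [[mf lf] Ff] [[mg lg] Gg] ab fg; rewrite Ff // Gg //.
by apply: (@le_Rintegral _ _ _ mu `[a, b] f g _ (lf a b) (lg a b)).
Qed.

Lemma prim_ge0 F f a b : prim F f -> a <= b ->
  (forall x, a <= x <= b -> 0 <= f x) -> F a <= F b.
Proof.
move=> Ff ab f0.
by have := prim_le (prim_cst 0) Ff ab f0; rewrite subrr subr_ge0.
Qed.

Lemma prim_abs F f G g a b : prim F f -> prim G g -> a <= b ->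
  (forall x, a <= x <= b -> `|f x| <= g x) -> `|F b - F a| <= G b - G a.
Proof.
move=> Ff Gg ab fg; rewrite ler_norml; apply/andP; split.
  have := prim_le (primN Gg) Ff ab; rewrite -opprD; apply=> x /fg.
  by rewrite ler_norml => /andP[].
by apply: prim_le Ff Gg ab _ => x /fg; rewrite ler_norml => /andP[].
Qed.

Lemma prim_cont F f : prim F f -> continuous F.
Proof.
move=> [lf Ff] x.
have ab : x - 1 < x + 1 by lra.
have xin : x \in `]x - 1, x + 1[ by rewrite in_itv /=; apply/andP; split; lra.
have /(continuous_within_itvP _ ab)[/(_ x xin) c _ _] :=
  @parameterized_integral_continuous R _ _ f (ltW ab) (lf.2 (x - 1) (x + 1)).
have E : \forall y \near x,
    F (x - 1) + parameterized_integral mu (x - 1) y f = F y.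
  near=> y; rewrite /parameterized_integral -Ff; first by rewrite addrC subrK.
  near: y; exists 1 => //= y /=; rewrite ltr_distl => /andP[? ?]; lra.
rewrite /continuous_at -(nbhs_singleton E).
apply: (cvg_trans _ (@cvgD _ _ _ _ _ _ _ _ _ (cvg_cst (F (x - 1))) c)).
exact: (near_eq_cvg E).
Unshelve. all: by end_near. Qed.

Lemma prim_der F f x : prim F f -> {for x, continuous f} -> is_derive x 1 F (f x).
Proof.
move=> [lf Ff] cf.
have xu : x < x + 1 by lra.
have ax : x - 1 < x by lra.
have [D E] := @continuous_FTC1_closed R f (x - 1) x (x + 1) xu (lf.2 _ _) ax cf.
have N : {near x, (fun y => F (x - 1) + \int[mu]_(t in `[x - 1, y]) f t) =1 F}.
  near=> y; rewrite -Ff; first by rewrite addrC subrK.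
  near: y; exists 1 => //= y /=; rewrite ltr_distl => /andP[? ?]; lra.
have D' : is_derive x 1 (fun y => F (x - 1) + \int[mu]_(t in `[x - 1, y]) f t) (f x).
  have : is_derive x 1 (fun y => \int[mu]_(t in `[x - 1, y]) f t) (f x).
    by rewrite -E derive1E; exact: derivableP.
  move=> H; have := @is_deriveD R _ _ (fun=> F (x - 1)) _ x 1 0 (f x) (is_derive_cst _ _ _) H.
  by rewrite add0r.
by move: D'; apply: near_eq_is_derive => //; rewrite oner_eq0.
Unshelve. all: by end_near. Qed.

Lemma der_prim F f : (forall x, is_derive x 1 F (f x)) -> continuous f -> prim F f.
Proof.
move=> dF cf; split; first exact: locint_cont.
move=> a b; rewrite le_eqVlt => /predU1P[->|ab].
  by rewrite set_itv1 Rintegral_set1 subrr.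
have cF : continuous F.
  by move=> x; apply: differentiable_continuous; apply/derivable1_diffP; apply: ex_derive.
rewrite /Rintegral (@continuous_FTC2 R f F a b ab) //.
- exact: continuous_subspaceT.
- split; [by move=> x _; apply: ex_derive| |].
  + exact: cvg_at_right_filter (cF a).
  + exact: cvg_at_left_filter (cF b).
- by move=> x _; rewrite derive1E; apply: derive_val.
Qed.

Lemma prim_uniq F f g : prim F f -> prim F g -> continuous f -> continuous g ->
  f =1 g.
Proof.
move=> Ff Fg cf cg x.
have [_ <-] := prim_der Ff (cf x).
by have [_ <-] := prim_der Fg (cg x).
Qed.

End Primitives.

(** * The product rule for absolutely continuous functions *)

Section ProductRule.
Variable R : realType.
Implicit Types (F G f g M : R -> R) (a b x : R).

(** The supremum of the points t of [a, b] with M a <= M t belongs to this set, by monotonicity to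
    its left, and must be b, by monotonicity to its right. Continuity of M does not enter. *)
Lemma loc_mono M :
  (forall x, exists2 d, 0 < d & forall s t, x - d < s -> s <= t -> t < x + d ->
     M s <= M t) ->
  forall a b, a <= b -> M a <= M b.
Proof.
move=> H a b ab.
pose E := [set t | a <= t <= b /\ M a <= M t].
have Ea : E a by rewrite /E /= lexx ab.
have supE : has_sup E by split; [exists a | exists b => t [/andP[]]].
set c := sup E.
have ac : a <= c by apply: ub_le_sup => //; exact: supE.2.
have cb : c <= b by apply: ge_sup; [exists a; exact: Ea | move=> t [/andP[]]].
have [d d0 Hd] := H c.
have [e [eab Me] ce] := sup_adherent d0 supE.
have ec : e <= c by apply: ub_le_sup; [exact: supE.2|].
pose t := Num.min b (c + d / 2).
have et : e <= t.
  by rewrite /t le_min; case/andP: eab => _ -> /=; rewrite (le_trans ec) // lerDl divr_ge0 ?ltW.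
have td : t < c + d.
  by rewrite /t gt_min; apply/orP; right; rewrite ltrD2l; lra.
have Mt : M a <= M t by apply: le_trans Me _; exact: Hd.
have tE : E t.
  split => //; rewrite /t ge_min lexx andbT (le_trans _ et) //.
  by case/andP: eab.
have tc : t <= c by apply: ub_le_sup; [exact: supE.2|].
suff -> : b = t by [].
move: tc; rewrite /t /Num.min; case: ifP => // _ tc; exfalso; lra.
Qed.

(* On short intervals the increments of F G - P, for a primitive P of f G + F g,
   are at most e times those of a primitive of |f| + |g|; hence
   c (F G - P) + e A is locally, so globally, nondecreasing for |c| <= 1. *)
Lemma primM F f G g : prim F f -> prim G g ->
  prim (fun x => F x * G x) (fun x => f x * G x + F x * g x).
Proof.
move=> Ff Gg.
have cF := prim_cont Ff; have cG := prim_cont Gg.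
have lfg : locint (fun x => f x * G x + F x * g x).
  apply: locintD; last by apply: locintM => //; exact: Gg.1.
  rewrite [X in locint X](_ : _ = fun x => G x * f x); last by apply/funext => x; rewrite mulrC.
  by apply: locintM => //; exact: Ff.1.
have [P pP] := prim_exists lfg.
have [A pA] := prim_exists (locintD (locint_abs Ff.1) (locint_abs Gg.1)).
suff D a b : a <= b -> F b * G b - P b = F a * G a - P a.
  split=> // a b ab; rewrite -(pP.2 _ _ ab); have := D _ _ ab; lra.
move=> ab.
have small e : 0 < e -> forall (c : R), `|c| <= 1 ->
    c * (F a * G a - P a) + e * A a <= c * (F b * G b - P b) + e * A b.
  move=> e0 c c1; apply: (@loc_mono (fun x => c * (F x * G x - P x) + e * A x)) => // x.
  have e2 : 0 < e / 2 by lra.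
  have := cF x; move/cvgrPdist_lt => /(_ _ e2)[dF /= dF0 HF].
  have := cG x; move/cvgrPdist_lt => /(_ _ e2)[dG /= dG0 HG].
  exists (Num.min dF dG); first by rewrite lt_min dF0.
  move=> s t xs st tx.
  have nb r : s <= r <= t -> `|F x - F r| < e / 2 /\ `|G x - G r| < e / 2.
    move=> /andP[sr rt]; split; [apply: HF|apply: HG] => /=.
      have : Num.min dF dG <= dF by rewrite ge_min lexx.
      by rewrite ltr_distl => ?; apply/andP; split; lra.
    have : Num.min dF dG <= dG by rewrite ge_min lexx orbT.
    by rewrite ltr_distl => ?; apply/andP; split; lra.
  have near2 r : s <= r <= t -> `|G t - G r| <= e /\ `|F s - F r| <= e.
    move=> r1; have [F1 G1] := nb _ r1.
    have [F2 _] := nb s ltac:(by rewrite lexx st).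
    have [_ G2] := nb t ltac:(by rewrite lexx st).
    move: F1 G1 F2 G2; rewrite !ltr_norml !ler_norml => /andP[? ?] /andP[? ?] /andP[? ?] /andP[? ?].
    by split; apply/andP; split; lra.
  (* With s and t frozen, this function is linear in F and G and has the same increment from s to t
     as F G - P, while its derivative is explicit and small. *)
  have pK : prim (fun r => G t * F r + F s * G r - P r)
     (fun r => G t * f r + F s * g r - (f r * G r + F r * g r)).
    by apply: primB pP; apply: primD; exact: primZ.
  have := prim_abs pK (primZ e pA) st.
  have bd r : s <= r <= t -> `|G t * f r + F s * g r - (f r * G r + F r * g r)| <=
     e * (`|f r| + `|g r|).
    move=> /near2[h1 h2].
    rewrite (_ : _ - _ = (G t - G r) * f r + (F s - F r) * g r); last by ring.
    rewrite (le_trans (ler_normD _ _)) // !normrM mulrDr lerD // ler_wpM2r //.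
  move=> /(_ bd) Kst.
  have : `|c * ((F t * G t - P t) - (F s * G s - P s))| <= e * A t - e * A s.
    rewrite normrM (le_trans _ Kst) // (_ : F t * G t - P t - _ =
      G t * F t + F s * G t - P t - (G t * F s + F s * G s - P s)); last by ring.
    by rewrite ler_piMl.
  rewrite ler_norml => /andP[? ?]; lra.
have Aab : 0 <= A b - A a.
  by rewrite subr_ge0; apply: (prim_ge0 pA ab) => x _; rewrite addr_ge0.
have key (c : R) : `|c| <= 1 -> c * (F a * G a - P a) <= c * (F b * G b - P b).
  move=> c1; apply/ler_addgt0Pl => e e0.
  have e'0 : 0 < e / (A b - A a + 1) by rewrite divr_gt0 //; lra.
  have := small _ e'0 _ c1.
  have : e / (A b - A a + 1) * (A b - A a) <= e.
    rewrite mulrAC ler_pdivrMr; last by lra.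
    by rewrite ler_pM2l //; lra.
  lra.
have := key 1; have := key (-1); rewrite normrN normr1 => /(_ (lexx _)) ? /(_ (lexx _)) ?.
lra.
Qed.

End ProductRule.

(** * Matrix-valued primitives and the Frobenius product *)

Section MatrixValued.
Variable R : realType.
Implicit Types (u v : 'M[R]_2) (psi eta f g : R -> 'M[R]_2) (W : R -> 'M[R]_2).

(** The Frobenius product. For matrices whose columns are the real and imaginary parts of vectors of
    C^2, it is the real part of the Hermitian product, and [nsq] is the squared norm. *)
Definition dot u v : R := \tr (u^T *m v).
Definition nsq u : R := dot u u.

Lemma dotE u v : dot u v = \sum_j \sum_i u i j * v i j.
Proof.
rewrite /dot /mxtrace; apply: eq_bigr => j _; rewrite mxE.
by apply: eq_bigr => i _; rewrite mxE.
Qed.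

Lemma dotC u v : dot u v = dot v u.
Proof. by rewrite /dot -mxtrace_tr trmx_mul trmxK. Qed.

Lemma dotDr u v w : dot u (v + w) = dot u v + dot u w.
Proof. by rewrite /dot mulmxDr raddfD. Qed.

Lemma dotZr u c v : dot u (c *: v) = c * dot u v.
Proof. by rewrite /dot -scalemxAr linearZ. Qed.

Lemma dotNr u v : dot u (- v) = - dot u v.
Proof. by rewrite -scaleN1r dotZr mulN1r. Qed.

Lemma dotDl u v w : dot (v + w) u = dot v u + dot w u.
Proof. by rewrite dotC dotDr !(dotC u). Qed.

Lemma dotZl u c v : dot (c *: v) u = c * dot v u.
Proof. by rewrite dotC dotZr dotC. Qed.

Lemma dotNl u v : dot (- v) u = - dot v u.
Proof. by rewrite dotC dotNr dotC. Qed.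

Lemma dot_mull A u v : dot (A *m u) v = dot u (A^T *m v).
Proof. by rewrite /dot trmx_mul mulmxA. Qed.

Lemma nsq_ge0 u : 0 <= nsq u.
Proof.
rewrite /nsq dotE; apply: sumr_ge0 => j _; apply: sumr_ge0 => i _.
by rewrite -expr2 sqr_ge0.
Qed.

Lemma nsq_eq0 u : nsq u = 0 -> u = 0.
Proof.
rewrite /nsq dotE => /eqP; rewrite psumr_eq0; last first.
  by move=> j _; apply: sumr_ge0 => i _; rewrite -expr2 sqr_ge0.
move=> /allP H; apply/matrixP => i j; rewrite mxE.
have := H j (mem_index_enum _); rewrite psumr_eq0; last first.
  by move=> ? _; rewrite -expr2 sqr_ge0.
move=> /allP /(_ i (mem_index_enum _)); rewrite -expr2 sqrf_eq0.
by move/eqP.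
Qed.

Lemma sum_I2 (V : nmodType) (F : 'I_2 -> V) : \sum_(i < 2) F i = F 0 + F 1.
Proof.
rewrite big_ord_recr big_ord_recr big_ord0 /= add0r.
by congr (F _ + F _); apply/val_inj.
Qed.

Lemma nsqE u : nsq u = u 0 0 ^+ 2 + u 1 0 ^+ 2 + (u 0 1 ^+ 2 + u 1 1 ^+ 2).
Proof.
by rewrite /nsq dotE !sum_I2 -!expr2.
Qed.

Lemma entry_le_nsq u i j : u i j ^+ 2 <= nsq u.
Proof.
rewrite /nsq dotE (bigD1 j) //= (bigD1 i) //= -expr2 -addrA lerDl addr_ge0 //.
  by apply: sumr_ge0 => ? _; rewrite -expr2 sqr_ge0.
by apply: sumr_ge0 => ? _; apply: sumr_ge0 => ? _; rewrite -expr2 sqr_ge0.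
Qed.

(** Expand the square of c u + s v for s = 1 and s = -1, and divide by c. *)
Lemma dot_young (c : R) u v : 0 < c -> `|2 * dot u v| <= c * nsq u + nsq v / c.
Proof.
move=> c0; have cn : c != 0 by rewrite gt_eqF.
have E (s : R) : s ^+ 2 = 1 -> 0 <= c * nsq u + nsq v / c + s * (2 * dot u v).
  move=> s1; have := nsq_ge0 (c *: u + s *: v).
  rewrite /nsq !dotDr !dotDl !dotZr !dotZl (dotC v u) => H.
  have : 0 <= (c * (c * dot u u) + s * (c * dot u v) + (c * (s * dot u v) + s * (s * dot v v))) / c.
    apply: divr_ge0; last exact: ltW.
    by apply: le_trans H _; rewrite le_eqVlt; apply/orP; left; apply/eqP; ring.
  suff -> : (c * (c * dot u u) + s * (c * dot u v) + (c * (s * dot u v) + s * (s * dot v v))) / c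
    = c * dot u u + s ^+ 2 * (dot v v / c) + s * (2 * dot u v).
    by rewrite s1 mul1r.
  by field.
have := E 1 (expr1n _ _); have := E (-1); rewrite sqrrN expr1n => /(_ erefl).
rewrite mulN1r mul1r ler_norml => ? ?; apply/andP; split; lra.
Qed.

Definition mprim (P p : R -> 'M[R]_2) : Prop :=
  forall i j, prim (fun x => P x i j) (fun x => p x i j).

Lemma mprim_ext P p Q q : mprim P p -> P =1 Q -> p =1 q -> mprim Q q.
Proof. by move=> Pp /funext <- /funext <-. Qed.

Lemma mprimD P p Q q : mprim P p -> mprim Q q ->
  mprim (fun x => P x + Q x) (fun x => p x + q x).
Proof.
by move=> Pp Qq i j; apply: prim_ext (primD (Pp i j) (Qq i j)) _ _ => x; rewrite mxE.
Qed.

Lemma mprimN P p : mprim P p -> mprim (fun x => - P x) (fun x => - p x).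
Proof.
by move=> Pp i j; apply: prim_ext (primN (Pp i j)) _ _ => x; rewrite mxE.
Qed.

Lemma mprimB P p Q q : mprim P p -> mprim Q q ->
  mprim (fun x => P x - Q x) (fun x => p x - q x).
Proof. by move=> Pp /mprimN; exact: mprimD. Qed.

Lemma mprimM P p Q q : mprim P p -> mprim Q q ->
  mprim (fun x => P x *m Q x) (fun x => p x *m Q x + P x *m q x).
Proof.
move=> Pp Qq i j.
apply: prim_ext (prim_sum (index_enum _) (fun k => primM (Pp i k) (Qq k j))) _ _ => x.
  by rewrite mxE.
by rewrite !mxE big_split.
Qed.

Lemma mprim_cst A : mprim (fun=> A) (fun=> 0).
Proof. by move=> i j; apply: prim_ext (prim_cst (A i j)) _ _ => x; rewrite ?mxE. Qed.

Lemma mprimMr P p A : mprim P p -> mprim (fun x => P x *m A) (fun x => p x *m A).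
Proof.
move=> Pp; apply: mprim_ext (mprimM Pp (mprim_cst A)) _ _ => x //.
by rewrite mulmx0 addr0.
Qed.

Lemma prim_dot P p Q q : mprim P p -> mprim Q q ->
  prim (fun x => dot (P x) (Q x)) (fun x => dot (p x) (Q x) + dot (P x) (q x)).
Proof.
move=> Pp Qq.
apply: prim_ext (prim_sum (index_enum _) (fun j => prim_sum (index_enum _)
   (fun i => primM (Pp i j) (Qq i j)))) _ _ => x.
  by rewrite dotE.
rewrite !dotE -big_split /=; apply: eq_bigr => j _.
by rewrite -big_split.
Qed.

Lemma mprim_cont P p : mprim P p -> forall i j, continuous (fun x => P x i j : R).
Proof. by move=> Pp i j; exact: prim_cont (Pp i j). Qed.

(* [susy W psi eta f] says that eta = (D + W) psi and (- D + W) eta = f, that is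
   (- D^2 + W^2 - W') psi = f. *)
Definition susy W psi eta f : Prop :=
  mprim psi (fun x => eta x - W x *m psi x) /\
  mprim eta (fun x => W x *m eta x - f x).

Lemma susyB W psi eta f psi' eta' f' : susy W psi eta f -> susy W psi' eta' f' ->
  susy W (fun x => psi x - psi' x) (fun x => eta x - eta' x) (fun x => f x - f' x).
Proof.
move=> [h1 h2] [h1' h2']; split.
  apply: mprim_ext (mprimB h1 h1') _ _ => x //.
  by rewrite mulmxBr !opprB addrACA [RHS]addrACA; congr (_ + _); rewrite addrC.
apply: mprim_ext (mprimB h2 h2') _ _ => x //.
by rewrite mulmxBr !opprB addrACA [RHS]addrACA; congr (_ + _); rewrite addrC.
Qed.

End MatrixValued.

(** * Energy estimates *)

Section Energy.
Variable R : realType.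
Implicit Types (psi eta f g : R -> 'M[R]_2) (W : R -> 'M[R]_2).
Local Notation mu := (@lebesgue_measure R).

Lemma prim_id : prim (fun x : R => x) (fun=> 1).
Proof.
by apply: der_prim => x; exact: cst_continuous.
Qed.

(** Square integrability with an explicit bound K for the squared norm, in terms of real integrals
    over compact intervals only; [sqi_in_L2] and [in_L2_sqi] translate to and from [in_L2]. *)
Definition sqi (K : R) psi : Prop :=
  [/\ forall i j, measurable_fun setT (fun x => psi x i j),
      locint (fun x => nsq (psi x)) &
      forall a b, a <= b -> \int[mu]_(x in `[a, b]) nsq (psi x) <= K].

Lemma sqi_prim K psi P a b : sqi K psi -> prim P (fun x => nsq (psi x)) ->
  a <= b -> P b - P a <= K.
Proof. by move=> [_ _ H] [_ E] ab; rewrite E // H. Qed.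

Lemma cont_nsq psi : (forall i j, continuous (fun x => psi x i j : R)) ->
  continuous (fun x => nsq (psi x) : R).
Proof.
move=> c x.
rewrite [X in continuous_at x X](_ : _ = fun y =>
   psi y 0 0 * psi y 0 0 + psi y 1 0 * psi y 1 0 + (psi y 0 1 * psi y 0 1 + psi y 1 1 * psi y 1 1)).
  by apply: cvgD; apply: cvgD; apply: cvgM; exact: c.
by apply/funext => y; rewrite nsqE !expr2.
Qed.

Lemma sqi_cont psi K P : (forall i j, continuous (fun x => psi x i j : R)) ->
  prim P (fun x => nsq (psi x)) ->
  (forall X, 0 < X -> P X - P (- X) <= K) -> sqi K psi.
Proof.
move=> c pP H; split.
- by move=> i j; exact: continuous_measurable_fun.
- exact: pP.1.
move=> a b ab; rewrite -pP.2 //.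
pose X := `|a| + `|b| + 1.
have aX : - X <= a.
  by have := ler_norm (- a); rewrite normrN /X; have := normr_ge0 b; lra.
have bX : b <= X.
  by have := ler_norm b; rewrite /X; have := normr_ge0 a; lra.
have n0 x y : x <= y -> P x <= P y.
  by move=> xy; apply: (prim_ge0 pP xy) => *; exact: nsq_ge0.
have X0 : 0 < X by rewrite /X; have := normr_ge0 a; have := normr_ge0 b; lra.
have := H X X0; have := n0 _ _ aX; have := n0 _ _ bX; lra.
Qed.

Lemma sqi_le K K' psi : K <= K' -> sqi K psi -> sqi K' psi.
Proof.
by move=> KK [h1 h2 h3]; split => // a b ab; apply: le_trans (h3 _ _ ab) KK.
Qed.

Lemma sqi_ge0 K psi : sqi K psi -> 0 <= K.
Proof.
move=> [_ _ /(_ 0 0 (lexx _))]; apply: le_trans.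
by apply: Rintegral_ge0 => x _; exact: nsq_ge0.
Qed.

(* A cut-off at N, multiplying the flux <psi, eta> in the energy identities. *)
Definition chi (N x : R) : R := 1 - (N ^+ 2)^-1 * (x * x).
Definition dchi (N x : R) : R := - ((N ^+ 2)^-1 * (x + x)).

Lemma prim_chi N : prim (chi N) (dchi N).
Proof.
apply: prim_ext (primB (prim_cst 1) (primZ (N ^+ 2)^-1 (primM prim_id prim_id))) _ _ => x //.
by rewrite /dchi mul1r mulr1 sub0r.
Qed.

Lemma chi_bounds N x : 0 < N -> `|x| <= N ->
  [/\ 0 <= chi N x ^+ 2, chi N x ^+ 2 <= 1 & dchi N x ^+ 2 <= 4 / N ^+ 2].
Proof.
move=> N0 xN.
have x2 : x * x <= N ^+ 2.
  by rewrite -expr2 -(real_normK (num_real x)) lerXn2r // nnegrE ltW.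
have N2 : 0 < N ^+ 2 by rewrite exprn_gt0.
have y0 : 0 <= (N ^+ 2)^-1 * (x * x) by apply: mulr_ge0; [rewrite invr_ge0 ltW|rewrite -expr2 sqr_ge0].
have y1 : (N ^+ 2)^-1 * (x * x) <= 1 by rewrite mulrC ler_pdivrMr ?mul1r.
rewrite /chi /dchi; split; [exact: sqr_ge0| |].
  by rewrite expr_le1 //; lra.
rewrite (_ : _ ^+ 2 = (4 / N ^+ 2) * ((N ^+ 2)^-1 * (x * x))); last first.
  by rewrite sqrrN; field; rewrite gt_eqF.
by rewrite ler_piMr // divr_ge0 ?ltW.
Qed.

Lemma chi_half N x : 0 < N -> `|x| <= N / 2 -> 9 / 16 <= chi N x ^+ 2.
Proof.
move=> N0 xN.
have x2 : x * x <= N ^+ 2 / 4.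
  rewrite (_ : N ^+ 2 / 4 = (N / 2) ^+ 2); last by field.
  by rewrite -expr2 -(real_normK (num_real x)) lerXn2r // nnegrE; lra.
have N2 : 0 < N ^+ 2 by rewrite exprn_gt0.
have y1 : (N ^+ 2)^-1 * (x * x) <= 1 / 4.
  by rewrite mulrC ler_pdivrMr //; lra.
have : 3 / 4 <= chi N x by rewrite /chi; lra.
move=> h; rewrite (_ : 9 / 16 = (3 / 4) ^+ 2); last by field.
by rewrite lerXn2r // nnegrE; lra.
Qed.

Lemma dot_symm (A u v : 'M[R]_2) : A^T = A -> dot (A *m u) v = dot u (A *m v).
Proof. by move=> s; rewrite dot_mull s. Qed.

(** As W is symmetric, it drops out of the derivative of <psi, eta>, which is |eta|^2 - <psi, f>;
    the first term is due to the cut-off. *)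
Lemma prim_energy W psi eta f N : (forall x, (W x)^T = W x) -> susy W psi eta f ->
  prim (fun x => chi N x ^+ 2 * dot (psi x) (eta x))
   (fun x => 2 * dot ((dchi N x) *: psi x) (chi N x *: eta x) +
             chi N x ^+ 2 * (nsq (eta x) - dot (psi x) (f x))).
Proof.
move=> sW [h1 h2].
apply: prim_ext (primM (primM (prim_chi N) (prim_chi N)) (prim_dot h1 h2)) _ _ => x.
  by rewrite expr2.
rewrite !dotDl !dotDr !dotNl !dotNr !dotZl !dotZr dot_symm // /nsq; ring.
Qed.

(** The integral of [h] over [- N, N] vanishes. Bounding [h] below on the inner half, where the
    cut-off is bounded away from zero, and more crudely on the rest, leaves an estimate for [e] on
    the inner half. *)
Lemma energy_split (H h E e Q q : R -> R) N : prim H h -> prim E e -> prim Q q ->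
  0 < N -> H N = 0 -> H (- N) = 0 ->
  (forall x, `|x| <= N -> - q x <= h x) ->
  (forall x, `|x| <= N / 2 -> e x - q x <= h x) ->
  E (N / 2) - E (- (N / 2)) <= Q N - Q (- N).
Proof.
move=> pH pE pQ N0 HN HN' h1 h2.
have i1 : - N <= - (N / 2) by lra.
have i2 : - (N / 2) <= N / 2 by lra.
have i3 : N / 2 <= N by lra.
have nrm (x M : R) : - M <= x <= M -> `|x| <= M by rewrite ler_norml.
have := prim_le (primN pQ) pH i1.
have := prim_le (primB pE pQ) pH i2.
have := prim_le (primN pQ) pH i3.
move=> A B C.
have := A (fun x hx => h1 x (nrm x N ltac:(case/andP: hx => *; apply/andP; split; lra))).
have := B (fun x hx => h2 x (nrm x (N / 2) hx)).
have := C (fun x hx => h1 x (nrm x N ltac:(case/andP: hx => *; apply/andP; split; lra))).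
lra.
Qed.

Lemma chiN0 (N : R) : 0 < N -> chi N N = 0 /\ chi N (- N) = 0.
Proof.
move=> N0; rewrite /chi mulrNN -expr2 mulVf ?subrr //.
by rewrite sqrf_eq0 gt_eqF.
Qed.

Lemma nsqZ (c : R) u : nsq (c *: u) = c ^+ 2 * nsq u.
Proof. by rewrite /nsq dotZl dotZr mulrA expr2. Qed.

Lemma susy_eta_cont W psi eta f : susy W psi eta f ->
  (forall i j, continuous (fun x => psi x i j : R)) /\
  (forall i j, continuous (fun x => eta x i j : R)).
Proof. by move=> [h1 h2]; split; [exact: mprim_cont h1|exact: mprim_cont h2]. Qed.

(** An estimate of Caccioppoli type: eta = (D + W) psi is in L_2 although psi' and W psi separately
    are not known to be. The cross term of the cut-off is absorbed by half of |eta|^2. *)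
Lemma susy_eta_sqi W psi eta f K1 K2 : (forall x, (W x)^T = W x) ->
  susy W psi eta f -> sqi K1 psi -> sqi K2 f -> sqi (32 * (K1 + K2)) eta.
Proof.
move=> sW S s1 s2.
have [cpsi ceta] := susy_eta_cont S.
have [E pE] := prim_exists (locint_cont (cont_nsq ceta)).
have [P1 pP1] : exists P, prim P (fun x => nsq (psi x)).
  by apply: prim_exists; case: s1.
have [P2 pP2] : exists P, prim P (fun x => nsq (f x)).
  by apply: prim_exists; case: s2.
apply: (sqi_cont ceta pE) => X X0.
pose N := 2 * X + 2.
have N0 : 0 < N by rewrite /N; lra.
have N2 : 1 <= N ^+ 2 by rewrite expr_ge1 // /N; lra.
have iN : 4 / N ^+ 2 <= 4 by rewrite ler_pdivrMr; nra.
have [z1 z2] := chiN0 N0.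
(* 9 / 32 is half of the lower bound 9 / 16 of the squared cut-off on the inner half. Young's
   inequality leaves 8 + 1 / 2 times |psi|^2 and 1 / 2 times |f|^2, both below 9; and 9 / (9 / 32) =
   32. *)
have := energy_split (prim_energy N sW S) (primZ (9 / 32) pE)
  (primZ 9 (primD pP1 pP2)) N0.
rewrite z1 z2 expr0n /= !mul0r => /(_ erefl erefl).
have low x : `|x| <= N -> (chi N x ^+ 2) * nsq (eta x) / 2 - 9 * (nsq (psi x) + nsq (f x)) <=
   2 * dot (dchi N x *: psi x) (chi N x *: eta x) +
             chi N x ^+ 2 * (nsq (eta x) - dot (psi x) (f x)).
  move=> xN; have [c0 c1 d1] := chi_bounds N0 xN.
  have := @dot_young R 2 (dchi N x *: psi x) (chi N x *: eta x) ltac:(lra).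
  have := @dot_young R 1 (psi x) (f x) ltac:(lra).
  rewrite !nsqZ !ler_norml => /andP[_ y1] /andP[y2 _].
  have := nsq_ge0 (psi x); have := nsq_ge0 (f x); have := nsq_ge0 (eta x) => e0 f0 p0.
  have d4 : dchi N x ^+ 2 * nsq (psi x) <= 4 * nsq (psi x) by rewrite ler_wpM2r //; lra.
  have : chi N x ^+ 2 * (2 * dot (psi x) (f x)) <= nsq (psi x) + nsq (f x).
    apply: (@le_trans _ _ (chi N x ^+ 2 * (nsq (psi x) + nsq (f x)))).
      by rewrite ler_wpM2l //; lra.
    by rewrite ler_piMl //; lra.
  lra.
have l1 x : `|x| <= N -> - (9 * (nsq (psi x) + nsq (f x))) <=
   2 * dot (dchi N x *: psi x) (chi N x *: eta x) +
             chi N x ^+ 2 * (nsq (eta x) - dot (psi x) (f x)).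
  move=> xN; apply: le_trans (low _ xN).
  have [c0 c1 d1] := chi_bounds N0 xN.
  by have := mulr_ge0 c0 (nsq_ge0 (eta x)); lra.
have l2 x : `|x| <= N / 2 -> 9 / 32 * nsq (eta x) - (9 * (nsq (psi x) + nsq (f x))) <=
   2 * dot (dchi N x *: psi x) (chi N x *: eta x) +
             chi N x ^+ 2 * (nsq (eta x) - dot (psi x) (f x)).
  move=> xN; have xN' : `|x| <= N by lra.
  apply: le_trans (low _ xN').
  have := chi_half N0 xN => c9.
  have : 9 / 16 * nsq (eta x) <= chi N x ^+ 2 * nsq (eta x) by rewrite ler_wpM2r // nsq_ge0.
  lra.
move=> /(_ l1 l2).
have NN : - N <= N by lra.
have := sqi_prim s1 pP1 NN; have := sqi_prim s2 pP2 NN.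
have n0 x y : x <= y -> E x <= E y.
  by move=> xy; apply: (prim_ge0 pE xy) => *; exact: nsq_ge0.
have := n0 X (N / 2) ltac:(rewrite /N; lra).
have := n0 (- (N / 2)) (- X) ltac:(rewrite /N; lra).
lra.
Qed.

(** The error of the cut-off is O(1 / N^2) times the integral of |psi|^2 over [- N, N], so linear
    growth of that integral suffices and psi need not be in L_2 beforehand. This applies to bounded
    functions as well as to functions in L_2. *)
Lemma susy_coercive W psi eta f g l Kg C P : (forall x, (W x)^T = W x) -> l < 0 ->
  susy W psi eta f -> (forall x, dot (psi x) (f x) = dot (psi x) (g x) + l * nsq (psi x)) ->
  sqi Kg g -> prim P (fun x => nsq (psi x)) ->
  (forall N, 1 <= N -> P N - P (- N) <= C * N) ->
  sqi (16 / 9 * (Kg / l ^+ 2)) psi.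
Proof.
move=> sW l0 S fE sg pP gr.
have [cpsi ceta] := susy_eta_cont S.
have [P2 pP2] : exists P, prim P (fun x => nsq (g x)).
  by apply: prim_exists; case: sg.
apply: (sqi_cont cpsi pP) => X X0.
have ln : l != 0 by rewrite lt_eqF.
suff key N : 2 * X + 2 <= N -> (9 / 32 * - l) * (P X - P (- X)) <= Kg / (2 * - l) + 4 * C / N.
  have [C' C0 CC] : exists2 C', 0 < C' & 4 * C <= C'.
    exists (4 * `|C| + 1); first by have := normr_ge0 C; lra.
    by have := ler_norm C; lra.
  have k2 : (9 / 32 * - l) * (P X - P (- X)) <= Kg / (2 * - l).
    apply/ler_addgt0Pr => e e0.
    pose N := 2 * X + 2 + C' / e.
    have c0 : 0 < C' / e by rewrite divr_gt0.
    have N0 : 0 < N by rewrite /N; lra.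
    apply: le_trans (key N _) _; first by rewrite /N; lra.
    rewrite lerD2l ler_pdivrMr //; apply: (le_trans CC).
    rewrite /N mulrDr (mulrC e (C' / e)) divfK ?gt_eqF //.
    by have := mulr_ge0 (ltW e0) (ltac:(lra) : 0 <= 2 * X + 2); lra.
  have E : 16 / 9 * (Kg / l ^+ 2) = (Kg / (2 * - l)) / (9 / 32 * - l) by field.
  rewrite E ler_pdivlMr; first by rewrite mulrC.
  lra.
move=> hN; have N0 : 0 < N by lra.
have N1 : 1 <= N by lra.
have [z1 z2] := chiN0 N0.
have := energy_split (prim_energy N sW S) (primZ (9 / 32 * - l) pP)
  (primD (primZ (2 * - l)^-1 pP2) (primZ (4 / N ^+ 2) pP)) N0.
rewrite z1 z2 expr0n /= !mul0r => /(_ erefl erefl).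
have low x : `|x| <= N -> (chi N x ^+ 2) * (- l / 2 * nsq (psi x)) -
     ((2 * - l)^-1 * nsq (g x) + 4 / N ^+ 2 * nsq (psi x)) <=
   2 * dot (dchi N x *: psi x) (chi N x *: eta x) +
             chi N x ^+ 2 * (nsq (eta x) - dot (psi x) (f x)).
  move=> xN; have [c0 c1 d1] := chi_bounds N0 xN.
  have := @dot_young R 1 (dchi N x *: psi x) (chi N x *: eta x) ltac:(lra).
  have := @dot_young R (- l) (psi x) (g x) ltac:(lra).
  rewrite fE !nsqZ !ler_norml => /andP[_ y1] /andP[y2 _].
  have := nsq_ge0 (psi x); have := nsq_ge0 (g x); have := nsq_ge0 (eta x) => e0 f0 p0.
  have d4 : dchi N x ^+ 2 * nsq (psi x) <= 4 / N ^+ 2 * nsq (psi x) by rewrite ler_wpM2r //; lra.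
  have i0 : 0 <= (2 * - l)^-1 by rewrite invr_ge0; lra.
  have E2 : nsq (g x) / - l = 2 * ((2 * - l)^-1 * nsq (g x)) by field.
  have g0 : 0 <= (2 * - l)^-1 * nsq (g x) by rewrite mulr_ge0.
  rewrite E2 in y1.
  have : chi N x ^+ 2 * (dot (psi x) (g x)) <=
     chi N x ^+ 2 * (- l / 2 * nsq (psi x)) + (2 * - l)^-1 * nsq (g x).
    apply: (@le_trans _ _ (chi N x ^+ 2 * (- l / 2 * nsq (psi x) + (2 * - l)^-1 * nsq (g x)))).
      by rewrite ler_wpM2l //; lra.
    by rewrite mulrDr lerD2l ler_piMl.
  lra.
have lp x : 0 <= - l / 2 * nsq (psi x) by rewrite mulr_ge0 ?nsq_ge0 //; lra.
have l1 x : `|x| <= N -> - ((2 * - l)^-1 * nsq (g x) + 4 / N ^+ 2 * nsq (psi x)) <=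
   2 * dot (dchi N x *: psi x) (chi N x *: eta x) +
             chi N x ^+ 2 * (nsq (eta x) - dot (psi x) (f x)).
  move=> xN; apply: le_trans (low _ xN).
  have [c0 c1 d1] := chi_bounds N0 xN.
  by have := mulr_ge0 c0 (lp x); lra.
have l2 x : `|x| <= N / 2 -> 9 / 32 * - l * nsq (psi x) -
     ((2 * - l)^-1 * nsq (g x) + 4 / N ^+ 2 * nsq (psi x)) <=
   2 * dot (dchi N x *: psi x) (chi N x *: eta x) +
             chi N x ^+ 2 * (nsq (eta x) - dot (psi x) (f x)).
  move=> xN; have xN' : `|x| <= N by lra.
  apply: le_trans (low _ xN').
  have := chi_half N0 xN => c9.
  have : 9 / 16 * (- l / 2 * nsq (psi x)) <= chi N x ^+ 2 * (- l / 2 * nsq (psi x)) by rewrite ler_wpM2r.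
  lra.
move=> /(_ l1 l2).
have NN : - N <= N by lra.
have k1 : (2 * - l)^-1 * (P2 N - P2 (- N)) <= Kg / (2 * - l).
  rewrite mulrC ler_wpM2r ?invr_ge0; [|lra|exact: (sqi_prim sg pP2 NN)].
  done.
have k2 : 4 / N ^+ 2 * (P N - P (- N)) <= 4 * C / N.
  apply: (@le_trans _ _ (4 / N ^+ 2 * (C * N))).
    by rewrite ler_wpM2l ?gr // divr_ge0 // exprn_ge0 // ltW.
  by rewrite le_eqVlt; apply/orP; left; apply/eqP; field; rewrite gt_eqF.
have n0 x y : x <= y -> P x <= P y.
  by move=> xy; apply: (prim_ge0 pP xy) => *; exact: nsq_ge0.
have m1 := n0 X (N / 2) ltac:(lra).
have m2 := n0 (- (N / 2)) (- X) ltac:(lra).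
have : 9 / 32 * - l * (P X - P (- X)) <= 9 / 32 * - l * (P (N / 2) - P (- (N / 2))).
  by rewrite ler_wpM2l //; lra.
lra.
Qed.

(** A^* A psi = 0 forces A psi = 0: with f = 0 the energy identity loses only the cut-off term, O(1
    / N^2) times the squared norm of psi, so the integral of |eta|^2 vanishes in the limit. *)
Lemma susy_ker W psi eta K : (forall x, (W x)^T = W x) ->
  susy W psi eta (fun=> 0) -> sqi K psi -> forall x, eta x = 0.
Proof.
move=> sW S s1.
have [cpsi ceta] := susy_eta_cont S.
have cn := cont_nsq ceta.
have [E pE] := prim_exists (locint_cont cn).
have [P pP] : exists P, prim P (fun x => nsq (psi x)).
  by apply: prim_exists; case: s1.
have K0 := sqi_ge0 s1.
have n0 x y : x <= y -> E x <= E y.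
  by move=> xy; apply: (prim_ge0 pE xy) => *; exact: nsq_ge0.
have key X N : 0 < X -> 2 * X + 2 <= N -> 9 / 32 * (E X - E (- X)) <= 8 * K / N.
  move=> X0 hN; have N0 : 0 < N by lra.
  have [z1 z2] := chiN0 N0.
  have := energy_split (prim_energy N sW S) (primZ (9 / 32) pE)
    (primZ (8 / N ^+ 2) pP) N0.
  rewrite z1 z2 expr0n /= !mul0r => /(_ erefl erefl).
  have low x : `|x| <= N -> (chi N x ^+ 2) * nsq (eta x) / 2 - 8 / N ^+ 2 * nsq (psi x) <=
   2 * dot (dchi N x *: psi x) (chi N x *: eta x) +
             chi N x ^+ 2 * (nsq (eta x) - dot (psi x) 0).
    move=> xN; have [c0 c1 d1] := chi_bounds N0 xN.
    have := @dot_young R 2 (dchi N x *: psi x) (chi N x *: eta x) ltac:(lra).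
    rewrite (_ : dot (psi x) 0 = 0); last by rewrite -(scale0r 0) dotZr mul0r.
    rewrite !nsqZ !ler_norml => /andP[y2 _].
    have d4 : dchi N x ^+ 2 * nsq (psi x) <= 4 / N ^+ 2 * nsq (psi x).
      by rewrite ler_wpM2r // nsq_ge0.
    lra.
  have np x : 0 <= 8 / N ^+ 2 * nsq (psi x).
    by rewrite mulr_ge0 ?nsq_ge0 // divr_ge0 // exprn_ge0 // ltW.
  have l1 x : `|x| <= N -> - (8 / N ^+ 2 * nsq (psi x)) <=
   2 * dot (dchi N x *: psi x) (chi N x *: eta x) +
             chi N x ^+ 2 * (nsq (eta x) - dot (psi x) 0).
    move=> xN; apply: le_trans (low _ xN).
    have [c0 c1 d1] := chi_bounds N0 xN.
    by have := mulr_ge0 c0 (nsq_ge0 (eta x)); lra.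
  have l2 x : `|x| <= N / 2 -> 9 / 32 * nsq (eta x) - 8 / N ^+ 2 * nsq (psi x) <=
   2 * dot (dchi N x *: psi x) (chi N x *: eta x) +
             chi N x ^+ 2 * (nsq (eta x) - dot (psi x) 0).
    move=> xN; have xN' : `|x| <= N by lra.
    apply: le_trans (low _ xN').
    have := chi_half N0 xN => c9.
    have : 9 / 16 * nsq (eta x) <= chi N x ^+ 2 * nsq (eta x) by rewrite ler_wpM2r // nsq_ge0.
    lra.
  move=> /(_ l1 l2).
  have NN : - N <= N by lra.
  have k2 : 8 / N ^+ 2 * (P N - P (- N)) <= 8 * K / N.
    apply: (@le_trans _ _ (8 / N ^+ 2 * K)).
      rewrite ler_wpM2l ?(sqi_prim s1 pP NN) // divr_ge0 // exprn_ge0 // ltW //.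
    rewrite mulrAC ler_wpM2l ?mulr_ge0 // lef_pV2 ?posrE ?exprn_gt0 //.
    by rewrite expr2 ler_peMr; lra.
  have := n0 X (N / 2) ltac:(lra); have := n0 (- (N / 2)) (- X) ltac:(lra).
  lra.
have Ec X : 0 < X -> E X <= E (- X).
  move=> X0; apply/ler_addgt0Pr => e e0.
  pose N := 2 * X + 2 + 32 * K / e.
  have c0 : 0 <= 32 * K / e by apply: divr_ge0; [exact: mulr_ge0|exact: ltW].
  have N0 : 0 < N by rewrite /N; lra.
  have := key X N X0 ltac:(rewrite /N; lra).
  have : 8 * K / N <= e / 4.
    rewrite ler_pdivrMr // /N mulrDr (_ : e / 4 * (32 * K / e) = 8 * K); last first.
      by field; rewrite gt_eqF.
    by have := mulr_ge0 (ltW e0) (ltW X0); lra.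
  lra.
have pE0 : prim E (fun=> 0).
  have Eq x : E x = E 0.
    have := Ec (`|x| + 1) ltac:(have := normr_ge0 x; lra).
    have := n0 (- (`|x| + 1)) x; have := n0 x (`|x| + 1).
    have := n0 (- (`|x| + 1)) 0; have := n0 0 (`|x| + 1).
    have := normr_ge0 x; have := ler_norm x; have := ler_norm (- x); rewrite normrN.
    move=> h1 h2 h3 /(_ ltac:(lra)) ? /(_ ltac:(lra)) ? /(_ ltac:(lra)) ? /(_ ltac:(lra)) ? ?.
    lra.
  by apply: prim_ext (prim_cst (E 0)) _ _ => x.
move=> x; apply: nsq_eq0.
by apply: (prim_uniq pE pE0 cn) => y; exact: cst_continuous.
Qed.

End Energy.

(** * The resolvent far to the left *)

Section Limits.
Variable R : realType.

Lemma small_geo (C e : R) : 0 < e -> exists n, C / 2 ^+ n < e.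
Proof.
move=> e0; have [n hn] : exists n, C / e < n%:R.
  exists (Num.bound `|C / e|); apply: (le_lt_trans (ler_norm _)).
  by apply: archi_boundP.
exists n; rewrite ltr_pdivrMr ?exprn_gt0 // mulrC -ltr_pdivrMr //.
by apply: lt_le_trans hn _; rewrite -natrX ler_nat ltnW // ltn_expl.
Qed.

(** The limit is taken as the supremum of the lower bounds [a n x - d n]. Each of them lies below
    every [a p x + d p], which yields the rate at once. *)
Lemma geo_lim (a : nat -> R -> R) C :
  (forall n x, `|a n.+1 x - a n x| <= C / 2 ^+ n) ->
  exists b, forall n x, `|a n x - b x| <= 2 * C / 2 ^+ n.
Proof.
move=> H; pose d n := 2 * C / 2 ^+ n.
have dE n : d n - d n.+1 = C / 2 ^+ n.
  by rewrite /d exprS; field; rewrite expf_neq0.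
have C0 : 0 <= C by have := H 0%N 0; rewrite expr0 divr1; apply: le_trans.
have d0 n : 0 <= d n by rewrite /d divr_ge0 ?mulr_ge0 // exprn_ge0.
have step n p x : `|a (n + p)%N x - a n x| <= d n - d (n + p)%N.
  elim: p => [|p IH]; first by rewrite addn0 !subrr normr0.
  rewrite addnS (_ : _ - _ = (a (n + p).+1 x - a (n + p)%N x) + (a (n + p)%N x - a n x)); last by ring.
  apply: le_trans (ler_normD _ _) _.
  by have := H (n + p)%N x; rewrite -dE; lra.
have cross n p x : a n x - d n <= a p x + d p.
  have [np|pn] := leqP n p.
    have := step n (p - n)%N x; rewrite subnKC // ler_norml => /andP[? ?].
    by have := d0 p; lra.
  have := step p (n - p)%N x; rewrite subnKC ?(ltnW pn) // ler_norml => /andP[? ?].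
  by have := d0 n; lra.
exists (fun x => sup [set a n x - d n | n in [set: nat]]) => n x.
have ne : [set a n x - d n | n in [set: nat]] !=set0 by exists (a 0%N x - d 0%N), 0%N.
have h1 : a n x - d n <= sup [set a n x - d n | n in [set: nat]].
  apply: ub_le_sup; last by exists n.
  by exists (a 0%N x + d 0%N) => _ [p _ <-].
have h2 : sup [set a n x - d n | n in [set: nat]] <= a n x + d n.
  by apply: ge_sup => // _ [p _ <-].
by rewrite -/(d n) ler_norml; apply/andP; split; lra.
Qed.

Lemma unif_cont (a : nat -> R -> R) b C : (forall n, continuous (a n)) ->
  (forall n x, `|a n x - b x| <= C / 2 ^+ n) -> continuous b.
Proof.
move=> ca H x; apply/cvgrPdist_lt => e e0.
have e3 : 0 < e / 3 by lra.
have [n hn] := small_geo C e3.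
have := ca n x; move/cvgrPdist_lt => /(_ _ e3).
apply: filterS => y hy.
have := H n x; have := H n y; rewrite (distrC (a n x)) => h1 h2.
rewrite (_ : b x - b y = (b x - a n x) + ((a n x - a n y) + (a n y - b y))); last by ring.
apply: le_lt_trans (ler_normD _ _) _.
have := ler_normD (a n x - a n y) (a n y - b y); lra.
Qed.

(** The derivatives converge only relative to a locally integrable weight [b]; it will be 1 + v,
    which is unbounded. *)
Lemma prim_lim (F f : nat -> R -> R) G g (b : R -> R) C :
  (forall n, prim (F n) (f n)) -> locint g -> locint b ->
  (forall n x, `|F n x - G x| <= C / 2 ^+ n) ->
  (forall n x, `|f n x - g x| <= C / 2 ^+ n * b x) -> prim G g.
Proof.
move=> pF lg lb H1 H2; split => // s t st.
have [P pP] := prim_exists lg; have [B pB] := prim_exists lb.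
rewrite -pP.2 //.
suff key e : 0 < e -> `|(G t - G s) - (P t - P s)| <= e.
  by apply/eqP; rewrite -subr_eq0 -normr_le0; apply/ler_addgt0Pr => e; rewrite add0r; exact: key.
move=> e0.
have [n hn] := small_geo (C * (2 + (B t - B s))) e0.
have := prim_abs (primB (pF n) pP) (primZ (C / 2 ^+ n) pB) st (fun x _ => H2 n x).
have := H1 n t; have := H1 n s; move=> h1 h2 h3.
have E : C * (2 + (B t - B s)) / 2 ^+ n = 2 * (C / 2 ^+ n) + (C / 2 ^+ n * B t - C / 2 ^+ n * B s).
  by field; rewrite expf_neq0.
rewrite (_ : _ - _ = - (F n t - G t) + ((F n s - G s) +
   (F n t - P t - (F n s - P s)))); last by ring.
apply: le_trans (ler_normD _ _) _; rewrite normrN.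
have := ler_normD (F n s - G s) (F n t - P t - (F n s - P s)); lra.
Qed.

End Limits.

(** * Bounded solutions of the first-order equations (D + v) u = f and (- D + v) u = f *)

Section ScalarEquation.
Variables (R : realType) (sg m : R) (v V : R -> R).
Hypothesis sgE : sg = 1 \/ sg = -1.
Hypothesis m0 : 0 < m.
Hypothesis cv : continuous v.
Hypothesis vm : forall x, m <= v x.
Hypothesis pV : prim V v.

(** The integrating factor: (Q u)' = sg Q f. It grows in the direction of sg and tends to zero in
    the opposite one, so the bounded solution is the one integrated from that opposite end. *)
Let Q x := expR (sg * V x).

Lemma weight_gt0 x : 0 < Q x. Proof. exact: expR_gt0. Qed.

Lemma sign_sqr : sg * sg = 1.
Proof. by case: sgE => ->; rewrite ?mulrNN mulr1. Qed.

Lemma prim_expR (c : R) : prim (fun x => expR (c * V x)) (fun x => c * v x * expR (c * V x)).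
Proof.
have cV := prim_cont pV.
have dV (x : R) : is_derive x (1 : R) V (v x) by apply: (prim_der pV); apply: cv.
have D (x : R) : is_derive x (1 : R) (fun x => expR (c * V x)) (c * v x * expR (c * V x)).
  have d1 : is_derive x 1 (fun x => c * V x) (c * v x) by apply: is_deriveZ.
  have := @is_derive1_comp R expR (fun x => c * V x) x _ _ (is_derive_expR _) d1.
  by rewrite mulrC.
apply: der_prim => x.
apply: cvgM; first by apply: cvgM; [exact: cvg_cst|exact: cv].
apply: (continuous_comp (f := fun x => c * V x)); last exact: continuous_expR.
by apply: cvgM; [exact: cvg_cst|exact: cV].
Qed.

(** Serves both signs at once: [sg * s <= sg * x] orders the points along the direction in which B
    increases. *)
Lemma prim_dir A a B b s x : prim A a -> prim B b -> (forall y, `|a y| <= sg * b y) ->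
  sg * s <= sg * x -> `|A x - A s| <= B x - B s.
Proof.
move=> pA pB ab; case: sgE => E; rewrite E ?mul1r ?mulN1r => sx.
  by apply: prim_abs pA pB sx _ => y _; have := ab y; rewrite E mul1r.
rewrite lerN2 in sx.
have := prim_abs pA (primN pB) sx; rewrite distrC => H.
by have := H (fun y _ => ltac:(by have := ab y; rewrite E mulN1r)); lra.
Qed.

Lemma weight_mono s x : sg * s <= sg * x -> Q s * (1 + m * (sg * x - sg * s)) <= Q x.
Proof.
move=> sx; have w0 := weight_gt0; have E : Q x = Q s * expR (sg * V x - sg * V s).
  by rewrite /Q -expRD addrC subrK.
rewrite E ler_pM2l //; apply: le_trans (expR_ge1Dx _); rewrite lerD2l.
have L (a b : R) : a <= b -> m * (b - a) <= V b - V a.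
  move=> ab; rewrite mulrBr.
  by apply: (prim_le (primZ m (@prim_id R)) pV ab) => y _; rewrite mulr1.
case: sgE sx => -> /=; rewrite ?mul1r ?mulN1r => sx.
  exact: L.
rewrite lerN2 in sx; have := L _ _ sx; lra.
Qed.

Lemma prim_weight u f : prim u (fun x => sg * (f x - v x * u x)) ->
  prim (fun x => Q x * u x) (fun x => sg * (Q x * f x)).
Proof.
move=> pu; apply: prim_ext (primM (prim_expR sg) pu) _ _ => x //.
by rewrite -/(Q x); ring.
Qed.

(** The increment of Q u is at most that of c Q, since c sg v Q is the derivative of c Q; the
    contribution of the starting point s disappears as s recedes, because u is bounded and Q tends
    to zero there. With c = 0 this is uniqueness. *)
Lemma decay_bound u f c B : prim u (fun x => sg * (f x - v x * u x)) ->
  (forall x, `|f x| <= c * v x) -> (forall x, `|u x| <= B) ->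
  forall x, `|u x| <= c.
Proof.
move=> pu fc uB x; have w0 := weight_gt0.
have B0 : 0 <= B by apply: le_trans (uB 0).
have v0 y : 0 < v y by apply: lt_le_trans (vm y).
have c0 : 0 <= c.
  by rewrite -(pmulr_lge0 _ (v0 0)); apply: le_trans (fc 0).
apply/ler_addgt0Pr => e e0.
(* Remote enough for [weight_mono] to give Q s B <= e Q x. *)
pose s := x - sg * (B / (m * e)).
have b0 : 0 <= B / (m * e) by rewrite divr_ge0 // mulr_ge0 // ltW.
have E : sg * x - sg * s = B / (m * e) by rewrite /s mulrBr opprB addrC subrK mulrA sign_sqr mul1r.
have sx : sg * s <= sg * x by rewrite -subr_ge0 E.
have := @prim_dir _ _ (fun y => c * Q y) _ s x (prim_weight pu) (primZ c (prim_expR sg)).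
have bd y : `|sg * (Q y * f y)| <= sg * (c * (sg * v y * Q y)).
  rewrite !normrM (gtr0_norm (weight_gt0 y)) (_ : sg * _ = sg * sg * (Q y * (c * v y))); last by ring.
  rewrite sign_sqr mul1r (_ : `|sg| = 1) ?mul1r ?ler_pM2l //.
  by case: sgE => ->; rewrite ?normrN normr1.
move=> /(_ bd sx) h1.
have := weight_mono sx; rewrite E => h2.
have h3 : Q s * B <= e * Q x.
  have : Q s * (m * (B / (m * e))) <= Q x by have := weight_gt0 s; lra.
  rewrite (_ : m * (B / (m * e)) = B / e); last by field; rewrite !gt_eqF.
  by rewrite mulrA ler_pdivrMr // (mulrC e).
have h4 : `|Q s * u s| <= Q s * B by rewrite normrM (gtr0_norm (weight_gt0 s)) ler_pM2l.
have : Q x * `|u x| <= Q x * (c + e).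
  rewrite -{1}(gtr0_norm (weight_gt0 x)) -normrM.
  have := ler_normD (Q x * u x - Q s * u s) (Q s * u s); rewrite subrK.
  have : 0 <= c * Q s by rewrite mulr_ge0 // ltW.
  lra.
by rewrite ler_pM2l.
Qed.

(** The solution is (G - l) / Q, where G is a primitive of sg Q f and l is the limit of G at the end
    where Q tends to zero. The term [g] is allowed because the right-hand side of the resolvent
    equation is merely in L_2. *)
Lemma decay_exists f (g : R -> R) I c K : locint f -> measurable_fun setT g ->
  (forall x, `|f x| <= c * v x + `|g x|) -> 0 <= c ->
  prim I (fun x => g x ^+ 2) -> (forall a b, a <= b -> I b - I a <= K) ->
  exists u, prim u (fun x => sg * (f x - v x * u x)) /\ exists B, forall x, `|u x| <= B.
Proof.
move=> lf mg fg c0 pI IK; have w0 := weight_gt0.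
have K0 : 0 <= K by have := IK 0 0 (lexx _); rewrite subrr.
have cQ : continuous Q by exact: prim_cont (prim_expR sg).
have [G pG] := prim_exists (locintZ sg (locintM cQ lf)).
(* By the inequality of the means, Q y |g y| <= (Q y)^2 / (2 Q x) + Q x (g y)^2 / 2, and 2 m Q^2 is
   at most the derivative of Q^2 in the direction of sg. Integrated up to x, the three terms
   contribute c, 1 / (4 m) and K / 2 times Q x. *)
pose C := c + (4 * m)^-1 + K / 2.
have C0 : 0 <= C.
  by rewrite /C !addr_ge0 ?invr_ge0 ?divr_ge0 // mulr_ge0 // ltW.
have key s x : sg * s <= sg * x -> `|G x - G s| <= C * Q x.
  move=> sx; have Qx0 := weight_gt0 x.
  have pQQ := primM (prim_expR sg) (prim_expR sg).
  have := @prim_dir _ _ (fun y => c * Q y + ((4 * m * Q x)^-1 * (Q y * Q y) +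
        (Q x / 2) * (sg * I y))) _ s x pG
    (primD (primZ c (prim_expR sg)) (primD (primZ (4 * m * Q x)^-1 pQQ)
       (primZ (Q x / 2) (primZ sg pI)))).
  have bd y : `|sg * (Q y * f y)| <= sg * (c * (sg * v y * Q y) +
      ((4 * m * Q x)^-1 * (sg * v y * Q y * Q y + Q y * (sg * v y * Q y)) +
       Q x / 2 * (sg * g y ^+ 2))).
    rewrite !normrM (_ : `|sg| = 1); last by case: sgE => ->; rewrite ?normrN normr1.
    rewrite mul1r (gtr0_norm (weight_gt0 y)).
    rewrite (_ : sg * _ = sg * sg * (c * (v y * Q y) + ((4 * m * Q x)^-1 * (2 * v y * Q y ^+ 2) +
      Q x / 2 * g y ^+ 2))); last by ring.
    rewrite sign_sqr mul1r.
    have f1 : Q y * `|f y| <= Q y * (c * v y + `|g y|) by rewrite ler_pM2l.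
    have f2 : (4 * m * Q x)^-1 * (2 * m * Q y ^+ 2) <= (4 * m * Q x)^-1 * (2 * v y * Q y ^+ 2).
      rewrite ler_wpM2l ?invr_ge0 ?mulr_ge0 ?(ltW m0) ?(ltW Qx0) //.
      by rewrite ler_wpM2r ?sqr_ge0 // ler_wpM2l.
    have f3 : Q y * `|g y| <= (4 * m * Q x)^-1 * (2 * m * Q y ^+ 2) + Q x / 2 * g y ^+ 2.
      rewrite -(real_normK (num_real (g y))).
      rewrite -subr_ge0 (_ : _ - _ = (Q x / 2) * (Q y / Q x - `|g y|) ^+ 2).
        by rewrite mulr_ge0 ?sqr_ge0 // divr_ge0 // ltW.
      by field; rewrite !gt_eqF.
    lra.
  move=> /(_ bd sx).
  have i1 : `|I x - I s| <= K.
    have [xs|xs] := leP x s.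
      rewrite ler_norml; have := IK _ _ xs.
      have := prim_ge0 pI xs (fun y _ => sqr_ge0 _) => ? ?; apply/andP; split; lra.
    have xs' := ltW xs; rewrite ler_norml; have := IK _ _ xs'.
    have := prim_ge0 pI xs' (fun y _ => sqr_ge0 _) => ? ?; apply/andP; split; lra.
  have i2 : sg * (I x - I s) <= K.
    apply: le_trans (ler_norm _) _; rewrite normrM.
    by case: sgE => ->; rewrite ?normrN normr1 mul1r.
  have i3 : Q x / 2 * (sg * (I x - I s)) <= Q x / 2 * K.
    by rewrite ler_wpM2l // divr_ge0 // ltW.
  have i4 : (4 * m * Q x)^-1 * (Q x * Q x) = (4 * m)^-1 * Q x by field; rewrite !gt_eqF.
  have i5 : 0 <= (4 * m * Q x)^-1 * (Q s * Q s).
    by rewrite mulr_ge0 // ?invr_ge0 ?mulr_ge0 // ltW.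
  have i6 : 0 <= c * Q s by rewrite mulr_ge0 // ltW.
  rewrite /C; lra.
(* By [key], the intervals with centre G x and radius C Q x pairwise intersect; the supremum of
   their left ends lies in all of them, and is the limit of G where Q vanishes. *)
pose E := [set G x - C * Q x | x in [set: R]].
have cross x s : G x - C * Q x <= G s + C * Q s.
  have q1 : 0 <= C * Q x by rewrite mulr_ge0 // ltW.
  have q2 : 0 <= C * Q s by rewrite mulr_ge0 // ltW.
  case: (leP (sg * s) (sg * x)) => [sx|/ltW sx]; have := key _ _ sx; rewrite ler_norml => /andP[? ?]; lra.
have ne : E !=set0 by exists (G 0 - C * Q 0), 0.
pose l := sup E.
have l1 x : G x - C * Q x <= l.
  apply: ub_le_sup; last by exists x.
  by exists (G 0 + C * Q 0) => _ [p _ <-].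
have l2 x : l <= G x + C * Q x by apply: ge_sup => // _ [p _ <-].
have QN x : expR (- sg * V x) * Q x = 1 by rewrite /Q -expRD mulNr addNr expR0.
exists (fun x => expR (- sg * V x) * (G x - l)); split.
  apply: prim_ext (primM (prim_expR (- sg)) (primB pG (prim_cst l))) _ _ => x //.
  rewrite subr0 (_ : expR (- sg * V x) * (sg * (Q x * f x)) =
    expR (- sg * V x) * Q x * (sg * f x)); last by ring.
  by rewrite QN; ring.
exists C => x; rewrite normrM gtr0_norm ?expR_gt0 //.
have : `|G x - l| <= C * Q x.
  by rewrite ler_norml; apply/andP; split; have := l1 x; have := l2 x; lra.
rewrite -(ler_pM2l (expR_gt0 (- sg * V x))) => /le_trans; apply.
by rewrite mulrCA QN mulr1.
Qed.

End ScalarEquation.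

(** * The fixed-point iteration in the space of bounded functions *)

Section BaseCase.
Variable R : realType.
Implicit Types (X : 'M[R]_2) (P : R -> 'M[R]_2).

Lemma I2P (i : 'I_2) : i = 0 \/ i = 1.
Proof. by case: i => [[|[|//]] ?]; [left|right]; apply/val_inj. Qed.

Lemma mxDE (A B : 'M[R]_2) i j : (A + B) i j = A i j + B i j.
Proof. by rewrite mxE. Qed.

Lemma mxNE (A : 'M[R]_2) i j : (- A) i j = - A i j.
Proof. by rewrite mxE. Qed.

Lemma mxZE (c : R) (A : 'M[R]_2) i j : (c *: A) i j = c * A i j.
Proof. by rewrite mxE. Qed.

Definition mxOpE := (mxDE, mxNE, mxZE).

Lemma entry_w (A A' B B' G : 'M[R]_2) a i j :
  (a *: A - (G - B)) i j - (a *: A' - (G - B')) i j =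
  -1 * (- (B - B') i j - a * (A i j - A' i j)).
Proof. by rewrite !mxE; ring. Qed.

Lemma entry_u (A A' B B' : 'M[R]_2) a i j :
  (A - a *: B) i j - (A' - a *: B') i j =
  1 * ((A i j - A' i j) - a * (B i j - B' i j)).
Proof. by rewrite !mxE; ring. Qed.

Definition mcont P : Prop := forall i j, continuous (fun x => P x i j : R).

Lemma mcontD P Q : mcont P -> mcont Q -> mcont (fun x => P x + Q x).
Proof.
move=> cP cQ i j; rewrite [X in continuous X](_ : _ = fun x => P x i j + Q x i j).
  by move=> x; apply: cvgD; [exact: cP|exact: cQ].
by apply/funext => x; rewrite mxE.
Qed.

Lemma mcontZ (f : R -> R) P : continuous f -> mcont P -> mcont (fun x => f x *: P x).
Proof.
move=> cf cP i j; rewrite [X in continuous X](_ : _ = fun x => f x * P x i j).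
  by move=> x; apply: cvgM; [exact: cf|exact: cP].
by apply/funext => x; rewrite mxE.
Qed.

Lemma mcontN P : mcont P -> mcont (fun x => - P x).
Proof.
move=> cP; rewrite (_ : (fun x => _) = fun x => (-1 : R) *: P x).
  by apply: mcontZ => // x; exact: cst_continuous.
by apply/funext => x; rewrite scaleN1r.
Qed.

Lemma mcontM P Q : mcont P -> mcont Q -> mcont (fun x => P x *m Q x).
Proof.
move=> cP cQ i j.
rewrite [X in continuous X](_ : _ = fun x => P x i 0 * Q x 0 j + P x i 1 * Q x 1 j).
  by move=> x; apply: cvgD; apply: cvgM; (exact: cP || exact: cQ).
by apply/funext => x; rewrite mxE sum_I2.
Qed.

Lemma mcont_cst X : mcont (fun=> X).
Proof. by move=> i j x; exact: cst_continuous. Qed.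

Variables (W dW : R -> 'M[R]_2) (v dv V : R -> R) (m c l : R) (Lam : 'M[R]_2).
Hypothesis pW : mprim W dW.
Hypothesis cdW : mcont dW.
Hypothesis symW : forall x, (W x)^T = W x.
Hypothesis pv : prim v dv.
Hypothesis cdv : continuous dv.
Hypothesis pV : prim V v.
Hypothesis m0 : 0 < m.
Hypothesis vm : forall x, m <= v x.
Hypothesis c0 : 0 <= c.
Hypothesis cm : c <= m / 2.
Hypothesis l0 : l < 0.
Hypothesis LamE : forall X, dot X (X *m Lam) = l * nsq X.

(* The operator X -> (- D^2 + W^2 - W') X - X Lam is compared with the scalar
   operator (- D + v)(D + v), whose inverse is explicit; [remainder] is the
   difference, and c <= m / 2 makes the fixed-point iteration contract. *)
Definition remainder x X :=
  (W x *m W x - dW x) *m X - (v x ^+ 2 - dv x) *: X - X *m Lam.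

Hypothesis remainder_le : forall x X b, (forall i j, `|X i j| <= b) ->
  forall i j, `|remainder x X i j| <= c * v x * b.

Lemma remainderB x X Y : remainder x (X - Y) = remainder x X - remainder x Y.
Proof.
by apply/matrixP => i j; rewrite /remainder mulmxBr scalerBr (mulmxBl X) !mxE; ring.
Qed.

Lemma mcont_remainder P : mcont P -> mcont (fun x => remainder x (P x)).
Proof.
move=> cP; have cW : mcont W := mprim_cont pW.
have cv : continuous v := prim_cont pv.
have cv2 : continuous (fun x => v x ^+ 2 - dv x).
  move=> x; apply: cvgB; last by apply: cdv.
  by rewrite expr2; apply: cvgM; apply: cv.
apply: mcontD; last by apply/mcontN/mcontM => //; exact: mcont_cst.
apply: mcontD; last by apply/mcontN/mcontZ.
by apply: mcontM => //; apply: mcontD; [exact: mcontM|exact: mcontN].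
Qed.

(** A choice is made so that the iteration is a function. Under the hypotheses of [solutionP] the
    default 0 is not what [xget] falls back on, and the bounded solution is unique by
    [decay_bound]. *)
Definition solution (sg : R) (f : R -> R) : R -> R :=
  xget (fun=> 0) [set u | prim u (fun x => sg * (f x - v x * u x)) /\
                          exists B, forall x, `|u x| <= B].

Lemma solutionP sg (f g I : R -> R) b K : sg = 1 \/ sg = -1 ->
  locint f -> measurable_fun setT g ->
  (forall x, `|f x| <= b * v x + `|g x|) -> 0 <= b ->
  prim I (fun x => g x ^+ 2) -> (forall x y, x <= y -> I y - I x <= K) ->
  prim (solution sg f) (fun x => sg * (f x - v x * solution sg f x)) /\
  exists B, forall x, `|solution sg f x| <= B.
Proof.
move=> sgE lf mg fg b0 pI IK.
have [u Hu] := decay_exists sgE m0 (prim_cont pv) vm pV lf mg fg b0 pI IK.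
by have := @xgetPex _ (fun=> 0) [set u | prim u (fun x => sg * (f x - v x * u x)) /\
   exists B, forall x, `|u x| <= B] (ex_intro _ u Hu).
Qed.

Variables (g : R -> 'M[R]_2) (Kg : R).
Hypothesis gL2 : sqi Kg g.

(** One step of the iteration: (- D + v) w = g - remainder P, and then (D + v) u = w. A fixed point
    u = P solves the full equation. *)
Definition next_w (P : R -> 'M[R]_2) x : 'M[R]_2 :=
  \matrix_(i, j) solution (-1) (fun y => (g y - remainder y (P y)) i j) x.
Definition next_u (P : R -> 'M[R]_2) x : 'M[R]_2 :=
  \matrix_(i, j) solution 1 (fun y => next_w P y i j) x.
Definition iterate n : R -> 'M[R]_2 := iter n next_u (fun=> 0).

Definition mbounded P : Prop := exists B, forall x i j, `|P x i j| <= B.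

Lemma locint_g i j : locint (fun x => g x i j) /\ locint (fun x => g x i j ^+ 2).
Proof.
have [mg lg _] := gL2.
have lg2 : locint (fun x => g x i j ^+ 2).
  apply: (locint_le _ lg); first exact: measurable_funX.
  by move=> x; rewrite ger0_norm ?sqr_ge0 // entry_le_nsq.
split=> //.
have l1 : locint (fun x => 1 + g x i j ^+ 2).
  by apply: locintD => //; apply: locint_cont => x; exact: cst_continuous.
apply: (locint_le _ l1) => // x.
rewrite -(real_normK (num_real (g x i j))).
by have := sqr_ge0 (`|g x i j| - 1); have := sqr_ge0 (`|g x i j|); nra.
Qed.

Lemma next_wP P : mcont P -> mbounded P ->
  mprim (next_w P) (fun x => v x *: next_w P x - (g x - remainder x (P x))) /\
  mbounded (next_w P).
Proof.
move=> cP [B PB].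
have B0 : 0 <= B by apply: le_trans (PB 0 0 0).
have S i j : prim (fun x => next_w P x i j)
   (fun x => (v x *: next_w P x - (g x - remainder x (P x))) i j) /\
   exists B, forall x, `|next_w P x i j| <= B.
  have [lg lg2] := locint_g i j.
  have [I pI] := prim_exists lg2.
  have [N pN] : exists N, prim N (fun x => nsq (g x)) by apply: prim_exists; case: gL2.
  have [] := @solutionP (-1) (fun y => (g y - remainder y (P y)) i j) (fun y => g y i j) I (c * B) Kg.
  - by right.
  - rewrite (_ : (fun y => _) = fun y => g y i j + (- remainder y (P y)) i j).
      apply: locintD => //; apply: locint_cont.
      exact: (mcontN (mcont_remainder cP)).
    by apply/funext => y; rewrite mxE.
  - exact: lg.1.
  - move=> x; rewrite (_ : (g x - _) i j = g x i j - remainder x (P x) i j); last by rewrite !mxE.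
    rewrite addrC (le_trans (ler_normD _ _)) // normrN lerD2r.
    by have := remainder_le x (PB x) i j; rewrite mulrAC.
  - by rewrite mulr_ge0.
  - exact: pI.
  - move=> x y xy; apply: le_trans (sqi_prim gL2 pN xy).
    by apply: (prim_le pI pN xy) => t _; exact: entry_le_nsq.
  move=> h1 [B' h2]; split; last by exists B' => x; rewrite mxE.
  apply: prim_ext h1 _ _ => x; first by rewrite mxE.
  by rewrite !mxE; ring.
split; first by move=> i j; case: (S i j).
have [B00 h00] := (S 0 0).2; have [B01 h01] := (S 0 1).2.
have [B10 h10] := (S 1 0).2; have [B11 h11] := (S 1 1).2.
exists (Num.max (Num.max B00 B01) (Num.max B10 B11)) => x i j.
by rewrite !le_max; case: (I2P i) => ->; case: (I2P j) => ->;
  rewrite ?h00 ?h01 ?h10 ?h11 ?orbT.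
Qed.

Lemma next_uP P : mcont P -> mbounded P ->
  mprim (next_u P) (fun x => next_w P x - v x *: next_u P x) /\
  mbounded (next_u P).
Proof.
move=> cP bP; have [pw [B wB]] := next_wP cP bP.
have B0 : 0 <= B by apply: le_trans (wB 0 0 0).
have cw := mprim_cont pw.
have S i j : prim (fun x => next_u P x i j)
   (fun x => (next_w P x - v x *: next_u P x) i j) /\
   exists B, forall x, `|next_u P x i j| <= B.
  have [] := @solutionP 1 (fun y => next_w P y i j) (fun=> 0) (fun=> 0) (B / m) 0.
  - by left.
  - exact: locint_cont.
  - exact: measurable_cst.
  - move=> x; rewrite normr0 addr0; apply: le_trans (wB x i j) _.
    rewrite mulrAC ler_pdivlMr //; apply: ler_wpM2l => //; exact: vm.
  - by rewrite divr_ge0 // ltW.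
  - by apply: prim_ext (prim_cst 0) _ _ => x //; rewrite expr0n.
  - by move=> x y _; rewrite subrr.
  move=> h1 [B' h2]; split; last by exists B' => x; rewrite mxE.
  apply: prim_ext h1 _ _ => x; first by rewrite mxE.
  by rewrite !mxE; ring.
split; first by move=> i j; case: (S i j).
have [B00 h00] := (S 0 0).2; have [B01 h01] := (S 0 1).2.
have [B10 h10] := (S 1 0).2; have [B11 h11] := (S 1 1).2.
exists (Num.max (Num.max B00 B01) (Num.max B10 B11)) => x i j.
by rewrite !le_max; case: (I2P i) => ->; case: (I2P j) => ->;
  rewrite ?h00 ?h01 ?h10 ?h11 ?orbT.
Qed.

Lemma iterateP n : mcont (iterate n) /\ mbounded (iterate n).
Proof.
elim: n => [|n [cn bn]].
  split; first exact: mcont_cst.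
  by exists 0 => x i j; rewrite mxE normr0.
have [p b] := next_uP cn bn; split=> //.
exact: mprim_cont p.
Qed.

(** The remainders differ by at most c v b. Inverting - D + v divides this by v and leaves c b;
    inverting D + v divides by v >= m once more, and c / m <= 1 / 2. *)
Lemma contraction P Q b : mcont P -> mbounded P -> mcont Q -> mbounded Q ->
  (forall x i j, `|P x i j - Q x i j| <= b) ->
  (forall x i j, `|next_w P x i j - next_w Q x i j| <= c * b) /\
  (forall x i j, `|next_u P x i j - next_u Q x i j| <= b / 2).
Proof.
move=> cP bP cQ bQ PQ.
have [pwP [B1 wP]] := next_wP cP bP; have [pwQ [B2 wQ]] := next_wP cQ bQ.
have [puP [B3 uP]] := next_uP cP bP; have [puQ [B4 uQ]] := next_uP cQ bQ.
have b0 : 0 <= b by apply: le_trans (PQ 0 0 0).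
have cv : continuous v := prim_cont pv.
have wle : forall x i j, `|next_w P x i j - next_w Q x i j| <= c * b.
  move=> x i j.
  apply: (@decay_bound R (-1) m v V (or_intror erefl) m0 cv vm pV
    (fun y => next_w P y i j - next_w Q y i j)
    (fun y => - (remainder y (P y - Q y)) i j) (c * b) (B1 + B2)).
  - apply: prim_ext (primB (pwP i j) (pwQ i j)) _ _ => y //.
    by rewrite remainderB; exact: entry_w.
  - move=> y; rewrite normrN mulrAC; apply: remainder_le => i' j'.
    by rewrite !mxE.
  - by move=> y; rewrite (le_trans (ler_normB _ _)) // lerD.
split=> // x i j.
apply: (@decay_bound R 1 m v V (or_introl erefl) m0 cv vm pV
    (fun y => next_u P y i j - next_u Q y i j)
    (fun y => next_w P y i j - next_w Q y i j) (b / 2) (B3 + B4)).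
- apply: prim_ext (primB (puP i j) (puQ i j)) _ _ => y //.
  exact: entry_u.
- move=> y; apply: le_trans (wle y i j) _.
  apply: (@le_trans _ _ (m / 2 * b)); first by rewrite ler_wpM2r.
  by have := ler_wpM2l b0 (vm y); lra.
- by move=> y; rewrite (le_trans (ler_normB _ _)) // lerD.
Qed.

Lemma base_exists : exists psi eta,
  susy W psi eta (fun x => g x + psi x *m Lam) /\ sqi (16 / 9 * (Kg / l ^+ 2)) psi.
Proof.
have cv : continuous v := prim_cont pv.
have [b hb] : exists b, forall x i j, `|iterate 1 x i j - iterate 0 x i j| <= b.
  have [_ [B HB]] := iterateP 1; exists B => x i j.
  by rewrite /= !mxE subr0; have := HB x i j; rewrite /= mxE.
have b0 : 0 <= b by apply: le_trans (hb 0 0 0).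
have du n x i j : `|iterate n.+1 x i j - iterate n x i j| <= b / 2 ^+ n.
  elim: n x i j => [|n IH] x i j; first by rewrite expr0 divr1; exact: hb.
  have [c1 b1] := iterateP n.+1; have [c2 b2] := iterateP n.
  have [_ /(_ x i j)] := contraction c1 b1 c2 b2 IH.
  by rewrite exprSr invfM mulrA.
have dw n x i j : `|next_w (iterate n.+1) x i j - next_w (iterate n) x i j| <= c * b / 2 ^+ n.
  have [c1 b1] := iterateP n.+1; have [c2 b2] := iterateP n.
  have [/(_ x i j) + _] := contraction c1 b1 c2 b2 (du n).
  by rewrite mulrA.
have [U HU] : exists U : R -> 'M[R]_2, forall n x i j,
    `|iterate n x i j - U x i j| <= 2 * b / 2 ^+ n.
  pose L i j := cid (geo_lim (fun n x => du n x i j)).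
  exists (fun x => \matrix_(i, j) sval (L i j) x) => n x i j; rewrite [X in _ - X]mxE.
  by case: (L i j) => /= f; apply.
have [w Hw] : exists w : R -> 'M[R]_2, forall n x i j,
    `|next_w (iterate n) x i j - w x i j| <= 2 * (c * b) / 2 ^+ n.
  pose L i j := cid (geo_lim (fun n x => dw n x i j)).
  exists (fun x => \matrix_(i, j) sval (L i j) x) => n x i j; rewrite [X in _ - X]mxE.
  by case: (L i j) => /= f; apply.
have cU : mcont U.
  move=> i j; apply: (unif_cont (a := fun n x => iterate n x i j)) => [n|n x].
    by have [h _] := iterateP n; exact: h.
  exact: HU.
have cw : mcont w.
  move=> i j; apply: (unif_cont (a := fun n x => next_w (iterate n) x i j)) => [n|n x].
    have [h1 h2] := iterateP n; have [p _] := next_wP h1 h2.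
    exact: (mprim_cont p).
  exact: Hw.
have v0 x : 0 <= v x by apply: le_trans (ltW m0) (vm x).
have lv1 : locint (fun x => 1 + v x).
  by apply: locint_cont => x; apply: cvgD; [exact: cvg_cst|exact: cv].
pose C := 4 * (1 + c) * b.
have i2 n : 0 <= (2 ^+ n : R)^-1 by rewrite invr_ge0 exprn_ge0.
have half n : (2 ^+ n.+1 : R)^-1 <= (2 ^+ n)^-1.
  by rewrite lef_pV2 ?posrE ?exprn_gt0 // ler_weXn2l // ler1n.
have bi n : 0 <= b / 2 ^+ n by rewrite mulr_ge0.
have cbi n : 0 <= c * (b / 2 ^+ n) by rewrite mulr_ge0.
have CE n : C / 2 ^+ n = 4 * (b / 2 ^+ n) + 4 * (c * (b / 2 ^+ n)) by rewrite /C; ring.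
have pU : mprim U (fun x => w x - v x *: U x).
  move=> i j.
  apply: (@prim_lim R (fun n x => iterate n.+1 x i j)
    (fun n x => (next_w (iterate n) x - v x *: iterate n.+1 x) i j)
    _ _ (fun x => 1 + v x) C) => //.
  - move=> n; have [h1 h2] := iterateP n; have [p _] := next_uP h1 h2.
    exact: p.
  - apply: locint_cont.
    by apply: mcontD => //; apply/mcontN/mcontZ.
  - move=> n x; apply: le_trans (HU n.+1 x i j) _; rewrite CE.
    have : 2 * b / 2 ^+ n.+1 <= 2 * b / 2 ^+ n by rewrite ler_wpM2l ?mulr_ge0.
    by have := bi n; have := cbi n; lra.
  - move=> n x.
    rewrite (_ : _ - _ = (next_w (iterate n) x i j - w x i j) -
       v x * (iterate n.+1 x i j - U x i j)); last by rewrite !mxOpE; ring.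
    apply: le_trans (ler_normB _ _) _; rewrite normrM (ger0_norm (v0 x)).
    have h1 := Hw n x i j.
    have h2 : `|iterate n.+1 x i j - U x i j| <= 2 * b / 2 ^+ n.
      by apply: le_trans (HU n.+1 x i j) _; rewrite ler_wpM2l ?mulr_ge0.
    have h3 := ler_wpM2l (v0 x) h2.
    have e1 : 0 <= v x * (b / 2 ^+ n) by rewrite mulr_ge0.
    have e2 : 0 <= v x * (c * (b / 2 ^+ n)) by rewrite mulr_ge0.
    rewrite CE; have := bi n; have := cbi n; lra.
have pw : mprim w (fun x => v x *: w x - (g x - remainder x (U x))).
  move=> i j.
  apply: (@prim_lim R (fun n x => next_w (iterate n) x i j)
    (fun n x => (v x *: next_w (iterate n) x - (g x - remainder x (iterate n x))) i j)
    _ _ (fun x => 1 + v x) C) => //.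
  - move=> n; have [h1 h2] := iterateP n; have [p _] := next_wP h1 h2.
    exact: p.
  - rewrite (_ : (fun x => _) = fun x => (v x *: w x + remainder x (U x)) i j + (-1) * g x i j).
      apply: locintD; last by apply/locintZ; case: (locint_g i j).
      apply: locint_cont.
      by apply: mcontD; [exact: mcontZ|exact: mcont_remainder].
    by apply/funext => x; rewrite !mxOpE; ring.
  - move=> n x; apply: le_trans (Hw n x i j) _; rewrite CE.
    by have := bi n; have := cbi n; lra.
  - move=> n x.
    rewrite (_ : _ - _ = v x * (next_w (iterate n) x i j - w x i j) +
       remainder x (iterate n x - U x) i j); last by rewrite remainderB !mxOpE; ring.
    apply: le_trans (ler_normD _ _) _; rewrite normrM (ger0_norm (v0 x)).
    have h1 := ler_wpM2l (v0 x) (Hw n x i j).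
    have h2 := remainder_le x (X := iterate n x - U x) (b := 2 * b / 2 ^+ n).
    have := h2 (fun i j => ltac:(by have := HU n x i j; rewrite !mxE)) i j.
    have e1 : 0 <= v x * (b / 2 ^+ n) by rewrite mulr_ge0.
    have e2 : 0 <= v x * (c * (b / 2 ^+ n)) by rewrite mulr_ge0.
    rewrite CE; have := bi n; have := cbi n; lra.
(* Since (D + v) U = w, this is (D + W) U. *)
pose eta x := w x + (W x *m U x - v x *: U x).
have S : susy W U eta (fun x => g x + U x *m Lam).
  split.
    apply: mprim_ext pU _ _ => x //; rewrite /eta.
    by rewrite -addrA; congr (_ + _); rewrite addrAC subrr add0r.
  have pvU : mprim (fun x => v x *: U x) (fun x => dv x *: U x + v x *: (w x - v x *: U x)).
    move=> i j; apply: prim_ext (primM pv (pU i j)) _ _ => x; first by rewrite mxE.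
    by rewrite !mxE.
  apply: mprim_ext (mprimD pw (mprimB (mprimM pW pU) pvU)) _ _ => x //.
  rewrite /eta /remainder; apply/matrixP => i j.
  rewrite !(mulmxDr, mulmxDl, mulmxN, mulNmx) -!mulmxA.
  rewrite !(scalerDr, scalerN, scalerA, scalerBl) -?scalemxAr !mxOpE -!expr2; ring.
exists U, eta; split=> //.
have [P pP] := prim_exists (locint_cont (cont_nsq cU)).
have Ub x i j : `|U x i j| <= 2 * b.
  by have := HU 0%N x i j; rewrite /= mxE sub0r normrN expr0 divr1.
have nU x : nsq (U x) <= 4 * (2 * b) ^+ 2.
  have h i j : U x i j ^+ 2 <= (2 * b) ^+ 2.
    rewrite -(real_normK (num_real (U x i j))) lerXn2r // nnegrE ?mulr_ge0 //.
  rewrite nsqE; have := h 0 0; have := h 0 1; have := h 1 0; have := h 1 1; lra.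
(* So far U is only bounded, hence the integral of its square over [- N, N] is O(N); the coercive
   estimate turns this into membership in L_2, with a bound in terms of g alone. *)
apply: (susy_coercive (C := 8 * (2 * b) ^+ 2) symW l0 S _ gL2 pP).
  by move=> x; rewrite dotDr LamE.
move=> N N1.
have NN : - N <= N by lra.
have := prim_le pP (primZ (4 * (2 * b) ^+ 2) (@prim_id R)) NN (fun x _ => _).
by move=> /(_ (fun x => ltac:(by rewrite mulr1; exact: nU))); lra.
Qed.

End BaseCase.

(** * Intertwining *)

Section SquareIntegrable.
Variable R : realType.
Implicit Types (psi eta f g : R -> 'M[R]_2).

Lemma mat2P (A B : 'M[R]_2) : A 0 0 = B 0 0 -> A 0 1 = B 0 1 ->
  A 1 0 = B 1 0 -> A 1 1 = B 1 1 -> A = B.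
Proof.
by move=> ? ? ? ?; apply/matrixP => i j; case: (I2P i) => ->; case: (I2P j) => ->.
Qed.

Lemma nsq_measurable psi : (forall i j, measurable_fun setT (fun x => psi x i j)) ->
  measurable_fun setT (fun x => nsq (psi x)).
Proof.
move=> m; rewrite [X in measurable_fun _ X](_ : _ = fun x =>
  psi x 0 0 ^+ 2 + psi x 1 0 ^+ 2 + (psi x 0 1 ^+ 2 + psi x 1 1 ^+ 2)).
  by repeat apply: measurable_funD; apply: measurable_funX; exact: m.
by apply/funext => x; rewrite nsqE.
Qed.

Lemma sqi_dom K C psi f : (forall i j, measurable_fun setT (fun x => psi x i j)) ->
  0 <= C -> sqi K f -> (forall x, nsq (psi x) <= C * nsq (f x)) -> sqi (C * K) psi.
Proof.
move=> m C0 [mf lf fK] H.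
have lp : locint (fun x => nsq (psi x)).
  apply: (locint_le (nsq_measurable m) (locintZ C lf)) => x.
  by rewrite ger0_norm ?nsq_ge0.
have [P pP] := prim_exists lp; have [F pF] := prim_exists lf.
split=> // a b ab; rewrite -pP.2 //.
apply: le_trans (prim_le pP (primZ C pF) ab (fun x _ => H x)) _.
by rewrite -mulrBr ler_wpM2l // pF.2 // fK.
Qed.

Lemma nsqD_le (u v : 'M[R]_2) : nsq (u + v) <= 2 * (nsq u + nsq v).
Proof.
have := dot_young u v (ltr01 : 0 < 1 :> R); rewrite ler_norml => /andP[_].
by rewrite /nsq !dotDr !dotDl (dotC v u); lra.
Qed.

Lemma sqiD K1 K2 psi f : sqi K1 psi -> sqi K2 f ->
  sqi (2 * (K1 + K2)) (fun x => psi x + f x).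
Proof.
move=> [m1 l1 h1] [m2 l2 h2].
have m i j : measurable_fun setT (fun x => (psi x + f x) i j).
  rewrite (_ : (fun x => _) = fun x => psi x i j + f x i j); first exact: measurable_funD.
  by apply/funext => x; rewrite mxE.
have lp : locint (fun x => nsq (psi x + f x)).
  apply: (locint_le (nsq_measurable m) (locintZ 2 (locintD l1 l2))) => x.
  by rewrite ger0_norm ?nsq_ge0 // nsqD_le.
have [P pP] := prim_exists lp.
have [F pF] := prim_exists l1; have [G pG] := prim_exists l2.
split=> // a b ab; rewrite -pP.2 //.
apply: le_trans (prim_le pP (primZ 2 (primD pF pG)) ab (fun x _ => nsqD_le _ _)) _.
by have := h1 _ _ ab; have := h2 _ _ ab; rewrite -pF.2 // -pG.2 //; lra.
Qed.

(* Multiplication by z on C^2, when u + i v is encoded as the matrix with columns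
   u and v, is right multiplication by [cmx z]. *)
Definition cmx (z : R[i]) : 'M[R]_2 :=
  \matrix_(i, j) if i == j then complex.Re z
                 else if i == 0 then complex.Im z else - complex.Im z.

Lemma cmx00 z : cmx z 0 0 = complex.Re z. Proof. by rewrite mxE. Qed.
Lemma cmx01 z : cmx z 0 1 = complex.Im z. Proof. by rewrite mxE. Qed.
Lemma cmx10 z : cmx z 1 0 = - complex.Im z. Proof. by rewrite mxE. Qed.
Lemma cmx11 z : cmx z 1 1 = complex.Re z. Proof. by rewrite mxE. Qed.

Definition cmxE := (cmx00, cmx01, cmx10, cmx11).

Lemma cmxM z z' : cmx (z * z') = cmx z *m cmx z'.
Proof.
case: z => a b; case: z' => c d.
by apply: mat2P; rewrite [in RHS]mxE sum_I2 !cmxE /=; ring.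
Qed.

Lemma cmxD z z' : cmx (z + z') = cmx z + cmx z'.
Proof.
case: z => a b; case: z' => c d.
by apply: mat2P; rewrite [in RHS]mxE !cmxE /=; ring.
Qed.

Lemma cmxN z : cmx (- z) = - cmx z.
Proof.
by case: z => a b; apply: mat2P; rewrite [in RHS]mxE !cmxE /=; ring.
Qed.

Lemma cmx_real r : cmx r%:C = r%:M.
Proof. by apply: mat2P; rewrite cmxE mxE /= ?mulr1n ?mulr0n ?oppr0. Qed.

Lemma mulmx_cmx_real (A : 'M[R]_2) r : A *m cmx r%:C = r *: A.
Proof. by rewrite cmx_real mul_mx_scalar. Qed.

Lemma mulmx_cmx0 (A : 'M[R]_2) z i : (A *m cmx z) i 0 = A i 0 * complex.Re z - A i 1 * complex.Im z.
Proof. by rewrite mxE sum_I2 !cmxE mulrN. Qed.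

Lemma mulmx_cmx1 (A : 'M[R]_2) z i : (A *m cmx z) i 1 = A i 0 * complex.Im z + A i 1 * complex.Re z.
Proof. by rewrite mxE sum_I2 !cmxE. Qed.

(** Multiplication by i is skew for [dot], so only Re z enters. This is where the constant l of the
    coercive estimate comes from. *)
Lemma dot_cmx X z : dot X (X *m cmx z) = complex.Re z * nsq X.
Proof. by rewrite /nsq !dotE !sum_I2 !mulmx_cmx0 !mulmx_cmx1; ring. Qed.

Lemma nsq_cmx X z : nsq (X *m cmx z) = (complex.Re z ^+ 2 + complex.Im z ^+ 2) * nsq X.
Proof. by rewrite !nsqE !mulmx_cmx0 !mulmx_cmx1; ring. Qed.

Lemma mulmx_cmxV (A : 'M[R]_2) z : z != 0 -> A *m cmx z *m cmx z^-1 = A.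
Proof.
by move=> z0; rewrite -mulmxA -cmxM mulfV // (cmx_real 1) mul_mx_scalar scale1r.
Qed.

Lemma mulmx_cmxVK (A : 'M[R]_2) z : z != 0 -> A *m cmx z^-1 *m cmx z = A.
Proof.
by move=> z0; rewrite -mulmxA -cmxM mulVf // (cmx_real 1) mul_mx_scalar scale1r.
Qed.

Lemma sqi_cmx z : exists2 C, 0 <= C & forall K psi, sqi K psi ->
  sqi (C * K) (fun x => psi x *m cmx z).
Proof.
exists (complex.Re z ^+ 2 + complex.Im z ^+ 2); first by rewrite addr_ge0 ?sqr_ge0.
move=> K psi s; apply: (sqi_dom _ _ s).
- case: s => m _ _ i j; case: (I2P j) => ->.
    rewrite (_ : (fun x => _) = fun x => psi x i 0 * complex.Re z - psi x i 1 * complex.Im z).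
      by apply: measurable_funB; apply: measurable_funM.
    by apply/funext => x; rewrite mulmx_cmx0.
  rewrite (_ : (fun x => _) = fun x => psi x i 0 * complex.Im z + psi x i 1 * complex.Re z).
    by apply: measurable_funD; apply: measurable_funM.
  by apply/funext => x; rewrite mulmx_cmx1.
- by rewrite addr_ge0 ?sqr_ge0.
- by move=> x; rewrite nsq_cmx.
Qed.

Lemma sqi0_eq0 psi : sqi 0 psi -> mcont psi -> forall x, psi x = 0.
Proof.
move=> s c; have cn := cont_nsq c.
have [P pP] := prim_exists (locint_cont cn).
have PE x y : x <= y -> P x = P y.
  move=> xy; apply/eqP; rewrite eq_le.
  have := sqi_prim s pP xy; have := prim_ge0 pP xy (fun t _ => nsq_ge0 _).
  by move=> ? ?; apply/andP; split; lra.
have pP0 : prim P (fun=> 0).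
  apply: prim_ext (prim_cst (P 0)) _ _ => // x.
  by have [h|/ltW h] := leP x 0; [rewrite (PE _ _ h)|rewrite (PE _ _ h)].
move=> x; apply: nsq_eq0; apply: (prim_uniq pP pP0 cn) => y; exact: cst_continuous.
Qed.

Lemma sqi_zero : sqi 0 (fun=> 0 : 'M[R]_2).
Proof.
have n0 : nsq (0 : 'M[R]_2) = 0 by rewrite nsqE !mxE expr0n /= !addr0.
split.
- by move=> i j; exact: measurable_cst.
- by apply: locint_cont => x; exact: cst_continuous.
- by move=> a b ab; rewrite Rintegral_cst //= n0 mul0r.
Qed.

Lemma mprim0_eq0 (P p : R -> 'M[R]_2) : mprim P p -> mcont p -> (forall x, P x = 0) -> forall x, p x = 0.
Proof.
move=> h c P0 x; apply/matrixP => i j; rewrite [RHS]mxE.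
apply: (prim_uniq (h i j) _ (c i j)); last by move=> y; exact: cst_continuous.
by apply: prim_ext (prim_cst 0) _ _ => y //; rewrite P0 mxE.
Qed.

End SquareIntegrable.

(** * Exchanging the factors A and A^* of the operator *)

Section Intertwining.
Variables (R : realType) (al : R).
Variables (W dW W1 dW1 : R -> 'M[R]_2).
Hypothesis pW : mprim W dW.
Hypothesis pW1 : mprim W1 dW1.
Hypothesis shape : forall x, dW x + dW1 x = W1 x *m W1 x - W x *m W x + (2 * al)%:M.

(** The hypotheses say that zeta = A^* xi and A zeta = f. As A^* is - (D - W), this is the system of
    the superpotential - W up to a sign, so the energy estimate bounds A^* xi as well. *)
Lemma susy_dual xi zeta (f : R -> 'M[R]_2) :
  mprim xi (fun x => W x *m xi x - zeta x) ->
  mprim zeta (fun x => f x - W x *m zeta x) ->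
  susy (fun x => - W x) xi (fun x => - zeta x) f.
Proof.
move=> h1 h2; split.
  by apply: mprim_ext h1 _ _ => x //; rewrite mulNmx opprK addrC.
by apply: mprim_ext (mprimN h2) _ _ => x //; rewrite mulNmx mulmxN opprK opprB.
Qed.

(* A A^* = A1^* A1 + 2 al, for A = D + W and A1 = D + W1 *)
Lemma susy_shift xi zeta (f : R -> 'M[R]_2) :
  mprim xi (fun x => W x *m xi x - zeta x) ->
  mprim zeta (fun x => f x - W x *m zeta x) ->
  susy W1 xi (fun x => (W x + W1 x) *m xi x - zeta x) (fun x => f x - (2 * al) *: xi x).
Proof.
move=> h1 h2; split.
  apply: mprim_ext h1 _ _ => x //.
  by rewrite mulmxDl -!addrA; congr (_ + _); rewrite addrCA subrr addr0.
apply: mprim_ext (mprimB (mprimM (mprimD pW pW1) h1) h2) _ _ => x //.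
rewrite shape -mul_scalar_mx.
rewrite !(mulmxDr, mulmxDl, mulmxN, mulNmx, mulmxBr) -?mulmxA.
by apply/matrixP => i j; rewrite !mxOpE; ring.
Qed.

Lemma susy_unshift xi eta (f : R -> 'M[R]_2) : susy W1 xi eta f ->
  let zeta := fun x => (W x + W1 x) *m xi x - eta x in
  mprim xi (fun x => W x *m xi x - zeta x) /\
  mprim zeta (fun x => (f x + (2 * al) *: xi x) - W x *m zeta x).
Proof.
move=> [h1 h2] zeta; split.
  apply: mprim_ext h1 _ _ => x //; rewrite /zeta.
  by apply/matrixP => i j; rewrite mulmxDl !mxOpE; ring.
apply: mprim_ext (mprimB (mprimM (mprimD pW pW1) h1) h2) _ _ => x //.
rewrite shape -mul_scalar_mx /zeta.
rewrite !(mulmxDr, mulmxDl, mulmxN, mulNmx, mulmxBr) -?mulmxA.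
by apply/matrixP => i j; rewrite !mxOpE; ring.
Qed.

End Intertwining.

(** * The superpotential, its shape invariance, and the induction for the resolvent *)

Section Superpotential.
Variables (R : realType) (alpha k omega0 : R).
Hypothesis halpha : 0 < alpha.
Hypothesis hcos : cos omega0 != 0.

Let gamma := alpha * tan omega0.

Definition drefl (t : R) : 'M[R]_2 :=
  \matrix_(i, j) if i == j then (if i == 0 then - sin t else sin t) else cos t.

Definition phase (w x : R) : R := gamma * x ^+ 2 + w.

Definition Wm (w x : R) : 'M[R]_2 :=
  (alpha * x)%:M + k *: reflection (phase w x).

Definition dWm (w x : R) : 'M[R]_2 :=
  alpha%:M + (2 * gamma * k * x) *: drefl (phase w x).

Lemma reflE (t : R) : [/\ reflection t 0 0 = cos t, reflection t 0 1 = sin t,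
  reflection t 1 0 = sin t & reflection t 1 1 = - cos t].
Proof. by split; rewrite mxE. Qed.

Lemma dreflE t : [/\ drefl t 0 0 = - sin t, drefl t 0 1 = cos t,
  drefl t 1 0 = cos t & drefl t 1 1 = sin t].
Proof. by split; rewrite mxE. Qed.

Lemma scalE (a : R) : [/\ (a%:M : 'M[R]_2) 0 0 = a, (a%:M : 'M[R]_2) 0 1 = 0,
  (a%:M : 'M[R]_2) 1 0 = 0 & (a%:M : 'M[R]_2) 1 1 = a].
Proof. by split; rewrite mxE /= ?mulr1n ?mulr0n. Qed.

Lemma WmE w x : [/\ Wm w x 0 0 = alpha * x + k * cos (phase w x),
  Wm w x 0 1 = k * sin (phase w x), Wm w x 1 0 = k * sin (phase w x) &
  Wm w x 1 1 = alpha * x - k * cos (phase w x)].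
Proof.
have [s1 s2 s3 s4] := scalE (alpha * x); have [r1 r2 r3 r4] := reflE (phase w x).
by split; rewrite mxDE mxZE ?s1 ?s2 ?s3 ?s4 ?r1 ?r2 ?r3 ?r4 ?add0r // mulrN.
Qed.

Lemma dWmE w x : [/\ dWm w x 0 0 = alpha - 2 * gamma * k * x * sin (phase w x),
  dWm w x 0 1 = 2 * gamma * k * x * cos (phase w x),
  dWm w x 1 0 = 2 * gamma * k * x * cos (phase w x) &
  dWm w x 1 1 = alpha + 2 * gamma * k * x * sin (phase w x)].
Proof.
have [s1 s2 s3 s4] := scalE alpha; have [r1 r2 r3 r4] := dreflE (phase w x).
by split; rewrite mxDE mxZE ?s1 ?s2 ?s3 ?s4 ?r1 ?r2 ?r3 ?r4 ?add0r // mulrN.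
Qed.

Lemma Wm_sym w x : (Wm w x)^T = Wm w x.
Proof. by have [h1 h2 h3 h4] := WmE w x; apply: mat2P; rewrite mxE // h2 h3. Qed.

Lemma prim_phase w : prim (phase w) (fun x => 2 * gamma * x).
Proof.
apply: prim_ext (primD (primZ gamma (primM (@prim_id R) (@prim_id R))) (prim_cst w)) _ _ => x.
  by rewrite /phase expr2.
by ring.
Qed.

Lemma prim_comp (F f h dh : R -> R) : prim h dh -> continuous dh -> continuous f ->
  (forall y, is_derive y (1 : R) F (f y)) -> prim (fun x => F (h x)) (fun x => f (h x) * dh x).
Proof.
move=> ph cdh cf dF; have ch := prim_cont ph.
have D (x : R) : is_derive x (1 : R) (fun x => F (h x)) (f (h x) * dh x).
  apply: is_derive1_comp.
  by apply: (prim_der ph); apply: cdh.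
apply: der_prim => x; apply: cvgM; last exact: cdh.
by apply: (continuous_comp (f := h)); [exact: ch|exact: cf].
Qed.

Lemma dphase_cont : continuous (fun x : R => 2 * gamma * x).
Proof. by move=> x; apply: cvgM; [exact: cvg_cst|exact: cvg_id]. Qed.

Lemma prim_cos_phase w : prim (fun x => cos (phase w x)) (fun x => - sin (phase w x) * (2 * gamma * x)).
Proof.
apply: (prim_comp (F := cos) (f := fun y => - sin y) (prim_phase w) dphase_cont).
by move=> x; apply: cvgN; exact: continuous_sin.
Qed.

Lemma prim_sin_phase w : prim (fun x => sin (phase w x)) (fun x => cos (phase w x) * (2 * gamma * x)).
Proof.
apply: (prim_comp (F := sin) (f := cos) (prim_phase w) dphase_cont).
exact: continuous_cos.
Qed.

Lemma mprim_Wm w : mprim (Wm w) (dWm w).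
Proof.
have pa : prim (fun x => alpha * x) (fun=> alpha).
  by apply: prim_ext (primZ alpha (@prim_id R)) _ _ => x //; rewrite mulr1.
have pc := primZ k (prim_cos_phase w); have ps := primZ k (prim_sin_phase w).
move=> i j; case: (I2P i) => ->; case: (I2P j) => ->.
- apply: prim_ext (primD pa pc) _ _ => x; first by case: (WmE w x).
  by case: (dWmE w x) => -> *; ring.
- apply: prim_ext ps _ _ => x; first by case: (WmE w x).
  by case: (dWmE w x) => _ -> *; ring.
- apply: prim_ext ps _ _ => x; first by case: (WmE w x).
  by case: (dWmE w x) => _ _ -> *; ring.
- apply: prim_ext (primB pa pc) _ _ => x; first by case: (WmE w x).
  by case: (dWmE w x) => _ _ _ ->; ring.
Qed.

Lemma dWm_cont w : mcont (dWm w).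
Proof.
have cs : continuous (fun x => sin (phase w x)) by exact: prim_cont (prim_sin_phase w).
have cc : continuous (fun x => cos (phase w x)) by exact: prim_cont (prim_cos_phase w).
rewrite (_ : dWm w = fun x => alpha%:M + (2 * gamma * k * x) *: drefl (phase w x)) //.
apply: mcontD; first exact: mcont_cst.
apply: mcontZ; first by move=> x; apply: cvgM; [exact: cvg_cst|exact: cvg_id].
have E t i j : drefl t i j = if i == j then (if i == 0 then - sin t else sin t) else cos t.
  by rewrite mxE.
move=> i j; rewrite [X in continuous X](_ : _ = fun x => if i == j then
  (if i == 0 then - sin (phase w x) else sin (phase w x)) else cos (phase w x)); last first.
  by apply/funext => x; rewrite E.
case: (i == j); last exact: cc.
case: (i == 0); last exact: cs.
move=> x.
by apply: cvgN; exact: cs.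
Qed.

Lemma gamma_cos : gamma * cos omega0 = alpha * sin omega0.
Proof. by rewrite /gamma /tan -mulrA divfK. Qed.

Lemma sin_sqr (t : R) : sin t ^+ 2 = 1 - cos t ^+ 2.
Proof. by have := cos2Dsin2 t; lra. Qed.

(** The scalar part comes from R^2 = 1, where R is the reflection. The rest is the addition formula
    R(t) - tan omega0 R'(t) = R(t - omega0) / cos omega0, the origin of the shift - omega0 and of
    the denominator in the potential. *)
Lemma potentialE w x : Wm w x *m Wm w x - dWm w x = potential alpha k omega0 w x.
Proof.
rewrite /potential -/gamma -(_ : phase w x - omega0 = gamma * x ^+ 2 + w - omega0) //.
have [s1 s2 s3 s4] := scalE (alpha ^+ 2 * x ^+ 2 + k ^+ 2 - alpha).
have [r1 r2 r3 r4] := reflE (phase w x - omega0).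
have [w1 w2 w3 w4] := WmE w x; have [d1 d2 d3 d4] := dWmE w x.
have gE : gamma = alpha * sin omega0 / cos omega0 by rewrite -gamma_cos mulfK.
have cs := sin_sqr (phase w x).
apply: mat2P; rewrite !mxDE mxNE mxZE mxE sum_I2 ?s1 ?s2 ?s3 ?s4 ?r1 ?r2 ?r3 ?r4
  ?w1 ?w2 ?w3 ?w4 ?d1 ?d2 ?d3 ?d4 ?cosB ?sinB gE.
- have -> : k * sin (phase w x) * (k * sin (phase w x)) = k ^+ 2 * sin (phase w x) ^+ 2 by ring.
  by rewrite cs; field.
- by field.
- by field.
- have -> : k * sin (phase w x) * (k * sin (phase w x)) = k ^+ 2 * sin (phase w x) ^+ 2 by ring.
  by rewrite cs; field.
Qed.

Lemma entry_quad (A B C : 'M[R]_2) i j : (A *m A - B *m B + C) i j =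
  (A i 0 * A 0 j + A i 1 * A 1 j) - (B i 0 * B 0 j + B i 1 * B 1 j) + C i j.
Proof. by rewrite !mxE !sum_I2. Qed.

(** Both reflections square to 1, so only the terms linear in x remain: gamma (R'(t) + R'(t + 2
    omega0)) = alpha (R(t + 2 omega0) - R(t)). Around the midpoint t + omega0 both sides are
    multiples of R'(t + omega0), with factors 2 gamma cos omega0 and 2 alpha sin omega0, which agree
    by the choice of gamma. [h1] and [h2] are the entries of this identity. *)
Lemma shape_invariance w x : dWm w x + dWm (w + 2 * omega0) x =
  Wm (w + 2 * omega0) x *m Wm (w + 2 * omega0) x - Wm w x *m Wm w x + (2 * alpha)%:M.
Proof.
set w' := w + 2 * omega0.
have pE : phase w' x = phase w x + (omega0 + omega0) by rewrite /phase /w'; ring.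
have [s1 s2 s3 s4] := scalE (2 * alpha).
have [w1 w2 w3 w4] := WmE w x; have [d1 d2 d3 d4] := dWmE w x.
have [v1 v2 v3 v4] := WmE w' x; have [e1 e2 e3 e4] := dWmE w' x.
have gE : gamma = alpha * sin omega0 / cos omega0 by rewrite -gamma_cos mulfK.
have cs := sin_sqr (phase w x); have cs' := sin_sqr (phase w' x).
have so := sin_sqr omega0.
have h1 : - gamma * (sin (phase w x) + sin (phase w' x)) =
    alpha * (cos (phase w' x) - cos (phase w x)).
  rewrite pE; move: (phase w x) => p; rewrite !(sinD, cosD) gE; apply/eqP; rewrite -subr_eq0; apply/eqP.
  transitivity (- alpha * (sin omega0 * sin p * cos omega0 +
     sin omega0 ^+ 2 * cos p - cos p * (1 - cos omega0 ^+ 2) +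
     sin omega0 * sin p / cos omega0 * (1 - cos omega0 ^+ 2- sin omega0 ^+ 2)
      - sin omega0 * sin p * cos omega0)).
    by field.
  by rewrite so; ring.
have h2 : gamma * (cos (phase w x) + cos (phase w' x)) =
    alpha * (sin (phase w' x) - sin (phase w x)).
  rewrite pE; move: (phase w x) => p; rewrite !(sinD, cosD) gE; apply/eqP; rewrite -subr_eq0; apply/eqP.
  transitivity (alpha * (sin omega0 * cos p / cos omega0 * (1 - cos omega0 ^+ 2- sin omega0 ^+ 2)
    + (1 - cos omega0 ^+ 2- sin omega0 ^+ 2) * sin p)).
    by field.
  by rewrite so; ring.
apply: mat2P; rewrite entry_quad mxDE ?s1 ?s2 ?s3 ?s4
  ?w1 ?w2 ?w3 ?w4 ?d1 ?d2 ?d3 ?d4 ?v1 ?v2 ?v3 ?v4 ?e1 ?e2 ?e3 ?e4.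
- transitivity (2 * alpha + 2 * k * x * (- gamma * (sin (phase w x) + sin (phase w' x)))).
    by ring.
  rewrite h1; transitivity (2 * alpha + 2 * k * x * (alpha * (cos (phase w' x) - cos (phase w x)))
    + k ^+ 2 * ((cos (phase w' x) ^+ 2 + sin (phase w' x) ^+ 2) - (cos (phase w x) ^+ 2 + sin (phase w x) ^+ 2))).
    by rewrite cs cs'; ring.
  by ring.
- transitivity (2 * k * x * (gamma * (cos (phase w x) + cos (phase w' x)))); first by ring.
  by rewrite h2; ring.
- transitivity (2 * k * x * (gamma * (cos (phase w x) + cos (phase w' x)))); first by ring.
  by rewrite h2; ring.
- transitivity (2 * alpha - 2 * k * x * (- gamma * (sin (phase w x) + sin (phase w' x)))).
    by ring.
  rewrite h1; transitivity (2 * alpha - 2 * k * x * (alpha * (cos (phase w' x) - cos (phase w x)))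
    + k ^+ 2 * ((cos (phase w' x) ^+ 2 + sin (phase w' x) ^+ 2) - (cos (phase w x) ^+ 2 + sin (phase w x) ^+ 2))).
    by rewrite cs cs'; ring.
  by ring.
Qed.

Lemma mulmx_cmx_sub (A : 'M[R]_2) z r : A *m cmx (z - r%:C) = A *m cmx z - r *: A.
Proof. by rewrite cmxD cmxN mulmxDr mulmxN mulmx_cmx_real. Qed.

Definition eigenpair w z (psi eta : R -> 'M[R]_2) : Prop :=
  susy (Wm w) psi eta (fun x => psi x *m cmx z).

Lemma eigenpair_lower w z psi eta : eigenpair w z psi eta ->
  eigenpair (w + 2 * omega0) (z - (2 * alpha)%:C) eta
   (fun x => (Wm w x + Wm (w + 2 * omega0) x) *m eta x - psi x *m cmx z).
Proof.
move=> [h1 h2].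
have h3 : mprim (fun x => psi x *m cmx z) (fun x => eta x *m cmx z - Wm w x *m (psi x *m cmx z)).
  by apply: mprim_ext (mprimMr (cmx z) h1) _ _ => x //; rewrite mulmxBl mulmxA.
have [a b] := susy_shift (mprim_Wm w) (mprim_Wm _) (shape_invariance w) h2 h3.
split; first exact: a.
apply: mprim_ext b _ _ => x; first by [].
by rewrite mulmx_cmx_sub.
Qed.

(** The first component of the result is A^* xi, because eta = (D + W1) xi for the next
    superpotential W1; the second is A A^* xi = z xi. *)
Lemma eigenpair_raise w z xi eta :
  eigenpair (w + 2 * omega0) (z - (2 * alpha)%:C) xi eta ->
  eigenpair w z (fun x => (Wm w x + Wm (w + 2 * omega0) x) *m xi x - eta x)
    (fun x => xi x *m cmx z).
Proof.
move=> h; have [a b] := susy_unshift (mprim_Wm w) (mprim_Wm _) (shape_invariance w) h.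
split.
  apply: mprim_ext b _ _ => x //.
  by rewrite mulmx_cmx_sub subrK.
apply: mprim_ext (mprimMr (cmx z) a) _ _ => x //.
by rewrite mulmxBl mulmxA.
Qed.

Definition solvable_at w z : Prop := exists2 K, 0 <= K & forall g Kg, sqi Kg g ->
  exists psi eta, susy (Wm w) psi eta (fun x => g x + psi x *m cmx z) /\ sqi (K * Kg) psi.

Definition injective_at w z : Prop := forall psi eta K,
  eigenpair w z psi eta -> sqi K psi -> forall x, psi x = 0.

Lemma injective_neg w z : complex.Re z < 0 -> injective_at w z.
Proof.
move=> z0 psi eta K h s.
have [P pP] : exists P, prim P (fun x => nsq (psi x)) by apply: prim_exists; case: s.
have K0 := sqi_ge0 s.
apply: sqi0_eq0; last by case: (susy_eta_cont h).
have := susy_coercive (l := complex.Re z) (C := K) (Wm_sym w) z0 h _ (sqi_zero R) pP _.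
rewrite mul0r mulr0; apply.
  by move=> x; rewrite dot_cmx /dot mulmx0 mxtrace0 add0r.
move=> N N1; apply: (le_trans (sqi_prim s pP _)); first by lra.
by rewrite ler_peMr.
Qed.

Lemma injective_step w z : z != 0 ->
  injective_at (w + 2 * omega0) (z - (2 * alpha)%:C) -> injective_at w z.
Proof.
move=> z0 H psi eta K h s.
have [C C0 sC] := sqi_cmx z.
have se := susy_eta_sqi (Wm_sym w) h s (sC _ _ s).
have e0 := H _ _ _ (eigenpair_lower h) se.
have [cpsi ceta] := susy_eta_cont h.
have := mprim0_eq0 h.2 _ e0.
have c : mcont (fun x => Wm w x *m eta x - psi x *m cmx z).
  apply: mcontD; first by apply: mcontM => //; exact: mprim_cont (mprim_Wm w).
  by apply/mcontN/mcontM => //; exact: mcont_cst.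
move=> /(_ c) E x; have := E x; rewrite e0 mulmx0 sub0r => /eqP; rewrite oppr_eq0 => /eqP F.
by rewrite -(mulmx_cmxV (psi x) z0) F mul0mx.
Qed.

(** Twice an upper bound, valid for m >= 1, of the constant c in [solvable_base], plus 1 to ensure m
    >= 1; hence m >= threshold gives c <= m / 2. The argument s is Im z: multiplication by i Im z is
    part of the remainder. *)
Definition threshold (s : R) : R :=
  1 + 2 * (k ^+ 2 + 2 * alpha + `|s| + 4 * `|k| / `|cos omega0|).

Lemma threshold_ge1 s : 1 <= threshold s.
Proof.
rewrite /threshold lerDl mulr_ge0 // !addr_ge0 ?sqr_ge0 ?mulr_ge0 //; exact: ltW.
Qed.

Lemma solvable_base w z : complex.Re z <= - threshold (complex.Im z) ^+ 2 ->
  solvable_at w z.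
Proof.
move=> hz; set s := complex.Im z in hz; set l := complex.Re z in hz.
have t1 := threshold_ge1 s.
have t2 : 1 <= threshold s ^+ 2 by rewrite expr_ge1 //; lra.
have l0 : l < 0 by lra.
pose m := Num.sqrt (- l).
have m2 : m ^+ 2 = - l by rewrite sqr_sqrtr //; lra.
have mt : threshold s <= m.
  rewrite -(ger0_norm (_ : 0 <= threshold s)); last by lra.
  by rewrite -sqrtr_sqr ler_sqrt; lra.
have m0 : 0 < m by lra.
(* v^2 = alpha^2 x^2 - Re z cancels the quadratic growth of the potential together with the real
   part of z. As |v'| <= alpha, all that is left is bounded, except for the reflection term, which
   is linear in x and thus at most a multiple of v. *)
pose v (x : R) := Num.sqrt (alpha ^+ 2 * x ^+ 2 + m ^+ 2).
pose dv (x : R) := alpha ^+ 2 * x / v x.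
have a2 x : 0 <= alpha ^+ 2 * x ^+ 2 by rewrite mulr_ge0 ?sqr_ge0.
have mm0 : 0 < m ^+ 2 by rewrite exprn_gt0.
have vx2 x : v x ^+ 2 = alpha ^+ 2 * x ^+ 2 + m ^+ 2.
  by rewrite sqr_sqrtr //; have := a2 x; lra.
have vm x : m <= v x.
  rewrite -(ger0_norm (ltW m0)) -sqrtr_sqr ler_sqrt; first by have := a2 x; lra.
  by have := a2 x; lra.
have v0 x : 0 < v x by apply: lt_le_trans (vm x).
have av x : alpha * `|x| <= v x.
  rewrite -(ger0_norm (ltW halpha)) -normrM -sqrtr_sqr ler_sqrt; last by have := a2 x; lra.
  by rewrite exprMn; lra.
have pq : prim (fun x => alpha ^+ 2 * x ^+ 2 + m ^+ 2) (fun x => 2 * alpha ^+ 2 * x).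
  apply: prim_ext (primD (primZ (alpha ^+ 2) (primM (@prim_id R) (@prim_id R))) (prim_cst (m ^+ 2))) _ _ => x.
    by rewrite expr2.
  by ring.
have cq : continuous (fun x : R => 2 * alpha ^+ 2 * x).
  by move=> x; apply: cvgM; [exact: cvg_cst|exact: cvg_id].
have dV (x : R) : is_derive x (1 : R) v (dv x).
  have dq : is_derive x (1 : R) (fun x => alpha ^+ 2 * x ^+ 2 + m ^+ 2) (2 * alpha ^+ 2 * x).
    by apply: (prim_der pq); apply: cq.
  have q0 : 0 < alpha ^+ 2 * x ^+ 2 + m ^+ 2 by have := a2 x; lra.
  have := @is_derive1_comp R Num.sqrt _ x _ _ (is_derive1_sqrt q0) dq.
  rewrite (_ : (2 * _)^-1 * _ = dv x) //.
  by rewrite /dv -/(v x); field; rewrite gt_eqF.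
have cv : continuous v.
  by move=> x; apply: differentiable_continuous; apply/derivable1_diffP; apply: ex_derive.
have cdv : continuous dv.
  move=> x; apply: cvgM; first by apply: cvgM; [exact: cvg_cst|exact: cvg_id].
  by apply: cvgV; [rewrite gt_eqF|exact: cv].
have pv : prim v dv by exact: der_prim.
have [V pV] := prim_exists (locint_cont cv).
pose c := (k ^+ 2 + 2 * alpha + `|s|) / m + 4 * `|k| / `|cos omega0|.
have nc0 : 0 < `|cos omega0| by rewrite normr_gt0.
have B0 : 0 <= k ^+ 2 + 2 * alpha + `|s|.
  by have := sqr_ge0 k; have := normr_ge0 s; have := halpha; lra.
have B1 : 0 <= 4 * `|k| / `|cos omega0| by rewrite divr_ge0 ?mulr_ge0.
have c0 : 0 <= c by rewrite addr_ge0 // divr_ge0 // ltW.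
have cm : c <= m / 2.
  have : (k ^+ 2 + 2 * alpha + `|s|) / m <= k ^+ 2 + 2 * alpha + `|s|.
    by rewrite ler_pdivrMr // ler_peMr //; lra.
  move: mt; rewrite /c /threshold; lra.
have rl x (X : 'M[R]_2) b : (forall i j, `|X i j| <= b) ->
    forall i j, `|remainder (Wm w) (dWm w) v dv (cmx z) x X i j| <= c * v x * b.
  move=> Xb i j.
  have b0 : 0 <= b by apply: le_trans (Xb 0 0).
  have RX : `|(reflection (phase w x - omega0) *m X) i j| <= 2 * b.
    have r (t : R) i' j' : `|reflection t i' j'| <= 1.
      rewrite mxE; case: ifP => _; [case: ifP => _|].
      - by rewrite ler_norml cos_geN1 cos_le1.
      - by rewrite normrN ler_norml cos_geN1 cos_le1.
      - by rewrite ler_norml sin_geN1 sin_le1.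
    rewrite mxE sum_I2 (le_trans (ler_normD _ _)) // !normrM mulr_natl mulr2n.
    by rewrite lerD // -[leRHS]mul1r ler_pM.
  have XJ : exists2 y, (X *m cmx z) i j = l * X i j + s * y & `|y| <= b.
    case: (I2P j) => ->.
      exists (- X i 1); last by rewrite normrN.
      by rewrite mulmx_cmx0 -/l -/s; ring.
    by exists (X i 0); rewrite // mulmx_cmx1 -/l -/s; ring.
  have [y yE yb] := XJ.
  have E : remainder (Wm w) (dWm w) v dv (cmx z) x X i j =
     (k ^+ 2 - alpha + dv x) * X i j - s * y +
     2 * alpha * k * x / cos omega0 * (reflection (phase w x - omega0) *m X) i j.
    rewrite /remainder potentialE /potential -/gamma.
    rewrite -(_ : phase w x - omega0 = gamma * x ^+ 2 + w - omega0) //.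
    by rewrite mulmxDl mul_scalar_mx -scalemxAl !mxOpE yE vx2 m2; ring.
  have dva : `|dv x| <= alpha.
    rewrite /dv normrM normfV (gtr0_norm (v0 x)) ler_pdivrMr // normrM.
    rewrite (ger0_norm (sqr_ge0 _)) expr2 -mulrA ler_wpM2l ?av // ltW //.
  have h1 : `|(k ^+ 2 - alpha + dv x) * X i j - s * y| <= (k ^+ 2 + 2 * alpha + `|s|) * b.
    have e1 : `|k ^+ 2 - alpha + dv x| <= k ^+ 2 + 2 * alpha.
      move: dva; rewrite !ler_norml => /andP[? ?].
      by have := sqr_ge0 k; have := halpha; move=> *; apply/andP; split; lra.
    rewrite (le_trans (ler_normB _ _)) // !normrM mulrDl lerD //.
      by apply: ler_pM.
    by apply: ler_wpM2l.
  have h2 : `|2 * alpha * k * x / cos omega0 * (reflection (phase w x - omega0) *m X) i j|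
      <= 4 * `|k| / `|cos omega0| * v x * b.
    rewrite normrM !normrM normfV (gtr0_norm halpha) (ger0_norm (_ : 0 <= 2)) //.
    apply: (@le_trans _ _ (2 * alpha * `|k| * `|x| / `|cos omega0| * (2 * b))).
      by apply: ler_wpM2l => //; rewrite divr_ge0 // !mulr_ge0 // ltW.
    rewrite (_ : _ * (2 * b) = (4 * `|k| / `|cos omega0| * b) * (alpha * `|x|)); last first.
      by ring.
    rewrite [leRHS]mulrAC; apply: ler_wpM2l; last exact: av.
    by rewrite mulr_ge0.
  have h3 : (k ^+ 2 + 2 * alpha + `|s|) * b <= (k ^+ 2 + 2 * alpha + `|s|) / m * v x * b.
    apply: ler_wpM2r => //; rewrite mulrAC ler_pdivlMr //; apply: ler_wpM2l => //.
  have -> : c * v x * b = (k ^+ 2 + 2 * alpha + `|s|) / m * v x * b +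
      4 * `|k| / `|cos omega0| * v x * b by rewrite /c; ring.
  rewrite E (le_trans (ler_normD _ _)) // lerD //.
  exact: (le_trans h1 h3).
exists (16 / 9 * (l ^+ 2)^-1); first by rewrite mulr_ge0 // invr_ge0 sqr_ge0.
move=> g Kg sg.
have [psi [eta [h1 h2]]] := base_exists (mprim_Wm w) (@dWm_cont w) (Wm_sym w) pv cdv pV m0 vm c0 cm
  l0 (fun X => dot_cmx X z) rl sg.
exists psi, eta; split => //; apply: sqi_le h2.
by rewrite le_eqVlt; apply/orP; left; apply/eqP; ring.
Qed.

(* With A = D + W and psi0 = (A^* A - mu)^-1 g, the resolvent identity
   z (A^* A - z)^-1 = A^* (A A^* - z)^-1 (z - mu) A (A^* A - mu)^-1
                      + mu (A^* A - mu)^-1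
   avoids differentiating g; A A^* is the next operator, shifted. *)
Lemma solvable_step w z : z != 0 ->
  solvable_at (w + 2 * omega0) (z - (2 * alpha)%:C) -> solvable_at w z.
Proof.
move=> z0 [K1 K10 H].
pose mu : R := - threshold 0 ^+ 2.
have [K0 K00 H0] : solvable_at w mu%:C by apply: solvable_base.
have [Cm Cm0 sCm] := sqi_cmx mu%:C.
have [Cd Cd0 sCd] := sqi_cmx (z - mu%:C).
have [Cz Cz0 sCz] := sqi_cmx z.
have [Ci Ci0 sCi] := sqi_cmx z^-1.
(* Relative to Kg, these bound the squared norms of g + mu psi0, of (z - mu) eta0, of xi and of zeta
   = A^* xi, in this order. *)
pose A := 2 * (1 + Cm * K0).
pose B := Cd * (32 * (K0 + A)).
pose D := K1 * B.
pose E := 32 * (D + 2 * (B + Cz * D)).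
exists (Ci * (2 * (E + Cm * K0))).
  by rewrite /E /D /B /A !(mulr_ge0, addr_ge0).
move=> g Kg sg.
have [psi0 [eta0 [S0 s0]]] := H0 g Kg sg.
have sf : sqi (A * Kg) (fun x => g x + psi0 x *m cmx mu%:C).
  by have := sqiD sg (sCm _ _ s0); apply: sqi_le; rewrite /A; lra.
have se := susy_eta_sqi (Wm_sym w) S0 s0 sf.
have sh : sqi (B * Kg) (fun x => eta0 x *m cmx (z - mu%:C)).
  by have := sCd _ _ se; apply: sqi_le; rewrite /B; lra.
have [xi [et [S1 s1]]] := H _ _ sh.
have [p1 p2] := susy_unshift (mprim_Wm w) (mprim_Wm _) (shape_invariance w) S1.
pose zeta x := (Wm w x + Wm (w + 2 * omega0) x) *m xi x - et x.
have {}p1 : mprim xi (fun x => Wm w x *m xi x - zeta x) := p1.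
have p2' : mprim zeta (fun x => (eta0 x *m cmx (z - mu%:C) + xi x *m cmx z) - Wm w x *m zeta x).
  apply: mprim_ext p2 _ _ => x //; congr (_ - _).
  by rewrite (mulmx_cmx_sub (xi x)) -addrA subrK.
have s1' : sqi (D * Kg) xi by apply: sqi_le s1; rewrite /D mulrA.
have sz : sqi (E * Kg) zeta.
  have NW x : (- Wm w x)^T = - Wm w x by rewrite raddfN /= Wm_sym.
  have := susy_eta_sqi NW (susy_dual p1 p2') s1' (sqiD sh (sCz _ _ s1')).
  move=> h; have : sqi (1 * (E * Kg)) zeta.
    apply: (sqi_dom _ ler01 (f := fun x => - zeta x)).
    - by move=> i j; apply: continuous_measurable_fun; exact: (mprim_cont p2').
    - by apply: sqi_le h; rewrite /E; lra.
    - by move=> x; rewrite mul1r -scaleN1r nsqZ sqrrN expr1n mul1r.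
  by rewrite mul1r.
(* Applying D + W to the first component gives ((z - mu) eta0 + z xi + mu eta0) / z = eta0 + xi, the
   second one. *)
exists (fun x => (zeta x + psi0 x *m cmx mu%:C) *m cmx z^-1), (fun x => eta0 x + xi x).
split; last first.
  by have := sCi _ _ (sqiD sz (sCm _ _ s0)); apply: sqi_le; lra.
split.
  apply: mprim_ext (mprimMr (cmx z^-1) (mprimD p2' (mprimMr (cmx mu%:C) S0.1))) _ _ => x //.
  rewrite (_ : eta0 x *m cmx (z - mu%:C) + xi x *m cmx z - Wm w x *m zeta x +
     (eta0 x - Wm w x *m psi0 x) *m cmx mu%:C =
     (eta0 x + xi x) *m cmx z - Wm w x *m (zeta x + psi0 x *m cmx mu%:C)).
    by rewrite mulmxBl mulmx_cmxV // -mulmxA.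
  rewrite cmxD cmxN !(mulmxDr, mulmxDl, mulmxN, mulNmx) -!mulmxA.
  by apply/matrixP => i j; rewrite !mxOpE; ring.
apply: mprim_ext (mprimD S0.2 p1) _ _ => x //.
rewrite mulmx_cmxVK // (mulmxDr (Wm w x)).
by apply/matrixP => i j; rewrite !mxOpE; ring.
Qed.

(** Each step lowers Re z by 2 alpha and keeps Im z, and with it the threshold. The phase w changes
    along the way, so the induction is for all phases at once. *)
Lemma resolvent_induction n w z :
  complex.Re z <= 2 * n%:R * alpha - threshold (complex.Im z) ^+ 2 ->
  (forall j : nat, z != (2 * j%:R * alpha)%:C) ->
  solvable_at w z /\ injective_at w z.
Proof.
elim: n w z => [|n IH] w z hz nz.
  rewrite mulr0 mul0r sub0r in hz.
  split; first exact: solvable_base.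
  apply: injective_neg; apply: (le_lt_trans hz); rewrite oppr_lt0 exprn_gt0 //.
  by have := threshold_ge1 (complex.Im z); lra.
have z0 : z != 0 by have := nz 0%N; rewrite mulr0 mul0r.
have ReE : complex.Re (z - (2 * alpha)%:C) = complex.Re z - 2 * alpha by case: (z).
have ImE : complex.Im (z - (2 * alpha)%:C) = complex.Im z by case: (z) => a b /=; rewrite subr0.
have [] := IH (w + 2 * omega0) (z - (2 * alpha)%:C).
- by rewrite ReE ImE; move: hz; rewrite -natr1; lra.
- move=> j; rewrite subr_eq -rmorphD /= (_ : _ + _ = 2 * j.+1%:R * alpha); first exact: nz.
  by rewrite -natr1; ring.
by move=> h1 h2; split; [exact: solvable_step|exact: injective_step].
Qed.

Lemma resolvent_spec w z : (forall j : nat, z != (2 * j%:R * alpha)%:C) ->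
  solvable_at w z /\ injective_at w z.
Proof.
apply: (@resolvent_induction (Num.bound `|(complex.Re z + threshold (complex.Im z) ^+ 2) / (2 * alpha)|)).
set q := _ / _.
have : q < (Num.bound `|q|)%:R.
  by apply: (le_lt_trans (ler_norm _)); apply: archi_boundP.
have a2 : 0 < 2 * alpha by have := halpha; lra.
rewrite {1}/q ltr_pdivrMr // => h.
by move: (_%:R) (complex.Re z) (threshold _) h => N a t; lra.
Qed.

End Superpotential.

(** * Entire solutions of Hermite's equation *)

Section ComplexModulus.
Variable R : realType.
Implicit Types (z u : R[i]).

Lemma cmodE z : `|z| = (cmod z)%:C.
Proof. exact: normc_def. Qed.

Lemma cmod_ge0 z : 0 <= cmod z.
Proof. exact: sqrtr_ge0. Qed.

Lemma cmodM z u : cmod (z * u) = cmod z * cmod u.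
Proof. by apply: complexI; rewrite -cmodE normrM !cmodE rmorphM. Qed.

Lemma cmodD z u : cmod (z + u) <= cmod z + cmod u.
Proof. by rewrite -lecR rmorphD /= -!cmodE ler_normD. Qed.

Lemma cmod0 : cmod (0 : R[i]) = 0.
Proof. by apply: complexI; rewrite -cmodE normr0. Qed.

Lemma cmod1 : cmod (1 : R[i]) = 1.
Proof. by apply: complexI; rewrite -cmodE normr1. Qed.

Lemma cmodX z n : cmod (z ^+ n) = cmod z ^+ n.
Proof. by elim: n => [|n IH]; rewrite ?expr0 ?cmod1 // !exprS cmodM IH. Qed.

Lemma cmod_real (r : R) : cmod r%:C = `|r|.
Proof. by rewrite /cmod /= expr0n /= addr0 sqrtr_sqr. Qed.

Lemma cmod_nat n : cmod (n%:R : R[i]) = n%:R.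
Proof. by rewrite -(rmorph_nat (real_complex R)) cmod_real normr_nat. Qed.

Lemma cmod_Re z : `|complex.Re z| <= cmod z.
Proof.
by rewrite -sqrtr_sqr ler_wsqrtr // lerDl sqr_ge0.
Qed.

Lemma cmod_Im z : `|complex.Im z| <= cmod z.
Proof.
by rewrite -sqrtr_sqr ler_wsqrtr // lerDr sqr_ge0.
Qed.

Lemma cmod_le z : cmod z <= `|complex.Re z| + `|complex.Im z|.
Proof.
have s0 : 0 <= `|complex.Re z| + `|complex.Im z| by rewrite addr_ge0.
rewrite -(ger0_norm s0) -sqrtr_sqr ler_wsqrtr //.
rewrite -(real_normK (num_real (complex.Re z))) -(real_normK (num_real (complex.Im z))).
by rewrite sqrrD lerD2r lerDl mulrn_wge0 // mulr_ge0.
Qed.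

End ComplexModulus.

(** * Complex power series and differentiation with a quadratic remainder *)

Section ComplexSeries.
Variable R : realType.
Implicit Types (a d : nat -> R[i]) (s t z h : R[i]) (b : nat -> R).

Definition csum a s : Prop :=
  series (fun j => complex.Re (a j)) @ \oo --> complex.Re s /\
  series (fun j => complex.Im (a j)) @ \oo --> complex.Im s.

Lemma csum_unique a s t : csum a s -> csum a t -> s = t.
Proof.
move=> [h1 h2] [h1' h2'].
have e1 : complex.Re s = complex.Re t := cvg_unique (@Rhausdorff R) h1 h1'.
have e2 : complex.Im s = complex.Im t := cvg_unique (@Rhausdorff R) h2 h2'.
by case: s t e1 e2 {h1 h2 h1' h2'} => ? ? [? ?] /= -> ->.
Qed.

Lemma csum_ext a a' s : csum a s -> a =1 a' -> csum a' s.
Proof. by move=> h /funext <-. Qed.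

Lemma csumD a a' s t : csum a s -> csum a' t -> csum (fun j => a j + a' j) (s + t).
Proof.
move=> [h1 h2] [h1' h2']; split.
  rewrite (_ : complex.Re (s + t) = complex.Re s + complex.Re t); last by case: (s); case: (t).
  rewrite (_ : series _ = fun n => series (fun j => complex.Re (a j)) n + series (fun j => complex.Re (a' j)) n).
    exact: cvgD.
  apply/funext => n; rewrite /series /= -big_split /=; apply: eq_bigr => i _.
  by case: (a i); case: (a' i).
rewrite (_ : complex.Im (s + t) = complex.Im s + complex.Im t); last by case: (s); case: (t).
rewrite (_ : series _ = fun n => series (fun j => complex.Im (a j)) n + series (fun j => complex.Im (a' j)) n).
  exact: cvgD.
apply/funext => n; rewrite /series /= -big_split /=; apply: eq_bigr => i _.
by case: (a i); case: (a' i).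
Qed.

Lemma csumZ c a s : csum a s -> csum (fun j => c * a j) (c * s).
Proof.
case: c => x y [h1 h2]; split.
  rewrite (_ : complex.Re _ = x * complex.Re s - y * complex.Im s); last by case: (s).
  rewrite (_ : series _ = fun n => x * series (fun j => complex.Re (a j)) n - y * series (fun j => complex.Im (a j)) n).
    by apply: cvgB; apply: cvgM => //; exact: cvg_cst.
  apply/funext => n; rewrite /series /= !mulr_sumr -sumrB; apply: eq_bigr => i _.
  by case: (a i).
rewrite (_ : complex.Im _ = x * complex.Im s + y * complex.Re s); last by case: (s).
rewrite (_ : series _ = fun n => x * series (fun j => complex.Im (a j)) n + y * series (fun j => complex.Re (a j)) n).
  by apply: cvgD; apply: cvgM => //; exact: cvg_cst.
apply/funext => n; rewrite /series /= !mulr_sumr -big_split /=; apply: eq_bigr => i _.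
by case: (a i).
Qed.

Lemma csumB a a' s t : csum a s -> csum a' t -> csum (fun j => a j - a' j) (s - t).
Proof.
move=> h /(csumZ (-1)) h'; have := csumD h h'; rewrite mulN1r => /csum_ext; apply => j.
by rewrite mulN1r.
Qed.

Lemma csum_shift a s : a 0%N = 0 -> csum (fun j => a j.+1) s -> csum a s.
Proof.
move=> a0 [h1 h2]; split.
  rewrite -(cvg_shiftS (series (fun j => complex.Re (a j)))).
  rewrite (_ : [sequence _]_n = series (fun j => complex.Re (a j.+1))) //.
  by apply/funext => n; rewrite /series /= big_nat_recl // a0 add0r.
rewrite -(cvg_shiftS (series (fun j => complex.Im (a j)))).
rewrite (_ : [sequence _]_n = series (fun j => complex.Im (a j.+1))) //.
by apply/funext => n; rewrite /series /= big_nat_recl // a0 add0r.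
Qed.

Lemma real_series_cvg (u b : nat -> R) B : (forall j, `|u j| <= b j) ->
  (forall n, series b n <= B) -> cvgn (series u).
Proof.
move=> ub bB; have b0 j : 0 <= b j by apply: le_trans (ub j).
apply: normed_cvg; apply: (series_le_cvg (v_ := b)) => //; first by move=> n; exact: normr_ge0.
apply: nondecreasing_is_cvgn; last by exists B => _ [n _ <-].
by apply/nondecreasing_seqP => n; rewrite /series /= big_nat_recr //= lerDl.
Qed.

Lemma csum_exists a b B : (forall j, cmod (a j) <= b j) ->
  (forall n, series b n <= B) -> exists s, csum a s.
Proof.
move=> ab bB.
have c1 := real_series_cvg (fun j => le_trans (cmod_Re (a j)) (ab j)) bB.
have c2 := real_series_cvg (fun j => le_trans (cmod_Im (a j)) (ab j)) bB.
by exists (limn (series (fun j => complex.Re (a j))) +i* limn (series (fun j => complex.Im (a j)))).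
Qed.

Lemma series_norm_le (u b : nat -> R) B l : (forall j, `|u j| <= b j) ->
  (forall n, series b n <= B) -> series u @ \oo --> l -> `|l| <= B.
Proof.
move=> ub bB cu.
have nb n : `|series u n| <= B.
  apply: le_trans (bB n); apply: le_trans (ler_norm_sum _ _ _) _.
  by apply: ler_sum => i _; exact: ub.
have cn : `|series u n| @[n --> \oo] --> `|l| by exact: cvg_norm.
rewrite -(cvg_lim _ cn) //; apply: limr_le; first by apply/cvg_ex; exists `|l|.
by near=> n; exact: nb.
Unshelve. all: by end_near. Qed.

Lemma csum_le a b B s : (forall j, cmod (a j) <= b j) ->
  (forall n, series b n <= B) -> csum a s -> cmod s <= 2 * B.
Proof.
move=> ab bB [h1 h2]; apply: le_trans (cmod_le s) _.
have := series_norm_le (fun j => le_trans (cmod_Re (a j)) (ab j)) bB h1.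
have := series_norm_le (fun j => le_trans (cmod_Im (a j)) (ab j)) bB h2.
lra.
Qed.

Lemma series_exp_le (x : R) n : 0 <= x -> series (exp_coeff x) n <= expR x.
Proof.
move=> x0; apply: nondecreasing_cvgn_le; last exact: is_cvg_series_exp_coeff.
apply/nondecreasing_seqP => m; rewrite /series /= big_nat_recr //= lerDl.
by rewrite /exp_coeff divr_ge0 // exprn_ge0.
Qed.

(** Taylor coefficients of an entire function of exponential type. The class is stable under
    [dcoef], and comparison with the exponential series gives convergence everywhere. *)
Definition exp_type (A C : R) d : Prop :=
  [/\ 0 <= A, 0 <= C & forall j, cmod (d j) <= A * C ^+ j / j`!%:R].

(** The slack in M and rho serves two purposes: M = 1, rho = |z| for the values of the series, and M
    = |h|^2 with a larger rho for its Taylor remainder. *)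
Lemma exp_type_series A C d (rho M : R) (c : nat -> R[i]) : exp_type A C d ->
  0 <= rho -> 0 <= M ->
  (forall j, cmod (c j) <= M * cmod (d j) * rho ^+ j) ->
  (exists s, csum c s) /\ forall s, csum c s -> cmod s <= 2 * (M * A * expR (C * rho)).
Proof.
move=> [A0 C0 dA] r0 M0 H.
pose b j := M * A * exp_coeff (C * rho) j.
have hb j : cmod (c j) <= b j.
  apply: le_trans (H j) _; rewrite /b /exp_coeff /= exprMn.
  rewrite (_ : M * A * _ = M * (A * C ^+ j / j`!%:R) * rho ^+ j); last by ring.
  by rewrite ler_wpM2r ?exprn_ge0 // ler_wpM2l.
have sb n : series b n <= M * A * expR (C * rho).
  rewrite (_ : series b n = M * A * series (exp_coeff (C * rho)) n).
    by rewrite ler_wpM2l ?mulr_ge0 // series_exp_le // mulr_ge0.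
  by rewrite /series /= mulr_sumr.
split; first exact: csum_exists hb sb.
by move=> s; exact: csum_le hb sb.
Qed.

Definition pser d z : R[i] := xget 0 [set s | csum (fun j => d j * z ^+ j) s].

Lemma pserP A C d z : exp_type A C d -> csum (fun j => d j * z ^+ j) (pser d z).
Proof.
move=> h.
have [] := @exp_type_series A C d (cmod z) 1 (fun j => d j * z ^+ j) h (cmod_ge0 z) ler01.
  by move=> j; rewrite mul1r cmodM cmodX.
move=> [s hs] _.
exact: (@xgetPex _ 0 [set s | csum (fun j => d j * z ^+ j) s] (ex_intro _ s hs)).
Qed.

Lemma pserE A C d z s : exp_type A C d -> csum (fun j => d j * z ^+ j) s -> pser d z = s.
Proof. by move=> h; apply: csum_unique; exact: pserP h. Qed.

Definition dcoef d j : R[i] := j.+1%:R * d j.+1.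

Lemma exp_type_dcoef A C d : exp_type A C d -> exp_type (A * C) C (dcoef d).
Proof.
move=> [A0 C0 dA]; split; rewrite ?mulr_ge0 // => j.
rewrite /dcoef cmodM cmod_nat.
have -> : A * C * C ^+ j / j`!%:R = j.+1%:R * (A * C ^+ j.+1 / j.+1`!%:R).
  rewrite factS natrM exprS; field.
  by rewrite pnatr_eq0 -lt0n fact_gt0 /= addrC natr1 pnatr_eq0.
by rewrite ler_wpM2l.
Qed.

(* Entire functions have a quadratic remainder, uniformly for bounded h; stated
   in this form, differentiability passes to products and compositions without
   any continuity argument. *)
Definition cderiv (f f' : R[i] -> R[i]) : Prop :=
  forall z (r : R), 0 <= r -> exists2 K, 0 <= K & forall h, cmod h <= r ->
    cmod (f (z + h) - f z - h * f' z) <= K * cmod h ^+ 2.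

(** By induction: the remainder for j + 1 is z + h times the one for j, plus h^2 j z^(j - 1), and
    j^2 + j <= (j + 1)^2. *)
Lemma binomial_remainder z h (rho : R) j : 1 <= rho -> cmod z + cmod h <= rho ->
  cmod ((z + h) ^+ j - z ^+ j - h * (j%:R * z ^+ j.-1)) <=
  (j ^ 2)%:R * cmod h ^+ 2 * rho ^+ j.
Proof.
move=> r1 zh; have h0 := cmod_ge0 h; have z0 := cmod_ge0 z.
have r0 : 0 <= rho by lra.
elim: j => [|j IH].
  by rewrite !expr0 subrr mul0r mulr0 subr0 cmod0 !mul0r.
set E := (z + h) ^+ j - z ^+ j - _ in IH.
have -> : (z + h) ^+ j.+1 - z ^+ j.+1 - h * (j.+1%:R * z ^+ j.+1.-1) =
   (z + h) * E + h ^+ 2 * (j%:R * z ^+ j.-1).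
  rewrite /E /= !exprS; case: j {IH E} => [|j]; first by rewrite !expr0 /=; ring.
  by rewrite /= !exprS -(natr1 j.+1); ring.
apply: le_trans (cmodD _ _) _; rewrite (cmodM (z + h)) (cmodM (h ^+ 2)) (cmodM j%:R) !cmodX cmod_nat.
have zr : cmod (z + h) <= rho by apply: le_trans (cmodD _ _) zh.
have t1 : cmod (z + h) * cmod E <= rho * ((j ^ 2)%:R * cmod h ^+ 2 * rho ^+ j).
  by apply: ler_pM => //; exact: cmod_ge0.
have t2 : cmod h ^+ 2 * (j%:R * cmod z ^+ j.-1) <= cmod h ^+ 2 * (j%:R * rho ^+ j.+1).
  apply: ler_wpM2l; first exact: sqr_ge0.
  apply: ler_wpM2l; first exact: ler0n.
  apply: (@le_trans _ _ (rho ^+ j.-1)).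
    by rewrite lerXn2r // ?nnegrE //; lra.
  by rewrite ler_weXn2l // (leq_trans (leq_pred j)).
apply: le_trans (lerD t1 t2) _.
rewrite (_ : _ + _ = (j ^ 2 + j)%:R * cmod h ^+ 2 * rho ^+ j.+1); last first.
  by rewrite natrD (exprS rho); ring.
apply: ler_wpM2r; first exact: exprn_ge0.
apply: ler_wpM2r; first exact: sqr_ge0.
by rewrite ler_nat -!mulnn mulSn mulnS; lia.
Qed.

Lemma cderiv_pser A C d : exp_type A C d -> cderiv (pser d) (pser (dcoef d)).
Proof.
move=> h z r r0.
have [A0 C0 dA] := h.
pose rho := cmod z + r + 1.
have z0 := cmod_ge0 z.
have rho1 : 1 <= rho by rewrite /rho; lra.
exists (2 * (A * expR (C * (4 * rho)))).
  by rewrite !mulr_ge0 // ltW // expR_gt0.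
move=> k kr.
pose c j := d j * ((z + k) ^+ j - z ^+ j - k * (j%:R * z ^+ j.-1)).
have Hc : csum c (pser d (z + k) - pser d z - k * pser (dcoef d) z).
  have h3 : csum (fun j => k * (d j * (j%:R * z ^+ j.-1))) (k * pser (dcoef d) z).
    apply: csumZ; apply: csum_shift; first by rewrite mul0r mulr0.
    apply: csum_ext (pserP z (exp_type_dcoef h)) _ => j.
    by rewrite /dcoef /= mulrCA mulrA.
  apply: csum_ext (csumB (csumB (pserP (z + k) h) (pserP z h)) h3) _ => j.
  by rewrite /c; ring.
have k2 : 0 <= cmod k ^+ 2 by exact: sqr_ge0.
(* Enlarging the radius by the factor 4 absorbs the j^2 of the binomial remainder, since j^2 <=
   4^j. *)
have [|||_ ] := @exp_type_series A C d (4 * rho) (cmod k ^+ 2) c h.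
- by rewrite mulr_ge0 //; lra.
- exact: k2.
- move=> j; rewrite /c cmodM.
  have kz : cmod z + cmod k <= rho by rewrite /rho; lra.
  have := binomial_remainder j rho1 kz => bj.
  apply: (@le_trans _ _ (cmod (d j) * ((j ^ 2)%:R * cmod k ^+ 2 * rho ^+ j))).
    by apply: ler_wpM2l => //; exact: cmod_ge0.
  rewrite exprMn (_ : cmod k ^+ 2 * cmod (d j) * _ =
     cmod (d j) * (4 ^+ j * cmod k ^+ 2 * rho ^+ j)); last by ring.
  apply: ler_wpM2l; first exact: cmod_ge0.
  apply: ler_wpM2r; first by apply: exprn_ge0; lra.
  apply: ler_wpM2r; first exact: k2.
  rewrite -natrX ler_nat (_ : 4 ^ j = (2 ^ j) ^ 2)%N; last by rewrite -expnM mulnC expnM.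
  by rewrite leq_sqr ltnW // ltn_expl.
by move=> /(_ _ Hc) /le_trans; apply; rewrite le_eqVlt; apply/orP; left; apply/eqP; ring.
Qed.

Lemma cderiv_bound f f' z (r : R) : cderiv f f' -> 0 <= r -> exists2 K, 0 <= K &
  forall h, cmod h <= r -> cmod (f (z + h) - f z) <= K * cmod h.
Proof.
move=> H r0; have [K K0 HK] := H z r r0.
exists (K * r + cmod (f' z)); first by rewrite addr_ge0 ?mulr_ge0 ?cmod_ge0.
move=> h hr; have H1 := HK h hr; have h0 := cmod_ge0 h.
rewrite (_ : f (z + h) - f z = (f (z + h) - f z - h * f' z) + h * f' z); last by ring.
apply: le_trans (cmodD _ _) _; rewrite cmodM.
have : K * cmod h ^+ 2 <= K * (r * cmod h).
  by apply: ler_wpM2l => //; rewrite expr2 ler_wpM2r.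
lra.
Qed.

Lemma cderivD f f' g g' : cderiv f f' -> cderiv g g' ->
  cderiv (fun z => f z + g z) (fun z => f' z + g' z).
Proof.
move=> H1 H2 z r r0; have [K K0 HK] := H1 z r r0; have [L L0 HL] := H2 z r r0.
exists (K + L); first exact: addr_ge0.
move=> h hr; rewrite (_ : _ - _ = (f (z + h) - f z - h * f' z) + (g (z + h) - g z - h * g' z)); last by ring.
by apply: le_trans (cmodD _ _) _; rewrite mulrDl lerD // ?HK ?HL.
Qed.

Lemma cderivM f f' g g' : cderiv f f' -> cderiv g g' ->
  cderiv (fun z => f z * g z) (fun z => f' z * g z + f z * g' z).
Proof.
move=> H1 H2 z r r0; have [K K0 HK] := H1 z r r0; have [L L0 HL] := H2 z r r0.
have [K' K'0 HK'] := cderiv_bound z H1 r0; have [L' L'0 HL'] := cderiv_bound z H2 r0.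
exists (K * cmod (g z) + cmod (f z) * L + K' * L').
  by rewrite !addr_ge0 // mulr_ge0 // cmod_ge0.
move=> h hr; rewrite (_ : _ - _ = (f (z + h) - f z - h * f' z) * g z +
   f z * (g (z + h) - g z - h * g' z) + (f (z + h) - f z) * (g (z + h) - g z)); last by ring.
apply: le_trans (cmodD _ _) _; rewrite [leRHS]mulrDl lerD //.
  apply: le_trans (cmodD _ _) _; rewrite [leRHS]mulrDl !cmodM lerD //.
    by rewrite mulrAC ler_wpM2r ?cmod_ge0 // HK.
  by rewrite -mulrA ler_wpM2l ?cmod_ge0 // HL.
rewrite cmodM (_ : _ * _ ^+ 2 = K' * cmod h * (L' * cmod h)); last by ring.
by apply: ler_pM; rewrite ?cmod_ge0 ?HK' ?HL'.
Qed.

Lemma cderiv_cst c : cderiv (fun=> c) (fun=> 0).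
Proof. by move=> z r r0; exists 0 => // h _; rewrite subrr mulr0 subr0 cmod0 mul0r. Qed.

Lemma cderiv_id : cderiv (fun z => z) (fun=> 1).
Proof.
move=> z r r0; exists 0 => // h _.
by rewrite (_ : _ - _ = 0) ?cmod0 ?mul0r //; ring.
Qed.

Lemma cderiv_comp f f' g g' : cderiv f f' -> cderiv g g' ->
  cderiv (fun z => f (g z)) (fun z => f' (g z) * g' z).
Proof.
move=> H1 H2 z r r0; have [L L0 HL] := H2 z r r0.
have [L' L'0 HL'] := cderiv_bound z H2 r0.
have r'0 : 0 <= L' * r by rewrite mulr_ge0.
have [K K0 HK] := H1 (g z) _ r'0.
exists (K * L' ^+ 2 + cmod (f' (g z)) * L).
  by rewrite addr_ge0 // mulr_ge0 ?cmod_ge0 ?sqr_ge0.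
move=> h hr; pose u := g (z + h) - g z.
have uh : cmod u <= L' * cmod h by exact: HL'.
have ur : cmod u <= L' * r by apply: le_trans uh _; rewrite ler_wpM2l.
have H := HK u ur; rewrite (_ : g z + u = g (z + h)) in H; last by rewrite /u; ring.
rewrite (_ : _ - _ = (f (g (z + h)) - f (g z) - u * f' (g z)) +
   f' (g z) * (g (z + h) - g z - h * g' z)); last by rewrite /u; ring.
apply: le_trans (cmodD _ _) _; rewrite [leRHS]mulrDl lerD //.
  apply: le_trans H _; rewrite -mulrA ler_wpM2l // -exprMn.
  by rewrite lerXn2r // nnegrE ?mulr_ge0 ?cmod_ge0.
by rewrite cmodM -mulrA ler_wpM2l ?cmod_ge0 // HL.
Qed.

End ComplexSeries.

(** * From quadratic remainders to complex and real derivatives *)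

Section QuadraticRemainder.

(** Over an arbitrary numeric field, as it is applied to C in [cderiv_entire] and to R in
    [cderiv_real]. *)
Lemma is_derive_quadratic (K : numFieldType) (f : K^o -> K^o) (x : K^o) (l B : K) : 0 <= B ->
  (forall h : K, `|h| <= 1 -> `|f (x + h) - f x - h * l| <= B * `|h| ^+ 2) ->
  is_derive x (1 : K^o) f l.
Proof.
move=> B0 H.
have C : h^-1 *: (f (h *: (1 : K^o) + x) - f x) @[h --> 0^'] --> (l : K^o).
  apply/cvgrPdist_le => e e0.
  have d0 : 0 < e / (B + 1) by rewrite divr_gt0 // ltr_wpDl.
  near=> h.
  have hn0 : h != 0 by near: h; exact: nbhs_dnbhs_neq.
  have h1 : `|h| <= 1 by near: h; exact: dnbhs0_le.
  have h2 : `|h| <= e / (B + 1) by near: h; exact: dnbhs0_le.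
  have nh : 0 < `|h| by rewrite normr_gt0.
  rewrite distrC (_ : h *: (1 : K^o) + x = x + h); last by rewrite addrC [h *: _]mulr1.
  have -> : h^-1 *: (f (x + h) - f x) - l = h^-1 * (f (x + h) - f x - h * l) :> K.
    by rewrite [RHS]mulrBr mulKf.
  rewrite normrM normfV mulrC ler_pdivrMr //; apply: le_trans (H h h1) _.
  rewrite expr2 mulrA ler_wpM2r //.
  have : (B + 1) * `|h| <= e by rewrite mulrC -ler_pdivlMr // ltr_wpDl.
  by apply: le_trans; rewrite mulrDl mul1r lerDl.
apply: DeriveDef; first by apply/cvg_ex; exists l.
exact: cvg_lim C.
Unshelve. all: by end_near. Qed.

Variable R : realType.

Lemma cderiv_entire (f f' : R[i] -> R[i]) : cderiv f f' -> entire_derivative f f'.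
Proof.
move=> H z; have [K K0 HK] := H z 1 ler01.
apply: (@is_derive_quadratic _ f z (f' z) K%:C); first by rewrite lecR.
move=> h; rewrite !cmodE -rmorphXn -rmorphM /= !lecR.
exact: HK.
Qed.

Lemma cderiv_real (f f' : R[i] -> R[i]) (x : R) : cderiv f f' ->
  is_derive x (1 : R) (fun t => complex.Re (f t%:C)) (complex.Re (f' x%:C)) /\
  is_derive x (1 : R) (fun t => complex.Im (f t%:C)) (complex.Im (f' x%:C)).
Proof.
move=> H; have [K K0 HK] := H x%:C 1 ler01.
have D (h : R) : `|h| <= 1 -> cmod (f (x + h)%:C - f x%:C - h%:C * f' x%:C) <= K * `|h| ^+ 2.
  by move=> h1; have := HK h%:C; rewrite cmod_real rmorphD /=; apply.
split.
  apply: (@is_derive_quadratic R (fun t => complex.Re (f t%:C)) x _ K K0) => h h1.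
  apply: le_trans (D h h1); apply: le_trans (cmod_Re _).
  rewrite le_eqVlt; apply/orP; left; apply/eqP; congr `|_|.
  by case: (f _) => a b; case: (f _) => c d; case: (f' _) => u v /=; ring.
apply: (@is_derive_quadratic R (fun t => complex.Im (f t%:C)) x _ K K0) => h h1.
apply: le_trans (D h h1); apply: le_trans (cmod_Im _).
rewrite le_eqVlt; apply/orP; left; apply/eqP; congr `|_|.
by case: (f _) => a b; case: (f _) => c d; case: (f' _) => u v /=; ring.
Qed.

End QuadraticRemainder.

(** * The even solution of the rotated Hermite equation *)

Section Kummer.
Variable R : realType.
Implicit Types (a b z : R[i]).

(* Taylor coefficients, in powers of z^2, of the even solution of
   y'' = 2 a z y' + b y with y 0 = 1. *)
Fixpoint kcoef a b j : R[i] :=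
  if j is i.+1 then (4 * a * i%:R + b) / ((2 * i + 1) * (2 * i + 2))%:R * kcoef a b i
  else 1.

Lemma kcoefS a b j : ((2 * j + 1) * (2 * j + 2))%:R * kcoef a b j.+1 =
  (4 * a * j%:R + b) * kcoef a b j.
Proof. by rewrite /= mulrA [_ * (_ / _)]mulrC divfK // pnatr_eq0; lia. Qed.

(** The ratio of consecutive coefficients is at most (2 |a| + |b|) / (2 j + 2) in modulus, as |4 a j
    + b| <= (2 j + 1) (2 |a| + |b|). *)
Lemma exp_type_kcoef a b : exp_type 1 (2 * cmod a + cmod b) (kcoef a b).
Proof.
have C0 : 0 <= 2 * cmod a + cmod b by have := cmod_ge0 a; have := cmod_ge0 b; lra.
split=> //; elim=> [|j IH]; first by rewrite /= cmod1 expr0 fact0 divr1 mul1r.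
set q := ((2 * j + 1) * (2 * j + 2))%:R : R.
have q0 : 0 < q by rewrite ltr0n; lia.
have E := congr1 (@cmod R) (kcoefS a b j).
rewrite (cmodM _%:R) (cmodM (4 * a * j%:R + b)) cmod_nat -/q in E.
rewrite -(ler_pM2l q0) E.
have h1 : cmod (4 * a * j%:R + b) <= (2 * j + 1)%:R * (2 * cmod a + cmod b).
  apply: le_trans (cmodD _ _) _; rewrite !cmodM !cmod_nat.
  rewrite natrD natrM mulrDl; have := cmod_ge0 a; have := cmod_ge0 b => b0 a0.
  have : 0 <= j%:R * cmod b by rewrite mulr_ge0.
  lra.
apply: (@le_trans _ _ ((2 * j + 1)%:R * (2 * cmod a + cmod b) *
   (1 * (2 * cmod a + cmod b) ^+ j / j`!%:R))).
  by apply: ler_pM => //; exact: cmod_ge0.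
have f0 : (j`!%:R : R) != 0 by rewrite pnatr_eq0 -lt0n fact_gt0.
have j0 : (j.+1%:R : R) != 0 by rewrite pnatr_eq0.
rewrite factS natrM exprS /q natrM (_ : (2 * j + 2)%:R = 2 * j.+1%:R :> R); last first.
  by rewrite -natrM; congr (_%:R); lia.
set J := j.+1%:R in j0 *; set c := 2 * cmod a + cmod b in C0 *.
have X0 : 0 <= (2 * j + 1)%:R * c * (c ^+ j / j`!%:R).
  by rewrite !mulr_ge0 ?invr_ge0 ?exprn_ge0.
rewrite (_ : (2 * j + 1)%:R * (2 * J) * _ = 2 * ((2 * j + 1)%:R * c * (c ^+ j / j`!%:R))).
  by rewrite mul1r; lra.
have aux (J' F c' Z Y : R) : J' != 0 -> F != 0 ->
    Y * (2 * J') * (1 * (c' * Z) / (J' * F)) = 2 * (Y * c' * (Z / F)).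
  by move=> ? ?; field; apply/andP; split.
exact: aux.
Qed.

Lemma cderiv_ext (f f' g' : R[i] -> R[i]) : cderiv f f' -> f' =1 g' -> cderiv f g'.
Proof. by move=> H /funext <-. Qed.

(** For a != 0 this is Kummer's function M(b / (4 a), 1/2, a z^2). Defined by its series it makes
    sense for a = 0 too, which the spectral statements need when gamma = 0. *)
Definition kummer a b z := pser (kcoef a b) (z * z).
Definition dkummer a b z := pser (dcoef (kcoef a b)) (z * z) * (1 * z + z * 1).

Lemma cderiv_kummer a b : cderiv (kummer a b) (dkummer a b).
Proof.
apply: (cderiv_comp (f := pser (kcoef a b))); first exact: cderiv_pser (exp_type_kcoef a b).
by apply: cderivM; exact: cderiv_id.
Qed.

Lemma csum_mul_deriv A C (d : nat -> R[i]) z : exp_type A C d ->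
  csum (fun j => j%:R * d j * z ^+ j) (z * pser (dcoef d) z).
Proof.
move=> h; apply: csum_shift; first by rewrite !mul0r.
apply: csum_ext (csumZ z (pserP z (exp_type_dcoef h))) _ => j.
by rewrite /dcoef exprS; ring.
Qed.

(** The equation y'' = 2 a z y' + b y rewritten in the variable z^2; on coefficients it is
    [kcoefS]. *)
Lemma kummer_ode a b z :
  2 * pser (dcoef (kcoef a b)) z + 4 * (z * pser (dcoef (dcoef (kcoef a b))) z) =
  4 * a * (z * pser (dcoef (kcoef a b)) z) + b * pser (kcoef a b) z.
Proof.
have h := exp_type_kcoef a b; have h1 := exp_type_dcoef h.
apply: csum_unique (csumD (csumZ 2 (pserP z h1)) (csumZ 4 (csum_mul_deriv z h1))) _.
apply: csum_ext (csumD (csumZ (4 * a) (csum_mul_deriv z h)) (csumZ b (pserP z h))) _ => j.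
rewrite (_ : 4 * a * _ + _ = ((4 * a * j%:R + b) * kcoef a b j) * z ^+ j); last by ring.
rewrite -kcoefS /dcoef.
rewrite (_ : ((2 * j + 1) * (2 * j + 2))%:R = (2 + 4 * j%:R) * j.+1%:R :> R[i]); first by ring.
by rewrite -!(natrM, natrD); congr (_%:R); lia.
Qed.

Lemma cderiv_dkummer a b :
  cderiv (dkummer a b) (fun z => 2 * a * z * dkummer a b z + b * kummer a b z).
Proof.
have h := exp_type_kcoef a b; have h1 := exp_type_dcoef h.
have q : cderiv (fun z => z * z) (fun z : R[i] => 1 * z + z * 1).
  by apply: cderivM; exact: cderiv_id.
have H := cderivM (cderiv_comp (cderiv_pser h1) q)
  (cderivD (cderivM (cderiv_cst 1) (@cderiv_id R)) (cderivM (@cderiv_id R) (cderiv_cst 1))).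
apply: cderiv_ext H _ => z; have := kummer_ode a b (z * z); rewrite /kummer /dkummer.
set F0 := pser _ _; set F1 := pser _ _; set F2 := pser _ _ => E.
transitivity (4 * a * (z * z * F0) + b * F2); first by rewrite -E; ring.
by ring.
Qed.

Lemma pser_0 (A C : R) d : exp_type A C d -> pser d 0 = d 0%N.
Proof.
move=> h; apply: (pserE h).
have c0 : csum (fun=> 0) (0 : R[i]).
  split; rewrite /= (_ : series _ = fun=> 0); try exact: cvg_cst.
    by apply/funext => n; rewrite /series /= big1.
  by apply/funext => n; rewrite /series /= big1.
have c1 : csum (fun j => if j == 0%N then d 0%N else 0) (d 0%N).
  split.
    rewrite -(cvg_shiftS (series _)) (_ : [sequence _]_n = fun=> complex.Re (d 0%N)); first exact: cvg_cst.
    by apply/funext => n; rewrite /series /= big_nat_recl // big1 ?addr0 // => i _.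
  rewrite -(cvg_shiftS (series _)) (_ : [sequence _]_n = fun=> complex.Im (d 0%N)); first exact: cvg_cst.
  by apply/funext => n; rewrite /series /= big_nat_recl // big1 ?addr0 // => i _.
by apply: csum_ext c1 _ => -[|j] /=; rewrite ?expr0 ?mulr1 // exprS mul0r mulr0.
Qed.

Lemma kummer0 a b : kummer a b 0 = 1.
Proof. by rewrite /kummer mulr0 (pser_0 (exp_type_kcoef a b)). Qed.

Lemma dkummer0 a b : dkummer a b 0 = 0.
Proof. by rewrite /dkummer !(mulr0, mul0r) addr0 mulr0. Qed.

Lemma csum_conj (d : nat -> R[i]) s : csum d s -> csum (fun j => conjc (d j)) (conjc s).
Proof.
move=> [h1 h2]; split.
  rewrite (_ : complex.Re (conjc s) = complex.Re s); last by case: (s).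
  rewrite (_ : (fun j => _) = (fun j => complex.Re (d j))) //.
  by apply/funext => j; case: (d j).
rewrite (_ : complex.Im (conjc s) = - complex.Im s); last by case: (s).
rewrite (_ : series _ = fun n => - series (fun j => complex.Im (d j)) n); first exact: cvgN.
by apply/funext => n; rewrite /series /= -sumrN; apply: eq_bigr => j _; case: (d j).
Qed.

Lemma conjcM (u v : R[i]) : conjc (u * v) = conjc u * conjc v.
Proof. exact: rmorphM. Qed.

Lemma conjcD (u v : R[i]) : conjc (u + v) = conjc u + conjc v.
Proof. exact: rmorphD. Qed.

Lemma conjcV (u : R[i]) : conjc u^-1 = (conjc u)^-1.
Proof. exact: fmorphV. Qed.

Lemma conjc_nat n : conjc (n%:R : R[i]) = n%:R.
Proof. exact: rmorph_nat. Qed.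

Lemma kcoef_conj a b j : conjc (kcoef a b j) = kcoef (conjc a) (conjc b) j.
Proof.
elim: j => [|j IH]; first exact: rmorph1.
by rewrite /= -IH !(conjcM, conjcD, conjcV, conjc_nat).
Qed.

Lemma conjc_real (x : R) : conjc x%:C = x%:C.
Proof. by rewrite /= oppr0. Qed.

Lemma pser_conj A C d (x : R) : exp_type A C d -> exp_type A C (fun j => conjc (d j)) ->
  conjc (pser d x%:C) = pser (fun j => conjc (d j)) x%:C.
Proof.
move=> h h'; symmetry; apply: (pserE h').
apply: csum_ext (csum_conj (pserP x%:C h)) _ => j.
by rewrite rmorphM rmorphXn /= oppr0.
Qed.

(** Conjugation is not an operation of [weber_expressible]. On the real line it stays inside the
    Kummer family, so real and imaginary parts become combinations of two expressible functions. *)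
Lemma kummer_conj a b (x : R) :
  conjc (kummer a b x%:C) = kummer (conjc a) (conjc b) x%:C.
Proof.
rewrite /kummer -rmorphM (@pser_conj 1 (2 * cmod a + cmod b)); first last.
- have [A0 C0 H] := exp_type_kcoef a b; split=> // j.
  apply: le_trans (H j); rewrite le_eqVlt; apply/orP; left; apply/eqP.
  by rewrite /cmod; case: (kcoef a b j) => u v /=; rewrite sqrrN.
- exact: exp_type_kcoef.
by congr (pser _ _); apply/funext => j; rewrite kcoef_conj.
Qed.

Lemma dkummer_conj a b (x : R) :
  conjc (dkummer a b x%:C) = dkummer (conjc a) (conjc b) x%:C.
Proof.
have h := exp_type_dcoef (exp_type_kcoef a b).
have realM : x%:C * x%:C = (x * x)%:C by rewrite rmorphM.
rewrite /dkummer conjcM realM (pser_conj _ h); last first.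
  have [A0 C0 H] := h; split=> // j.
  apply: le_trans (H j); rewrite le_eqVlt; apply/orP; left; apply/eqP.
  by rewrite /cmod; case: (dcoef _ j) => u v /=; rewrite sqrrN.
have -> : 1 * x%:C + x%:C * 1 = (x + x)%:C by rewrite mul1r mulr1 rmorphD.
rewrite conjc_real; congr (_ * _); congr (pser _ _).
by apply/funext => j; rewrite /dcoef conjcM conjc_nat kcoef_conj.
Qed.

Lemma kcoef_scale a b j : a != 0 -> kcoef a b j = a ^+ j * kcoef 1 (b / a) j.
Proof.
move=> a0; elim: j => [|j IH]; first by rewrite expr0 mul1r.
rewrite /= IH exprS.
rewrite (_ : 4 * 1 * j%:R + b / a = a^-1 * (4 * a * j%:R + b)); last by field.
by rewrite [RHS](_ : _ = a * a^-1 * ((4 * a * j%:R + b) / ((2 * j + 1) * (2 * j + 2))%:R *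
   (a ^+ j * kcoef 1 (b / a) j))); [rewrite mulfV // mul1r|ring].
Qed.

Lemma kummer_scale a b r z : a != 0 -> r ^+ 2 = a -> kummer a b z = kummer 1 (b / a) (r * z).
Proof.
move=> a0 ra; apply: (pserE (exp_type_kcoef a b)).
apply: csum_ext (pserP (r * z * (r * z)) (exp_type_kcoef 1 (b / a))) _ => j.
rewrite (kcoef_scale b j a0) (_ : r * z * (r * z) = r ^+ 2 * (z * z)); last by ring.
by rewrite ra exprMn; ring.
Qed.

(** Replacing z by a square root of a times z turns y'' = 2 a z y' + b y into Hermite's equation
    with nu = - b / (2 a). *)
Lemma weber_kummer a b : a != 0 -> weber_expressible (kummer a b).
Proof.
move=> a0; pose r := sqrtc a.
have ra : r ^+ 2 = a by rewrite sqr_sqrtc.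
have -> : kummer a b = fun z => kummer 1 (b / a) (r * z + 0).
  by apply/funext => z; rewrite addr0; exact: kummer_scale.
apply: weber_linear; apply: (@weber_hermite R (- (b / a) / 2)).
exists (dkummer 1 (b / a)), (fun z => 2 * 1 * z * dkummer 1 (b / a) z + (b / a) * kummer 1 (b / a) z).
split.
- exact: cderiv_entire (cderiv_kummer _ _).
- exact: cderiv_entire (cderiv_dkummer _ _).
- by move=> z; field.
Qed.

Lemma weber_dkummer a b : a != 0 -> weber_expressible (dkummer a b).
Proof.
move=> a0; apply: weber_derive (weber_kummer b a0) _.
exact: cderiv_entire (cderiv_kummer _ _).
Qed.

End Kummer.

(** * Functions of a real variable expressed by Weber functions *)

Section RealExpressions.
Variable R : realType.
Implicit Types (f g : R -> R[i]).

(** Agreement is asked for on the real line only; this admits real parts, imaginary parts and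
    conjugates, once the conjugate is known to be expressible there. *)
Definition rexpr f : Prop := exists2 F : R[i] -> R[i],
  weber_expressible F & forall x : R, f x = F x%:C.

Lemma rexpr_ext f g : rexpr f -> f =1 g -> rexpr g.
Proof. by move=> h /funext <-. Qed.

Lemma rexpr_cst (c : R[i]) : rexpr (fun=> c).
Proof. by exists (fun=> c) => //; exact: weber_const. Qed.

Lemma rexpr_id : rexpr (fun x => x%:C).
Proof. by exists (fun z => z) => //; exact: weber_id. Qed.

Lemma rexprD f g : rexpr f -> rexpr g -> rexpr (fun x => f x + g x).
Proof.
move=> [F hF fF] [G hG gG]; exists (fun z => F z + G z); first exact: weber_add.
by move=> x; rewrite fF gG.
Qed.

Lemma rexprM f g : rexpr f -> rexpr g -> rexpr (fun x => f x * g x).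
Proof.
move=> [F hF fF] [G hG gG]; exists (fun z => F z * G z); first exact: weber_mul.
by move=> x; rewrite fF gG.
Qed.

Lemma rexprN f : rexpr f -> rexpr (fun x => - f x).
Proof.
move=> h; apply: rexpr_ext (rexprM (rexpr_cst (-1)) h) _ => x.
by rewrite mulN1r.
Qed.

Lemma rexpr_exp f : rexpr f -> rexpr (fun x => cexp (f x)).
Proof.
move=> [F hF fF]; exists (fun z => cexp (F z)); first exact: weber_exp.
by move=> x; rewrite fF.
Qed.

Lemma rexpr_Re f : rexpr f -> rexpr (fun x => conjc (f x)) ->
  rexpr (fun x => (complex.Re (f x))%:C).
Proof.
move=> h1 h2; apply: rexpr_ext (rexprM (rexpr_cst 2^-1) (rexprD h1 h2)) _ => x.
have -> : f x + conjc (f x) = 2 * (complex.Re (f x))%:C.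
  by case: (f x) => u v; apply/eqP; rewrite eq_complex /=; apply/andP; split; apply/eqP; ring.
by rewrite mulKf // pnatr_eq0.
Qed.

Lemma rexpr_Im f : rexpr f -> rexpr (fun x => conjc (f x)) ->
  rexpr (fun x => (complex.Im (f x))%:C).
Proof.
move=> h1 h2; apply: rexpr_ext (rexprM (rexpr_cst (2 * 'i)^-1) (rexprD h1 (rexprN h2))) _ => x.
have -> : f x - conjc (f x) = (2 * 'i) * (complex.Im (f x))%:C.
  by case: (f x) => u v; apply/eqP; rewrite eq_complex /=; apply/andP; split; apply/eqP; ring.
rewrite mulKf // mulf_neq0 ?pnatr_eq0 //.
by rewrite eq_complex /= oner_eq0 andbF.
Qed.

Lemma rexpr_real_exp (f : R -> R) : rexpr (fun x => (f x)%:C) -> rexpr (fun x => (expR (f x))%:C).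
Proof.
move=> h; apply: rexpr_ext (rexpr_exp h) _ => x.
by rewrite /cexp /= cos0 sin0 mulr1 mulr0.
Qed.

Lemma rexpr_cos_sin (f : R -> R) : rexpr (fun x => (f x)%:C) ->
  rexpr (fun x => (cos (f x))%:C) /\ rexpr (fun x => (sin (f x))%:C).
Proof.
move=> h.
have e1 : rexpr (fun x => cos (f x) +i* sin (f x)).
  apply: rexpr_ext (rexpr_exp (rexprM (rexpr_cst 'i) h)) _ => x.
  have -> : 'i%C * (f x)%:C = 0 +i* f x.
    by apply/eqP; rewrite eq_complex /=; apply/andP; split; apply/eqP; ring.
  by rewrite /cexp /= expR0 !mul1r.
have e2 : rexpr (fun x => conjc (cos (f x) +i* sin (f x))).
  apply: rexpr_ext (rexpr_exp (rexprM (rexpr_cst (- 'i)) h)) _ => x.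
  have -> : - 'i%C * (f x)%:C = 0 +i* - f x.
    by apply/eqP; rewrite eq_complex /=; apply/andP; split; apply/eqP; ring.
  by rewrite /cexp /= expR0 !mul1r cosN sinN.
split; first exact: rexpr_Re e1 e2.
exact: rexpr_Im e1 e2.
Qed.

End RealExpressions.

(** * Eigenspaces *)

Section Eigenspaces.
Variables (R : realType) (alpha k omega0 : R).
Hypothesis halpha : 0 < alpha.
Hypothesis hcos : cos omega0 != 0.

Let gamma := alpha * tan omega0.
Local Notation W := (Wm alpha k omega0).
Local Notation theta := (phase alpha omega0).

Lemma prim_Re (f f' : R[i] -> R[i]) : cderiv f f' ->
  continuous (fun x : R => complex.Re (f' x%:C)) ->
  prim (fun x => complex.Re (f x%:C)) (fun x => complex.Re (f' x%:C)).
Proof.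
move=> H c; apply: der_prim => //.
by move=> x; have [h _] := cderiv_real x H.
Qed.

Lemma prim_Im (f f' : R[i] -> R[i]) : cderiv f f' ->
  continuous (fun x : R => complex.Im (f' x%:C)) ->
  prim (fun x => complex.Im (f x%:C)) (fun x => complex.Im (f' x%:C)).
Proof.
move=> H c; apply: der_prim => //.
by move=> x; have [_ h] := cderiv_real x H.
Qed.

Lemma cderiv_cont (f f' : R[i] -> R[i]) : cderiv f f' ->
  continuous (fun x : R => complex.Re (f x%:C)) /\
  continuous (fun x : R => complex.Im (f x%:C)).
Proof.
move=> H; split=> x; have [h1 h2] := cderiv_real x H;
  by apply: differentiable_continuous; apply/derivable1_diffP; apply: ex_derive.
Qed.

Let a : R[i] := 0 +i* gamma.
Let b : R[i] := (k ^+ 2)%:C.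
Definition kre (x : R) := complex.Re (kummer a b x%:C).
Definition kim (x : R) := complex.Im (kummer a b x%:C).
Definition dkre (x : R) := complex.Re (dkummer a b x%:C).
Definition dkim (x : R) := complex.Im (dkummer a b x%:C).

Lemma prim_kre : prim kre dkre.
Proof. exact: prim_Re (cderiv_kummer a b) (cderiv_cont (cderiv_dkummer a b)).1. Qed.

Lemma prim_kim : prim kim dkim.
Proof. exact: prim_Im (cderiv_kummer a b) (cderiv_cont (cderiv_dkummer a b)).2. Qed.

Lemma prim_dkummer : prim dkre (fun x => - (2 * gamma * x * dkim x) + k ^+ 2 * kre x) /\
  prim dkim (fun x => 2 * gamma * x * dkre x + k ^+ 2 * kim x).
Proof.
have [cr ci] := cderiv_cont (cderiv_kummer a b).
have [cdr cdi] := cderiv_cont (cderiv_dkummer a b).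
have cl : continuous (fun x : R => 2 * gamma * x).
  by move=> x; apply: cvgM; [exact: cvg_cst|exact: cvg_id].
have E (x : R) : 2 * a * x%:C * dkummer a b x%:C + b * kummer a b x%:C =
   (- (2 * gamma * x * dkim x) + k ^+ 2 * kre x) +i* (2 * gamma * x * dkre x + k ^+ 2 * kim x).
  rewrite /dkre /dkim /kre /kim; case: (dkummer a b _) => u v; case: (kummer a b _) => s t.
  by apply/eqP; rewrite eq_complex /=; apply/andP; split; apply/eqP; ring.
split.
  have := @prim_Re _ _ (cderiv_dkummer a b).
  rewrite (_ : (fun x : R => complex.Re (2 * a * x%:C * dkummer a b x%:C + b * kummer a b x%:C)) =
    (fun x => - (2 * gamma * x * dkim x) + k ^+ 2 * kre x)); last by apply/funext => x; rewrite E.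
  apply; move=> x; apply: cvgD; first by apply: cvgN; apply: cvgM; [exact: cl|exact: cdi].
  by apply: cvgM; [exact: cvg_cst|exact: cr].
have := @prim_Im _ _ (cderiv_dkummer a b).
rewrite (_ : (fun x : R => complex.Im (2 * a * x%:C * dkummer a b x%:C + b * kummer a b x%:C)) =
  (fun x => 2 * gamma * x * dkre x + k ^+ 2 * kim x)); last by apply/funext => x; rewrite E.
apply; move=> x; apply: cvgD; first by apply: cvgM; [exact: cl|exact: cdr].
by apply: cvgM; [exact: cvg_cst|exact: ci].
Qed.

Lemma kummer_at0 : [/\ kre 0 = 1, kim 0 = 0, dkre 0 = 0 & dkim 0 = 0].
Proof. by rewrite /kre /kim /dkre /dkim (kummer0 a b) (dkummer0 a b). Qed.

Lemma prim_at0 (f : R -> R) : continuous f -> exists F, prim F f /\ F 0 = 0.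
Proof.
move=> c; have [F pF] := prim_exists (locint_cont c).
exists (fun x => F x - F 0); split; last by rewrite subrr.
by apply: prim_ext (primB pF (prim_cst (F 0))) _ _ => x //; rewrite subr0.
Qed.

Lemma prim0_cst (F : R -> R) : prim F (fun=> 0) -> forall x, F x = F 0.
Proof.
move=> pF x.
have E u v : u <= v -> F v = F u.
  move=> uv; apply/eqP; rewrite -subr_eq0 pF.2 //.
  by rewrite Rintegral_cst //= mul0r.
by have [h|/ltW h] := leP x 0; [rewrite (E _ _ h)|rewrite (E _ _ h)].
Qed.

Let cosc w : continuous (fun x : R => cos (theta w x)).
Proof. exact: prim_cont (prim_cos_phase alpha omega0 w). Qed.

Let sinc w : continuous (fun x : R => sin (theta w x)).
Proof. exact: prim_cont (prim_sin_phase alpha omega0 w). Qed.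

(* In the coordinates p = u + i v and q = u - i v, the equation
   (u, v)' = - k R(theta) (u, v) becomes p' = - k e^(i theta) q and
   q' = - k e^(- i theta) p, so that p'' = 2 i gamma x p' + k^2 p. *)
Lemma first_order_pair w : exists qr qi,
  [/\ prim qr (fun x => - k * (cos (theta w x) * kre x + sin (theta w x) * kim x)),
      prim qi (fun x => - k * (cos (theta w x) * kim x - sin (theta w x) * kre x)),
      qr 0 = 0, qi 0 = 0 &
      forall x, dkre x = - k * (cos (theta w x) * qr x - sin (theta w x) * qi x) /\
                dkim x = - k * (cos (theta w x) * qi x + sin (theta w x) * qr x)].
Proof.
have [cr ci] := cderiv_cont (cderiv_kummer a b).
have c1 : continuous (fun x : R => - k * (cos (theta w x) * kre x + sin (theta w x) * kim x)).
  move=> x; apply: cvgM; first exact: cvg_cst.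
  by apply: cvgD; apply: cvgM; [exact: cosc|exact: cr|exact: sinc|exact: ci].
have c2 : continuous (fun x : R => - k * (cos (theta w x) * kim x - sin (theta w x) * kre x)).
  move=> x; apply: cvgM; first exact: cvg_cst.
  by apply: cvgB; apply: cvgM; [exact: cosc|exact: ci|exact: sinc|exact: cr].
have [qr [pqr qr0]] := prim_at0 c1; have [qi [pqi qi0]] := prim_at0 c2.
exists qr, qi; split=> //.
have [pdr pdi] := prim_dkummer.
have pc := prim_cos_phase alpha omega0 w; have ps := prim_sin_phase alpha omega0 w.
have [pr0 pi0 dr0 di0] := kummer_at0.
(* [N1] and [N2] are the real and imaginary parts of e^(- i theta) p' + k q = 0. The left side is
   constant by the equation for p'', and zero at 0. Defining q as a primitive, not as a quotient of
   p' by k, covers k = 0. *)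
have N1 x : cos (theta w x) * dkre x + sin (theta w x) * dkim x + k * qr x = 0.
  rewrite (@prim0_cst (fun x => cos (theta w x) * dkre x + sin (theta w x) * dkim x + k * qr x)).
    by rewrite dr0 di0 qr0 !mulr0 !addr0.
  apply: prim_ext (primD (primD (primM pc pdr) (primM ps pdi)) (primZ k pqr)) _ _ => y //.
  by rewrite -/gamma; ring.
have N2 x : cos (theta w x) * dkim x - sin (theta w x) * dkre x + k * qi x = 0.
  rewrite (@prim0_cst (fun x => cos (theta w x) * dkim x - sin (theta w x) * dkre x + k * qi x)).
    by rewrite dr0 di0 qi0 !mulr0 subrr !addr0.
  apply: prim_ext (primD (primB (primM pc pdi) (primM ps pdr)) (primZ k pqi)) _ _ => y //.
  by rewrite -/gamma; ring.
move=> x; have cs := sin_sqr (theta w x).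
have e1 : k * qr x = - (cos (theta w x) * dkre x + sin (theta w x) * dkim x) by have := N1 x; lra.
have e2 : k * qi x = - (cos (theta w x) * dkim x - sin (theta w x) * dkre x) by have := N2 x; lra.
split.
  transitivity (- cos (theta w x) * (k * qr x) + sin (theta w x) * (k * qi x)); last by ring.
  rewrite e1 e2; transitivity ((cos (theta w x) ^+ 2 + sin (theta w x) ^+ 2) * dkre x); last by ring.
  by rewrite cs; ring.
transitivity (- cos (theta w x) * (k * qi x) - sin (theta w x) * (k * qr x)); last by ring.
rewrite e1 e2; transitivity ((cos (theta w x) ^+ 2 + sin (theta w x) ^+ 2) * dkim x); last by ring.
by rewrite cs; ring.
Qed.

Definition mx4 (s t u v : R) : 'M[R]_2 :=
  \matrix_(i, j) if i == 0 then (if j == 0 then s else t) else (if j == 0 then u else v).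

Lemma mx4E s t u v : [/\ mx4 s t u v 0 0 = s, mx4 s t u v 0 1 = t,
  mx4 s t u v 1 0 = u & mx4 s t u v 1 1 = v].
Proof. by split; rewrite mxE. Qed.

Lemma mprim4 (s t u v s' t' u' v' : R -> R) (P : R -> 'M[R]_2) :
  prim s s' -> prim t t' -> prim u u' -> prim v v' ->
  (forall x, [/\ P x 0 0 = s' x, P x 0 1 = t' x, P x 1 0 = u' x & P x 1 1 = v' x]) ->
  mprim (fun x => mx4 (s x) (t x) (u x) (v x)) P.
Proof.
move=> hs ht hu hv HP i j; case: (I2P i) => ->; case: (I2P j) => ->.
- apply: prim_ext hs _ _ => x; last by case: (HP x).
  by case: (mx4E (s x) (t x) (u x) (v x)).
- apply: prim_ext ht _ _ => x; last by case: (HP x).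
  by case: (mx4E (s x) (t x) (u x) (v x)).
- apply: prim_ext hu _ _ => x; last by case: (HP x).
  by case: (mx4E (s x) (t x) (u x) (v x)).
- apply: prim_ext hv _ _ => x; last by case: (HP x).
  by case: (mx4E (s x) (t x) (u x) (v x)).
Qed.

Lemma gaussian_prim (c : R) : prim (fun x => expR (c * (x * x)))
  (fun x => expR (c * (x * x)) * (c * (x + x))).
Proof.
have ph : prim (fun x => c * (x * x)) (fun x => c * (x + x)).
  apply: prim_ext (primZ c (primM (@prim_id R) (@prim_id R))) _ _ => x //.
  by rewrite mul1r mulr1.
apply: (prim_comp (F := @expR R) ph).
  by move=> x; apply: cvgM; [exact: cvg_cst|apply: cvgD; exact: cvg_id].
exact: continuous_expR.
Qed.

Lemma mulmx2E (A B : 'M[R]_2) i j : (A *m B) i j = A i 0 * B 0 j + A i 1 * B 1 j.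
Proof. by rewrite mxE sum_I2. Qed.

Lemma entry_sub (A B : 'M[R]_2) i j : (A - B) i j = A i j - B i j.
Proof. by rewrite !mxE. Qed.

Lemma rexpr_theta w : rexpr (fun x => (theta w x)%:C).
Proof.
apply: rexpr_ext (rexprD (rexprM (rexpr_cst gamma%:C) (rexprM (@rexpr_id R) (@rexpr_id R))) (rexpr_cst w%:C)) _ => x.
by rewrite -!rmorphM -rmorphD /phase expr2.
Qed.

Lemma rexpr_kummer : gamma != 0 -> [/\ rexpr (fun x => (kre x)%:C), rexpr (fun x => (kim x)%:C),
  rexpr (fun x => (dkre x)%:C) & rexpr (fun x => (dkim x)%:C)].
Proof.
move=> g0.
have a0 : a != 0 by rewrite eq_complex /= negb_and g0 orbT.
have a0' : conjc a != 0 by rewrite eq_complex /= oppr_eq0 negb_and g0 orbT.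
have e1 : rexpr (fun x => kummer a b x%:C) by exists (kummer a b) => //; exact: weber_kummer.
have e2 : rexpr (fun x => dkummer a b x%:C) by exists (dkummer a b) => //; exact: weber_dkummer.
have e1' : rexpr (fun x => conjc (kummer a b x%:C)).
  exists (kummer (conjc a) (conjc b)); first exact: weber_kummer.
  by move=> x; exact: kummer_conj.
have e2' : rexpr (fun x => conjc (dkummer a b x%:C)).
  exists (dkummer (conjc a) (conjc b)); first exact: weber_dkummer.
  by move=> x; exact: dkummer_conj.
split; [exact: rexpr_Re e1 e1'|exact: rexpr_Im e1 e1'|exact: rexpr_Re e2 e2'|exact: rexpr_Im e2 e2'].
Qed.

Lemma rexpr_lin (c d : R) (f g : R -> R) : rexpr (fun x => (f x)%:C) -> rexpr (fun x => (g x)%:C) ->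
  rexpr (fun x => (c * f x + d * g x)%:C).
Proof.
move=> hf hg; apply: rexpr_ext (rexprD (rexprM (rexpr_cst c%:C) hf) (rexprM (rexpr_cst d%:C) hg)) _ => x.
by rewrite -!rmorphM -rmorphD.
Qed.

Lemma rexpr_mul (f g : R -> R) : rexpr (fun x => (f x)%:C) -> rexpr (fun x => (g x)%:C) ->
  rexpr (fun x => (f x * g x)%:C).
Proof. by move=> hf hg; apply: rexpr_ext (rexprM hf hg) _ => x; rewrite -rmorphM. Qed.

(** S is a fundamental matrix of A psi = 0. G solves the adjoint equation, so G S is constant and G
    is the inverse of S; it serves to show that all solutions are combinations of the columns of
    S. *)
Lemma ground_states w : exists S G : R -> 'M[R]_2,
  [/\ mprim S (fun x => - (W w x *m S x)), mprim G (fun x => G x *m W w x),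
      S 0 = 1%:M, G 0 = 1%:M &
      k != 0 -> gamma != 0 -> forall i j, rexpr (fun x => (S x i j)%:C)].
Proof.
have [qr [qi [pqr pqi qr0 qi0 dE]]] := first_order_pair w.
have [pr0 pi0 _ _] := kummer_at0.
pose c x := cos (theta w x); pose s x := sin (theta w x).
have ppr : prim kre (fun x => - k * (c x * qr x - s x * qi x)).
  by apply: prim_ext prim_kre _ _ => x //; case: (dE x).
have ppi : prim kim (fun x => - k * (c x * qi x + s x * qr x)).
  by apply: prim_ext prim_kim _ _ => x //; case: (dE x).
(* If (p, q) solves the complex system, so does (conj q, conj p). Hence p + conj q and i (p - conj
   q) yield real solutions, whose components are their real and imaginary parts: the columns of
   T. *)
pose T x := mx4 (kre x + qr x) (- (kim x + qi x)) (kim x - qi x) (kre x - qr x).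
(* The adjugate of T; because the reflection has trace zero, it satisfies the equation of an
   inverse. *)
pose T' x := mx4 (kre x - qr x) (kim x + qi x) (- (kim x - qi x)) (kre x + qr x).
pose g1 (x : R) := expR (- (alpha / 2) * (x * x)); pose g2 (x : R) := expR (alpha / 2 * (x * x)).
have pT : mprim T (fun x => (- k) *: (reflection (theta w x) *m T x)).
  apply: (mprim4 (primD ppr pqr) (primN (primD ppi pqi)) (primB ppi pqi) (primB ppr pqr)) => x.
  have [r1 r2 r3 r4] := reflE (theta w x).
  have [t1 t2 t3 t4] := mx4E (kre x + qr x) (- (kim x + qi x)) (kim x - qi x) (kre x - qr x).
  by split; rewrite mxZE mulmx2E ?r1 ?r2 ?r3 ?r4 /T ?t1 ?t2 ?t3 ?t4 -/(c x) -/(s x); ring.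
have pT' : mprim T' (fun x => k *: (T' x *m reflection (theta w x))).
  apply: (mprim4 (primB ppr pqr) (primD ppi pqi) (primN (primB ppi pqi)) (primD ppr pqr)) => x.
  have [r1 r2 r3 r4] := reflE (theta w x).
  have [t1 t2 t3 t4] := mx4E (kre x - qr x) (kim x + qi x) (- (kim x - qi x)) (kre x + qr x).
  by split; rewrite mxZE mulmx2E ?r1 ?r2 ?r3 ?r4 /T' ?t1 ?t2 ?t3 ?t4 -/(c x) -/(s x); ring.
exists (fun x => g1 x *: T x), (fun x => g2 x *: T' x); split.
- move=> i j; apply: prim_ext (primM (gaussian_prim (- (alpha / 2))) (pT i j)) _ _ => x.
    by rewrite mxZE.
  rewrite /Wm -scalemxAr mulmxDl mul_scalar_mx -scalemxAl !mxOpE -/(g1 x).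
  by rewrite (_ : - (alpha / 2) * (x + x) = - (alpha * x)); [ring|field].
- move=> i j; apply: prim_ext (primM (gaussian_prim (alpha / 2)) (pT' i j)) _ _ => x.
    by rewrite mxZE.
  rewrite /Wm -scalemxAl mulmxDr mul_mx_scalar -scalemxAr !mxOpE -/(g2 x).
  by rewrite (_ : alpha / 2 * (x + x) = alpha * x); [ring|field].
- have [t1 t2 t3 t4] := mx4E (kre 0 + qr 0) (- (kim 0 + qi 0)) (kim 0 - qi 0) (kre 0 - qr 0).
  have [s1 s2 s3 s4] := scalE (1 : R).
  by apply: mat2P; rewrite mxZE /T /g1 ?t1 ?t2 ?t3 ?t4 ?s1 ?s2 ?s3 ?s4 ?pr0 ?pi0 ?qr0 ?qi0 !mulr0 expR0; ring.
- have [t1 t2 t3 t4] := mx4E (kre 0 - qr 0) (kim 0 + qi 0) (- (kim 0 - qi 0)) (kre 0 + qr 0).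
  have [s1 s2 s3 s4] := scalE (1 : R).
  by apply: mat2P; rewrite mxZE /T' /g2 ?t1 ?t2 ?t3 ?t4 ?s1 ?s2 ?s3 ?s4 ?pr0 ?pi0 ?qr0 ?qi0 !mulr0 expR0; ring.
move=> k0 g0.
have [epr epi edr edi] := rexpr_kummer g0.
have [ec es] := rexpr_cos_sin (rexpr_theta w).
(* Here k != 0 enters: q = - e^(- i theta) p' / k expresses q without an integration. *)
have eqr : rexpr (fun x => (qr x)%:C).
  apply: rexpr_ext (rexpr_lin (- k^-1) (- k^-1) (rexpr_mul ec edr) (rexpr_mul es edi)) _ => x.
  have cs := sin_sqr (theta w x); have [-> ->] := dE x; congr (_%:C).
  transitivity ((cos (theta w x) ^+ 2 + sin (theta w x) ^+ 2) * qr x); first by field.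
  by rewrite cs; ring.
have eqi : rexpr (fun x => (qi x)%:C).
  apply: rexpr_ext (rexpr_lin (- k^-1) k^-1 (rexpr_mul ec edi) (rexpr_mul es edr)) _ => x.
  have cs := sin_sqr (theta w x); have [-> ->] := dE x; congr (_%:C).
  transitivity ((cos (theta w x) ^+ 2 + sin (theta w x) ^+ 2) * qi x); first by field.
  by rewrite cs; ring.
have eg : rexpr (fun x => (g1 x)%:C).
  apply: (rexpr_real_exp (f := fun x => - (alpha / 2) * (x * x))).
  apply: rexpr_ext (rexprM (rexpr_cst (- (alpha / 2))%:C) (rexprM (@rexpr_id R) (@rexpr_id R))) _ => x.
  by rewrite -!rmorphM.
move=> i j.
suff eT : rexpr (fun x => (T x i j)%:C).
  by apply: rexpr_ext (rexpr_mul eg eT) _ => x; rewrite mxZE.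
case: (I2P i) => ->; case: (I2P j) => ->.
- apply: rexpr_ext (rexpr_lin 1 1 epr eqr) _ => x.
  by case: (mx4E (kre x + qr x) (- (kim x + qi x)) (kim x - qi x) (kre x - qr x)) => -> *; congr (_%:C); ring.
- apply: rexpr_ext (rexpr_lin (-1) (-1) epi eqi) _ => x.
  by case: (mx4E (kre x + qr x) (- (kim x + qi x)) (kim x - qi x) (kre x - qr x)) => _ -> *; congr (_%:C); ring.
- apply: rexpr_ext (rexpr_lin 1 (-1) epi eqi) _ => x.
  by case: (mx4E (kre x + qr x) (- (kim x + qi x)) (kim x - qi x) (kre x - qr x)) => _ _ -> *; congr (_%:C); ring.
- apply: rexpr_ext (rexpr_lin 1 (-1) epr eqr) _ => x.
  by case: (mx4E (kre x + qr x) (- (kim x + qi x)) (kim x - qi x) (kre x - qr x)) => _ _ _ ->; congr (_%:C); ring.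
Qed.

Lemma rexpr_W w i j : rexpr (fun x => (W w x i j)%:C).
Proof.
have [ec es] := rexpr_cos_sin (rexpr_theta w).
case: (I2P i) => ->; case: (I2P j) => ->.
- apply: rexpr_ext (rexpr_lin alpha k (@rexpr_id R) ec) _ => x.
  by case: (WmE alpha k omega0 w x) => ->.
- apply: rexpr_ext (rexpr_lin k 0 es es) _ => x.
  by case: (WmE alpha k omega0 w x) => _ ->; rewrite mul0r addr0.
- apply: rexpr_ext (rexpr_lin k 0 es es) _ => x.
  by case: (WmE alpha k omega0 w x) => _ _ ->; rewrite mul0r addr0.
- apply: rexpr_ext (rexpr_lin alpha (- k) (@rexpr_id R) ec) _ => x.
  by case: (WmE alpha k omega0 w x) => _ _ _ ->; rewrite mulNr.
Qed.

Lemma dot_reflection_le (t : R) (A : 'M[R]_2) : `|dot A (reflection t *m A)| <= nsq A.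
Proof.
have r2 : nsq (reflection t *m A) = nsq A.
  have [r1 r2 r3 r4] := reflE t; rewrite !nsqE !mulmx2E r1 r2 r3 r4.
  transitivity ((cos t ^+ 2 + sin t ^+ 2) *
    (A 0 0 ^+ 2 + A 1 0 ^+ 2 + (A 0 1 ^+ 2 + A 1 1 ^+ 2))); first by ring.
  by rewrite cos2Dsin2 mul1r.
have := dot_young A (reflection t *m A) ltr01.
rewrite r2 divr1 mul1r normrM ger0_norm //; lra.
Qed.

(* x |psi|^2 has derivative at most (1 - 2 alpha x^2 + 2 |k| |x|) |psi|^2, and it
   is nonnegative at N and nonpositive at - N. *)
Lemma kernel_sqi w psi : mprim psi (fun x => - (W w x *m psi x)) -> exists K, sqi K psi.
Proof.
move=> pp.
have cpsi := mprim_cont pp.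
have [P pP] := prim_exists (locint_cont (cont_nsq cpsi)).
have n0 x y : x <= y -> P x <= P y.
  by move=> xy; apply: (prim_ge0 pP xy) => *; exact: nsq_ge0.
(* For |x| >= X one has |x| >= 1 and alpha |x| >= 1 + |k|, so the factor 1 - 2 alpha x^2 + 2 |k| |x|
   is at most 1 - 2 |x| <= -1. *)
pose X := 1 + (1 + `|k|) / alpha.
have a0 := halpha.
have k0 := normr_ge0 k.
have X1 : 1 <= X by rewrite /X lerDl divr_ge0 // ?(ltW halpha) //; lra.
(* On [- X, X] the same factor is at most 1 + 2 |k| X = Q - 1. *)
pose Q := 2 + 2 * `|k| * X.
have Q0 : 0 <= Q by rewrite /Q; have := mulr_ge0 k0 (le_trans ler01 X1); lra.
exists ((Q + 1) * (P X - P (- X))); apply: (sqi_cont cpsi pP) => N N0.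
have PX : 0 <= P X - P (- X) by rewrite subr_ge0 n0 //; lra.
have [NX|XN] := leP N X.
  have := n0 N X NX; have := n0 (- X) (- N).
  rewrite lerN2 => /(_ NX); have := mulr_ge0 Q0 PX; lra.
have pH := primM (@prim_id R) (prim_dot pp pp).
have dW x : `|dot (psi x) (W w x *m psi x) - alpha * x * nsq (psi x)| <= `|k| * nsq (psi x).
  rewrite /Wm mulmxDl mul_scalar_mx -scalemxAl dotDr !dotZr -/(nsq (psi x)).
  by rewrite addrAC subrr add0r normrM ler_wpM2l // dot_reflection_le.
have hle x : 1 * dot (psi x) (psi x) + x * (dot (- (W w x *m psi x)) (psi x) + dot (psi x) (- (W w x *m psi x)))
    <= (1 - 2 * alpha * x ^+ 2 + 2 * `|k| * `|x|) * nsq (psi x).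
  rewrite dotNl dotNr (dotC (W w x *m psi x)) -/(nsq (psi x)).
  have := dW x; rewrite ler_norml => /andP[d1 d2].
  have [x0|x0] := leP 0 x.
    have := ler_wpM2l x0 d1; rewrite (ger0_norm x0); lra.
  have := ler_wnM2l (ltW x0) d2; rewrite (ltr0_norm x0); lra.
have out x : X <= `|x| -> (1 - 2 * alpha * x ^+ 2 + 2 * `|k| * `|x|) * nsq (psi x) <= - nsq (psi x).
  move=> xX; rewrite -[leRHS]mulN1r; apply: ler_wpM2r; first exact: nsq_ge0.
  rewrite -(real_normK (num_real x)).
  have h1 : 1 + `|k| <= alpha * `|x|.
    have : (1 + `|k|) / alpha <= `|x| by move: xX; rewrite /X; lra.
    by rewrite ler_pdivrMr // mulrC.
  have x1 : 1 <= `|x| by lra.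
  have h2 : (1 + `|k|) * `|x| <= alpha * `|x| ^+ 2.
    by rewrite expr2 mulrA ler_wpM2r.
  lra.
have mid x : `|x| <= X -> (1 - 2 * alpha * x ^+ 2 + 2 * `|k| * `|x|) * nsq (psi x) <= (Q - 1) * nsq (psi x).
  move=> xX; apply: ler_wpM2r; first exact: nsq_ge0.
  have : 0 <= alpha * x ^+ 2 by rewrite mulr_ge0 ?sqr_ge0 // ltW.
  have : `|k| * `|x| <= `|k| * X by rewrite ler_wpM2l.
  by rewrite /Q; lra.
have A := prim_le pH (primN pP) (ltW XN) (fun x hx => le_trans (hle x) (out x
   (ltac:(rewrite ger0_norm; case/andP: hx => *; lra)))).
have NX' : - N <= - X by lra.
have B := prim_le pH (primN pP) NX' (fun x hx => le_trans (hle x) (out x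
   (ltac:(rewrite ler0_norm; case/andP: hx => *; lra)))).
have XX : - X <= X by lra.
have D := prim_le pH (primZ (Q - 1) pP) XX (fun x hx => le_trans (hle x) (mid x
   (ltac:(by rewrite ler_norml)))).
have e1 : 0 <= N * dot (psi N) (psi N) by rewrite mulr_ge0 ?nsq_ge0 // ltW.
have e2 : 0 <= N * dot (psi (- N)) (psi (- N)) by rewrite mulr_ge0 ?nsq_ge0 // ltW.
lra.
Qed.

(** Raising keeps square integrability: A^* xi is controlled by the energy estimate for the
    superpotential - W. *)
Lemma eigenpair_raise_sqi w z xi eta K :
  eigenpair alpha k omega0 (w + 2 * omega0) (z - (2 * alpha)%:C) xi eta -> sqi K xi ->
  exists K', sqi K' (fun x => (W w x + W (w + 2 * omega0) x) *m xi x - eta x).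
Proof.
move=> h s.
have [p1 p2] := susy_unshift (mprim_Wm alpha k omega0 w) (mprim_Wm _ _ _ _)
  (shape_invariance alpha k hcos w) h.
pose zeta x := (W w x + W (w + 2 * omega0) x) *m xi x - eta x.
have {}p1 : mprim xi (fun x => W w x *m xi x - zeta x) := p1.
have p2' : mprim zeta (fun x => xi x *m cmx z - W w x *m zeta x).
  apply: mprim_ext p2 _ _ => x; first by [].
  by rewrite mulmx_cmx_sub subrK.
have NW x : (- W w x)^T = - W w x by rewrite raddfN /= Wm_sym.
have [C C0 sC] := sqi_cmx z.
have h2 := susy_eta_sqi NW (susy_dual p1 p2') s (sC _ _ s).
exists (1 * (32 * (K + C * K))).
apply: (sqi_dom _ ler01 h2 (psi := zeta)).
- by move=> i j; apply: continuous_measurable_fun; exact: (mprim_cont p2').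
- by move=> x; rewrite mul1r -scaleN1r nsqZ sqrrN expr1n mul1r.
Qed.

(** The two real columns of E form a basis over C of the eigenspace, and H = A E. In E C, the rows
    of C encode the two complex coefficients. The third and fourth assertions are independence and
    completeness. *)
Lemma weber_eigenspace n w : exists E H : R -> 'M[R]_2,
  [/\ forall C : 'M[R]_2, eigenpair alpha k omega0 w (2 * n%:R * alpha)%:C (fun x => E x *m C) (fun x => H x *m C),
      exists K, sqi K E,
      forall C : 'M[R]_2, (forall x, E x *m C = 0) -> C = 0,
      forall psi eta K, eigenpair alpha k omega0 w (2 * n%:R * alpha)%:C psi eta -> sqi K psi ->
        exists C : 'M[R]_2, forall x, psi x = E x *m C &
      k != 0 -> gamma != 0 -> forall i j,
        rexpr (fun x => (E x i j)%:C) /\ rexpr (fun x => (H x i j)%:C)].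
Proof.
elim: n w => [|n IH] w.
  have [S [G [pS pG S0 G0 eS]]] := ground_states w.
  have z0 (A : 'M[R]_2) : A *m cmx (2 * 0%:R * alpha)%:C = 0.
    by rewrite mulmx_cmx_real mulr0 mul0r scale0r.
  have SG x : S x *m G x = 1%:M.
    apply: mulmx1C; have p := mprimM pG pS.
    apply/matrixP => i j.
    rewrite (@prim0_cst (fun x => (G x *m S x) i j)); first by rewrite S0 G0 mulmx1.
    apply: prim_ext (p i j) _ _ => y //.
    by rewrite mulmxN mulmxA subrr mxE.
  have [K sK] := kernel_sqi pS.
  exists S, (fun=> 0); split.
  - move=> C; split.
      apply: mprim_ext (mprimMr C pS) _ _ => x //.
      by rewrite mul0mx sub0r mulNmx mulmxA.
    apply: mprim_ext (@mprim_cst R 0) _ _ => x; first by rewrite mul0mx.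
    by rewrite mul0mx mulmx0 z0 subrr.
  - by exists K.
  - by move=> C /(_ 0); rewrite S0 mul1mx.
  - move=> psi eta K' h s.
    have h' : susy (W w) psi eta (fun=> 0).
      split; first exact: h.1.
      by apply: mprim_ext h.2 _ _ => x //; rewrite z0.
    have e0 := susy_ker (Wm_sym alpha k omega0 w) h' s.
    have p := mprimM pG h.1.
    have Gp x : G x *m psi x = psi 0.
      apply/matrixP => i j.
      rewrite (@prim0_cst (fun x => (G x *m psi x) i j)); first by rewrite G0 mul1mx.
      apply: prim_ext (p i j) _ _ => y //.
      by rewrite e0 sub0r mulmxN mulmxA subrr mxE.
    exists (psi 0) => x; by rewrite -(Gp x) mulmxA SG mul1mx.
  - move=> k0 g0 i j; split; first exact: eS.
    by apply: rexpr_ext (rexpr_cst 0) _ => x; rewrite mxE.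
have [E [H [h1 [K sK] h3 h4 h5]]] := IH (w + 2 * omega0).
pose lam : R := 2 * n.+1%:R * alpha.
have lam0 : lam != 0 by rewrite /lam !mulf_neq0 ?pnatr_eq0 // gt_eqF.
have lE : (2 * n%:R * alpha)%:C = lam%:C - (2 * alpha)%:C :> R[i].
  by rewrite -rmorphB /= /lam -natr1; congr (_%:C); ring.
rewrite -/lam; rewrite lE in h1 h4.
pose V x := W w x + W (w + 2 * omega0) x.
(* This is A^* E for the old E, and lam E = A A^* E is its image under A. *)
exists (fun x => V x *m E x - H x), (fun x => lam *: E x).
have raise C : eigenpair alpha k omega0 w lam%:C (fun x => (V x *m E x - H x) *m C)
    (fun x => lam *: E x *m C).
  have [q1 q2] := eigenpair_raise hcos (h1 C).
  have E1 : (fun x => (V x *m E x - H x) *m C) = (fun x => V x *m (E x *m C) - H x *m C).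
    by apply/funext => x; rewrite mulmxBl mulmxA.
  have E2 : (fun x => lam *: E x *m C) = (fun x => E x *m C *m cmx lam%:C).
    by apply/funext => x; rewrite mulmx_cmx_real scalemxAl.
  by rewrite E1 E2; split.
split.
- exact: raise.
- have := h1 1%:M; rewrite (_ : (fun x => E x *m 1%:M) = E); last by apply/funext => x; rewrite mulmx1.
  rewrite (_ : (fun x => H x *m 1%:M) = H); last by apply/funext => x; rewrite mulmx1.
  by move=> h; exact: eigenpair_raise_sqi h sK.
(* If A^* E C = 0, then applying A gives lam E C = 0, and lam is nonzero. *)
- move=> C C0; apply: h3 => x.
  have [q1 q2] := raise C.
  have cc : mcont (fun x => lam *: E x *m C - W w x *m ((V x *m E x - H x) *m C)).
    have [cp ce] := susy_eta_cont (raise C).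
    by apply: mcontD => //; apply/mcontN/mcontM => //; exact: mprim_cont (mprim_Wm _ _ _ _).
  have := mprim0_eq0 q1 cc C0 x; rewrite C0 mulmx0 subr0 -scalemxAl => /eqP.
  by rewrite scaler_eq0 (negbTE lam0) /= => /eqP.
(* A psi is an L_2 eigenfunction of the next operator, so A psi = E C by induction; then lam psi =
   A^* A psi = A^* E C. *)
- move=> psi eta K' hp s.
  have [Cz Cz0 sCz] := sqi_cmx lam%:C.
  have se := susy_eta_sqi (Wm_sym alpha k omega0 w) hp s (sCz _ _ s).
  have hl := eigenpair_lower hcos hp.
  have [C EC] := h4 _ _ _ hl se.
  have [cp ce] := susy_eta_cont hl.
  have [cp' ce'] := susy_eta_cont (h1 C).
  have cW2 : mcont (W (w + 2 * omega0)) by exact: mprim_cont (mprim_Wm _ _ _ _).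
  have Heq x : (W w x + W (w + 2 * omega0) x) *m eta x - psi x *m cmx lam%:C = H x *m C.
    have eq1 : mprim (fun=> 0) (fun x => ((W w x + W (w + 2 * omega0) x) *m eta x - psi x *m cmx lam%:C) - H x *m C).
      apply: mprim_ext (mprimB hl.1 (h1 C).1) _ _ => y.
        by rewrite EC subrr.
      by rewrite EC opprB addrA addrNK.
    have := mprim0_eq0 eq1 _ (fun=> erefl) x.
    have cc : mcont (fun x => ((W w x + W (w + 2 * omega0) x) *m eta x - psi x *m cmx lam%:C) - H x *m C).
      by apply: mcontD => //; exact: mcontN.
    by move=> /(_ cc) /eqP; rewrite subr_eq0 => /eqP.
  exists (lam^-1 *: C) => x.
  rewrite -scalemxAr mulmxBl -(Heq x) -mulmxA -EC opprB addrCA subrr addr0.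
  by rewrite mulmx_cmx_real scalerA mulVf // scale1r.
- move=> k0 g0 i j.
  have eE i' j' := (h5 k0 g0 i' j').1; have eH i' j' := (h5 k0 g0 i' j').2.
  split; last first.
    by apply: rexpr_ext (rexpr_lin lam 0 (eE i j) (eE i j)) _ => x; rewrite mul0r addr0 mxZE.
  have eV i' j' : rexpr (fun x => (V x i' j')%:C).
    by apply: rexpr_ext (rexpr_lin 1 1 (rexpr_W w i' j') (rexpr_W (w + 2 * omega0) i' j')) _ => x; rewrite !mul1r /V mxDE.
  have e1 := rexpr_lin 1 1 (rexpr_mul (eV i 0) (eE 0 j)) (rexpr_mul (eV i 1) (eE 1 j)).
  apply: rexpr_ext (rexpr_lin 1 (-1) e1 (eH i j)) _ => x.
  have -> : (V x *m E x - H x) i j = (V x *m E x) i j - H x i j.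
    exact: entry_sub.
  by rewrite mulmx2E !mul1r mulN1r.
Qed.

End Eigenspaces.

(** * The operator L *)

Section RealForm.
Variable R : realType.
Implicit Types (psi g : R -> 'cV[R[i]]_2) (P : R -> 'M[R]_2).
Local Notation mu := (@lebesgue_measure R).

Definition toM psi (x : R) : 'M[R]_2 :=
  \matrix_(i, j) if j == 0 then complex.Re (psi x i 0) else complex.Im (psi x i 0).

Definition ofM P (x : R) : 'cV[R[i]]_2 := \col_i (P x i 0 +i* P x i 1).

Lemma toM0 psi x i : toM psi x i 0 = complex.Re (psi x i 0).
Proof. by rewrite mxE. Qed.

Lemma toM1 psi x i : toM psi x i 1 = complex.Im (psi x i 0).
Proof. by rewrite mxE. Qed.

Lemma toMK psi : ofM (toM psi) = psi.
Proof.
apply/funext => x; apply/colP => i; rewrite mxE toM0 toM1.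
by case: (psi x i 0).
Qed.

Lemma ofMK P : toM (ofM P) = P.
Proof.
apply/funext => x; apply/matrixP => i j.
by case: (I2P j) => ->; rewrite ?toM0 ?toM1 mxE.
Qed.

Lemma toM_shift g (z : R[i]) psi x :
  toM (fun x => g x + z *: psi x) x = toM g x + toM psi x *m cmx z.
Proof.
apply/matrixP => i j; rewrite [RHS]mxE.
case: (I2P j) => ->.
  rewrite !toM0 mulmx_cmx0 toM0 toM1 !mxE.
  by case: (g x i 0) => u v; case: z => s t; case: (psi x i 0) => p q /=; ring.
rewrite !toM1 mulmx_cmx1 toM0 toM1 !mxE.
by case: (g x i 0) => u v; case: z => s t; case: (psi x i 0) => p q /=; ring.
Qed.

(** Monotone convergence along the intervals [- n, n]. *)
Lemma integral_setT_le (f : R -> R) (K : R) : measurable_fun setT f ->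
  (forall x, 0 <= f x) -> (forall a b : R, mu.-integrable `[a, b] (EFin \o f)) ->
  (forall a b : R, a <= b -> \int[mu]_(x in `[a, b]) f x <= K) ->
  (\int[mu]_x (f x)%:E <= K%:E)%E.
Proof.
move=> mf f0 lf fK.
pose F (n : nat) : set R := `[- n%:R, n%:R]%classic.
have FT : \bigcup_i F i = setT.
  apply/seteqP; split=> // x _.
  exists (Num.bound `|x|) => //; rewrite /F /= in_itv /= -ler_norml.
  by apply: ltW; apply: archi_boundP.
have H : (\int[mu]_(x in F i) (f x)%:E)%E @[i --> \oo] --> (\int[mu]_x (f x)%:E)%E.
  rewrite -FT; apply: ge0_nondecreasing_set_cvg_integral.
  - move=> n m nm; rewrite subsetEset => x; rewrite /F /= !in_itv /= => /andP[h1 h2].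
    have h : (n%:R : R) <= m%:R by rewrite ler_nat.
    by apply/andP; split; lra.
  - by move=> i; exact: measurable_itv.
  - by move=> i; apply/measurable_EFinP; apply: measurable_funTS.
  - by move=> i x _; rewrite /= lee_fin.
rewrite -(cvg_lim _ H) //; apply: lime_le; first by apply/cvg_ex; eexists; exact: H.
apply: nearW => n.
have nn : - (n%:R : R) <= n%:R by rewrite (le_trans (_ : _ <= 0)) ?oppr_le0.
have := fK _ _ nn; rewrite -lee_fin; apply: le_trans.
rewrite /Rintegral fineK //; apply: integrable_fin_num => //; exact: lf.
Qed.

Definition energy P : \bar R := (\int[mu]_x (nsq (P x))%:E)%E.

Lemma energy_le K P : sqi K P -> (energy P <= K%:E)%E.
Proof.
move=> [m [mn ln] h]; apply: integral_setT_le => // x; exact: nsq_ge0.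
Qed.

Lemma vnorm_sqr psi x : vnorm (psi x) ^+ 2 = nsq (toM psi x).
Proof.
rewrite /vnorm sqr_sqrtr; last first.
  by apply: sumr_ge0 => j _; rewrite addr_ge0 ?sqr_ge0.
by rewrite sum_I2 nsqE !toM0 !toM1; ring.
Qed.

Lemma L2norm_energy psi : L2norm psi = sqrte (energy (toM psi)).
Proof.
rewrite /L2norm unlock -poweR12_sqrt; last first.
  by apply: integral_ge0 => x _; rewrite lee_fin nsq_ge0.
congr (_ `^ _)%E; apply: eq_integral => x _.
rewrite gee0_abs ?lee_fin ?sqrtr_ge0 // poweR_EFin powR_mulrn ?sqrtr_ge0 //.
by rewrite vnorm_sqr.
Qed.

Lemma sqi_in_L2 K psi : sqi K (toM psi) -> in_L2 psi.
Proof.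
move=> s; have e := energy_le s; have [m [mn ln] h] := s.
have key i j : (fun x => toM psi x i j) \in Lfun mu 2%:E.
  rewrite inE; apply/andP; split; rewrite inE /=; first exact: m.
  rewrite /finite_norm unlock /=; apply: poweR_lty.
  apply: le_lt_trans (_ : (energy (toM psi) < +oo)%E); last by apply: le_lt_trans e (ltry _).
  apply: ge0_le_integral => //.
  - rewrite (_ : (fun x => _) = EFin \o (fun x => toM psi x i j ^+ 2)).
      by apply/measurable_EFinP; apply: measurable_funX; exact: m.
    apply/funext => x; rewrite /= powR_mulrn //; congr EFin.
    by rewrite real_normK ?num_real.
  - by apply/measurable_EFinP; exact: nsq_measurable.
  - move=> x _; rewrite /= powR_mulrn // lee_fin real_normK ?num_real //.
    exact: entry_le_nsq.
move=> i; split.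
  by have := key i 0; rewrite (_ : (fun x => _) = fun x => complex.Re (psi x i 0)) //; apply/funext => x; rewrite toM0.
by have := key i 1; rewrite (_ : (fun x => _) = fun x => complex.Im (psi x i 0)) //; apply/funext => x; rewrite toM1.
Qed.

Lemma in_L2_sqi psi : in_L2 psi -> exists2 K, sqi K (toM psi) & energy (toM psi) = K%:E.
Proof.
move=> L.
have key i j : (fun x => toM psi x i j) \in Lfun mu 2%:E.
  have [h1 h2] := L i; case: (I2P j) => ->.
    by rewrite (_ : (fun x => _) = fun x => complex.Re (psi x i 0)) //; apply/funext => x; rewrite toM0.
  by rewrite (_ : (fun x => _) = fun x => complex.Im (psi x i 0)) //; apply/funext => x; rewrite toM1.
have m i j : measurable_fun setT (fun x => toM psi x i j).
  by have := key i j; rewrite inE => /andP[]; rewrite inE.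
have mn := nsq_measurable m.
have I : mu.-integrable setT (EFin \o (fun x => nsq (toM psi x))).
  have J i j := Lfun2_integrable_sqr (key i j).
  have := integrableD measurableT (integrableD measurableT (J 0 0) (J 1 0))
     (integrableD measurableT (J 0 1) (J 1 1)).
  apply: eq_integrable => // x _ /=.
  by rewrite nsqE.
have fe : energy (toM psi) \is a fin_num := integrable_fin_num measurableT I.
exists (fine (energy (toM psi))); last by rewrite fineK.
have li a b : mu.-integrable `[a, b] (EFin \o (fun x => nsq (toM psi x))).
  by apply: (@integrableS _ _ _ mu setT `[a, b]) I.
split=> // a b ab.
rewrite /Rintegral -lee_fin !fineK //; last by apply: integrable_fin_num => //.
apply: ge0_subset_integral => //; first by apply/measurable_EFinP.
by move=> x _; rewrite lee_fin nsq_ge0.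
Qed.

End RealForm.

(** * Spectrum and eigenfunctions of L through the first-order system *)

Section SchrodingerForm.
Variables (R : realType) (alpha k omega0 : R).
Hypothesis halpha : 0 < alpha.
Hypothesis hcos : cos omega0 != 0.
Implicit Types (psi g : R -> 'cV[R[i]]_2).
Local Notation mu := (@lebesgue_measure R).
Local Notation W := (Wm alpha k omega0).
Local Notation dW := (dWm alpha k omega0).
Local Notation L := (operatorL alpha k omega0).

Lemma residualE w psi g x i :
  (map_mx (real_complex R) (potential alpha k omega0 w x) *m psi x - g x) i 0 =
  ((W w x *m W w x - dW w x) *m toM psi x - toM g x) i 0 +i*
  ((W w x *m W w x - dW w x) *m toM psi x - toM g x) i 1.
Proof.
rewrite (potentialE alpha k hcos w x) !entry_sub !mulmx2E !toM0 !toM1.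
rewrite mxE [(map_mx _ _ *m _) i 0]mxE sum_I2 [(- g x) i 0]mxE.
rewrite [map_mx _ _ i 0]mxE [map_mx _ _ i 1]mxE.
case: (psi x 0 0) => p q; case: (psi x 1 0) => s t; case: (g x i 0) => u v.
by apply/eqP; rewrite eq_complex /=; apply/andP; split; apply/eqP; ring.
Qed.

Lemma potential_cont w : mcont (fun x => W w x *m W w x - dW w x).
Proof.
have cW : mcont (W w) by exact: mprim_cont (mprim_Wm _ _ _ _).
by apply: mcontD; [exact: mcontM|apply: mcontN; exact: dWm_cont].
Qed.

(** The passage is eta = psi' + W psi in one direction and psi' = eta - W psi in the other. As W is
    differentiable, eta is absolutely continuous exactly when psi' is. *)
Lemma schrodingerP w psi g : L w psi g <->
  [/\ in_L2 psi, in_L2 g & exists eta, susy (W w) (toM psi) eta (toM g)].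
Proof.
have pW := mprim_Wm alpha k omega0 w.
have cW := mprim_cont pW.
split=> [[h1 h2 [dpsi hd]]|[h1 h2 [eta [p1 p2]]]]; split=> //.
  have [Kg sg _] := in_L2_sqi h2.
  pose D := toM dpsi.
  have cpsi : mcont (toM psi).
    move=> i j; have [/(_ _)dR _] := hd i.
    have c x : is_derive x (1 : R) (fun t => toM psi t i j) (D x i j).
      have [d1 d2] := dR x; case: (I2P j) => ->.
        rewrite /D toM0 (_ : (fun t => _) = fun t => complex.Re (psi t i 0)) //.
        by apply/funext => t; rewrite toM0.
      rewrite /D toM1 (_ : (fun t => _) = fun t => complex.Im (psi t i 0)) //.
      by apply/funext => t; rewrite toM1.
    by move=> x; apply: differentiable_continuous; apply/derivable1_diffP; apply: ex_derive.
  have pD : mprim D (fun x => (W w x *m W w x - dW w x) *m toM psi x - toM g x).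
    move=> i j; split.
      rewrite (_ : (fun x => _) = fun x => ((W w x *m W w x - dW w x) *m toM psi x) i j + (-1) * toM g x i j).
        apply: locintD; last by apply: locintZ; case: (locint_g sg i j).
        by apply: locint_cont; apply: mcontM => //; exact: potential_cont.
      by apply/funext => x; rewrite entry_sub mulN1r.
    move=> s t st; have [_ /(_ s t st) E] := hd i.
    have E1 : dpsi t i 0 - dpsi s i 0 =
      (\int[mu]_(x in `[s, t]) ((W w x *m W w x - dW w x) *m toM psi x - toM g x) i 0) +i*
      (\int[mu]_(x in `[s, t]) ((W w x *m W w x - dW w x) *m toM psi x - toM g x) i 1).
      rewrite E /cintegral; congr (_ +i* _); apply: eq_Rintegral => x _;
        by rewrite residualE.
    case: (I2P j) => ->; rewrite /D ?toM0 ?toM1.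
      have := congr1 (@complex.Re R) E1 => /= <-.
      by case: (dpsi t i 0) => ? ?; case: (dpsi s i 0).
    have := congr1 (@complex.Im R) E1 => /= <-.
    by case: (dpsi t i 0) => ? ?; case: (dpsi s i 0).
  have cD := mprim_cont pD.
  have pP : mprim (toM psi) D.
    move=> i j; apply: der_prim; last exact: cD.
    move=> x; have [/(_ x)[d1 d2] _] := hd i; case: (I2P j) => ->.
      rewrite /D toM0 (_ : (fun t => _) = fun t => complex.Re (psi t i 0)) //.
      by apply/funext => t; rewrite toM0.
    rewrite /D toM1 (_ : (fun t => _) = fun t => complex.Im (psi t i 0)) //.
    by apply/funext => t; rewrite toM1.
  exists (fun x => D x + W w x *m toM psi x); split.
    by apply: mprim_ext pP _ _ => x //; rewrite addrK.
  apply: mprim_ext (mprimD pD (mprimM pW pP)) _ _ => x //.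
  rewrite !(mulmxDr, mulmxDl, mulNmx) -!mulmxA.
  by apply/matrixP => i j; rewrite !mxOpE; ring.
have cpsi := mprim_cont p1; have ceta := mprim_cont p2.
pose D x := eta x - W w x *m toM psi x.
have cD : mcont D by apply: mcontD => //; apply/mcontN/mcontM.
have pD : mprim D (fun x => (W w x *m W w x - dW w x) *m toM psi x - toM g x).
  apply: mprim_ext (mprimB p2 (mprimM pW p1)) _ _ => x //.
  rewrite !(mulmxDr, mulmxDl, mulNmx, mulmxN) -!mulmxA.
  by apply/matrixP => i j; rewrite !mxOpE; ring.
exists (ofM D) => i; split.
  move=> x; split.
    have := prim_der (p1 i 0) (cD i 0 x).
    rewrite (_ : (fun x => toM psi x i 0) = fun t => complex.Re (psi t i 0)); last by apply/funext => t; rewrite toM0.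
    by rewrite (_ : complex.Re (ofM D x i 0) = D x i 0) // [ofM D x i 0]mxE.
  have := prim_der (p1 i 1) (cD i 1 x).
  rewrite (_ : (fun x => toM psi x i 1) = fun t => complex.Im (psi t i 0)); last by apply/funext => t; rewrite toM1.
  by rewrite (_ : complex.Im (ofM D x i 0) = D x i 1) // [ofM D x i 0]mxE.
move=> s t st; rewrite [ofM D t i 0]mxE [ofM D s i 0]mxE /cintegral.
have -> : \int[mu]_(x in `[s, t]) complex.Re ((map_mx (real_complex R) (potential alpha k omega0 w x) *m psi x - g x) i 0)
  = D t i 0 - D s i 0.
  by rewrite (pD i 0).2 //; apply: eq_Rintegral => x _; rewrite residualE.
have -> : \int[mu]_(x in `[s, t]) complex.Im ((map_mx (real_complex R) (potential alpha k omega0 w x) *m psi x - g x) i 0)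
  = D t i 1 - D s i 1.
  by rewrite (pD i 1).2 //; apply: eq_Rintegral => x _; rewrite residualE.
by [].
Qed.

Lemma eigenfunctionP w z psi : eigenfunction (L w) z psi <->
  [/\ exists K, sqi K (toM psi), exists eta, eigenpair alpha k omega0 w z (toM psi) eta &
      exists x, psi x != 0].
Proof.
have E : toM (fun x => z *: psi x) = fun x => toM psi x *m cmx z.
  apply/funext => x; rewrite -[LHS]/(toM (fun x => z *: psi x) x).
  have := toM_shift (fun=> 0) z psi x.
  rewrite (_ : (fun x => 0 + z *: psi x) = fun x => z *: psi x); last by apply/funext => y; rewrite add0r.
  move=> ->; rewrite (_ : toM (fun=> 0) x = 0) ?add0r //.
  by apply/matrixP => i j; rewrite !mxE; case: ifP.
split=> [[/schrodingerP[h1 h2 [eta he]] x0]|[[K s] [eta he] x0]]; split=> //.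
- by have [K s _] := in_L2_sqi h1; exists K.
- by exists eta; move: he; rewrite E.
- apply/schrodingerP; split.
  + exact: sqi_in_L2 s.
  + by have [C C0 sC] := sqi_cmx z; apply: (@sqi_in_L2 _ (C * K)); rewrite E; exact: sC.
  + by exists eta; rewrite E.
Qed.

Lemma shiftedP w z psi g : shifted (L w) z psi g <->
  [/\ in_L2 psi, in_L2 (fun x => g x + z *: psi x) &
      exists eta, susy (W w) (toM psi) eta (fun x => toM g x + toM psi x *m cmx z)].
Proof.
have E : toM (fun x => g x + z *: psi x) = fun x => toM g x + toM psi x *m cmx z.
  by apply/funext => x; exact: toM_shift.
rewrite /shifted; split=> [/schrodingerP[h1 h2 [eta he]]|[h1 h2 [eta he]]].
  by split=> //; exists eta; rewrite -E.
by apply/schrodingerP; split=> //; exists eta; rewrite E.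
Qed.

Lemma in_resolvent w z : (forall j : nat, z != (2 * j%:R * alpha)%:C) ->
  resolvent_set (L w) z.
Proof.
move=> nz; have [[K K0 sol] inj] := resolvent_spec k halpha hcos w nz.
have uniq psi psi' g : shifted (L w) z psi g -> shifted (L w) z psi' g -> psi = psi'.
  move=> /shiftedP[h1 _ [eta he]] /shiftedP[h1' _ [eta' he']].
  have S := susyB he he'.
  have [K1 s1 _] := in_L2_sqi h1; have [K2 s2 _] := in_L2_sqi h1'.
  have S' : eigenpair alpha k omega0 w z (fun x => toM psi x - toM psi' x) (fun x => eta x - eta' x).
    split; first exact: S.1.
    apply: mprim_ext S.2 _ _ => x //; congr (_ - _).
    by rewrite mulmxBl opprD addrACA subrr add0r.
  have s : sqi (2 * (K1 + 1 * K2)) (fun x => toM psi x - toM psi' x).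
    apply: (sqiD s1); apply: (sqi_dom _ ler01 s2).
      by move=> i j; case: s2 => m _ _; rewrite (_ : (fun x => _) = fun x => - toM psi' x i j);
        [exact: measurableT_comp|apply/funext => x; rewrite mxNE].
    by move=> x; rewrite mul1r -scaleN1r nsqZ sqrrN expr1n mul1r.
  have e0 := inj _ _ _ S' s.
  rewrite -(toMK psi) -(toMK psi'); congr ofM; apply/funext => x.
  by apply/eqP; rewrite -subr_eq0 e0.
have good g : in_L2 g -> exists psi Kg, [/\ shifted (L w) z psi g, sqi (K * Kg) (toM psi) &
    energy (toM g) = Kg%:E].
  move=> Lg; have [Kg sg eg] := in_L2_sqi Lg.
  have [P [eta [h1 h2]]] := sol _ _ sg.
  exists (ofM P), Kg; rewrite ofMK; split=> //.
  apply/shiftedP; split.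
  - by apply: (@sqi_in_L2 _ (K * Kg)); rewrite ofMK.
  - have [C C0 sC] := sqi_cmx z.
    apply: (@sqi_in_L2 _ (2 * (Kg + C * (K * Kg)))).
    rewrite (_ : toM _ = fun x => toM g x + P x *m cmx z); first by apply: sqiD => //; exact: sC.
    by apply/funext => x; rewrite toM_shift ofMK.
  - by exists eta; rewrite ofMK.
split.
  move=> g Lg; have [psi [Kg [h1 _ _]]] := good g Lg.
  by exists psi; split=> // psi' h'; exact: uniq h1 h'.
(* The square root is due to [solvable_at], which bounds squared norms. *)
exists (Num.sqrt K) => psi g h.
(* The graph of L only gives g + z psi in L_2; subtracting z psi recovers g. *)
have Lg : in_L2 g.
  have /shiftedP[l1 l2 _] := h.
  have [K1 s1 _] := in_L2_sqi l1; have [K2 s2 _] := in_L2_sqi l2.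
  have [C C0 sC] := sqi_cmx (- z).
  apply: (@sqi_in_L2 _ (2 * (K2 + C * K1))).
  rewrite (_ : toM g = fun x => toM (fun x => g x + z *: psi x) x + toM psi x *m cmx (- z)).
    by apply: sqiD => //; exact: sC.
  by apply/funext => x; rewrite toM_shift cmxN mulmxN addrK.
have [psi' [Kg [h1 h2 eg]]] := good g Lg.
rewrite (uniq _ _ _ h h1) !L2norm_energy eg.
have ep := energy_le h2.
have ep0 : (0 <= energy (toM psi'))%E by apply: integral_ge0 => x _; rewrite lee_fin nsq_ge0.
case E : (energy (toM psi')) ep ep0 => [r| |] //; rewrite !lee_fin => rK r0.
by rewrite /= -sqrtrM // ler_wsqrtr.
Qed.

Lemma eigenvalue_exists w n : exists psi, eigenfunction (L w) (2 * n%:R * alpha)%:C psi.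
Proof.
have [E [H [h1 [K sK] h3 _ _]]] := weber_eigenspace k halpha hcos n w.
have h := h1 1%:M.
have E1 : (fun x => E x *m 1%:M) = E by apply/funext => x; rewrite mulmx1.
rewrite E1 in h.
exists (ofM E); apply/eigenfunctionP; rewrite ofMK; split.
- by exists K.
- by exists (fun x => H x *m 1%:M).
apply: contrapT => /forallNP F.
have : (1%:M : 'M[R]_2) = 0.
  apply: h3 => x; rewrite mulmx1.
  have /negP := F x; rewrite negbK => /eqP e.
  rewrite -[LHS](congr1 (fun f => f x) (ofMK E)).
  by apply/matrixP => i j; rewrite mxE e !mxE; case: ifP.
by move=> /matrixP /(_ 0 0) /eqP; rewrite !mxE /= oner_eq0.
Qed.

(** Both psi and 0 solve the shifted equation with right-hand side 0, against the uniqueness in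
    [resolvent_set]. *)
Lemma eigenvalue_in_spectrum w z psi : eigenfunction (L w) z psi -> spectrum (L w) z.
Proof.
move=> h [/(_ (fun=> 0)) H _].
have Z : toM (fun=> 0 : 'cV[R[i]]_2) = fun=> 0.
  by apply/funext => x; apply/matrixP => i j; rewrite !mxE; case: ifP.
have L0 : in_L2 (fun=> 0 : 'cV[R[i]]_2).
  by apply: (@sqi_in_L2 _ 0); rewrite Z; exact: sqi_zero.
have [phi [_ un]] := H L0.
have [[K s] [eta he] [x xn]] := (eigenfunctionP w z psi).1 h.
have e1 : shifted (L w) z psi (fun=> 0).
  have [h' _] := h; rewrite /shifted.
  by rewrite (_ : (fun x => 0 + z *: psi x) = fun x => z *: psi x) //; apply/funext => y; rewrite add0r.
have e2 : shifted (L w) z (fun=> 0) (fun=> 0).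
  apply/shiftedP; split=> //.
    by rewrite (_ : (fun x => _) = fun=> 0) //; apply/funext => y; rewrite scaler0 addr0.
  exists (fun=> 0); rewrite Z; split.
    by apply: mprim_ext (@mprim_cst R 0) _ _ => y //; rewrite mulmx0 subrr.
  by apply: mprim_ext (@mprim_cst R 0) _ _ => y //; rewrite mulmx0 mul0mx addr0 subrr.
by move: xn; rewrite -(un _ e1) (un _ e2) eqxx.
Qed.

Lemma spectrumE w : spectrum (L w) = [set (2 * n%:R * alpha)%:C | n in [set: nat]].
Proof.
apply/seteqP; split=> z; last first.
  by move=> [n _ <-]; have [psi h] := eigenvalue_exists w n; exact: eigenvalue_in_spectrum h.
move=> sz; apply: contrapT => nz; apply: sz; apply: in_resolvent => j.
by apply/eqP => e; apply: nz; exists j.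
Qed.

Lemma eigenfunction_form w z psi : eigenfunction (L w) z psi ->
  exists n, z = (2 * n%:R * alpha)%:C.
Proof. by move=> /eigenvalue_in_spectrum; rewrite spectrumE => -[n _ <-]; exists n. Qed.

Lemma spectrum_isolated w z : spectrum (L w) z -> isolated (spectrum (L w)) z.
Proof.
move=> sz; split; first exact/mem_set.
move: (sz); rewrite spectrumE => -[n _ zE].
(* Neighbouring points of the spectrum are 2 alpha apart, so the radius alpha isolates. *)
exists (ball (z : R[i]^o) (alpha%:C : R[i])).
  by apply: nbhsx_ballx; rewrite ltcR.
apply/seteqP; split=> y; last first.
  by move=> ->; split; [apply: ballxx; rewrite ltcR|exists n].
move=> [By [m _ yE]]; move: By; rewrite -zE -yE /ball /= => H.
congr (_%:C); have -> : m = n; last by [].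
apply/eqP; apply/negPn/negP => mn.
have : `|(2 * n%:R * alpha)%:C - (2 * m%:R * alpha)%:C| < alpha%:C :> R[i] by exact: H.
rewrite -rmorphB /= cmodE cmod_real ltcR (_ : _ - _ = 2 * alpha * (n%:R - m%:R)); last by ring.
rewrite normrM (ger0_norm (_ : 0 <= 2 * alpha)); last by rewrite mulr_ge0 // ltW.
have d1 : 1 <= `|n%:R - m%:R| :> R.
  case: (ltngtP m n) mn => // lt _; first by rewrite -natrB ?(ltnW lt) // normr_nat ler1n subn_gt0.
  by rewrite distrC -natrB ?(ltnW lt) // normr_nat ler1n subn_gt0.
apply/negP; rewrite -leNgt -[leLHS]mulr1; apply: ler_pM; rewrite ?ler01 ?(ltW halpha) //.
by rewrite ler_peMl ?(ltW halpha) // ler1n.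
Qed.

Lemma eigenspace_finite w z : finite_multiplicity (L w) z.
Proof.
have [[n zE]|nz] := pselect (exists n : nat, z = (2 * n%:R * alpha)%:C); last first.
  exists 0%N, (fun _ _ => 0) => psi h; exfalso; apply: nz.
  exact: eigenfunction_form h.
have [E [H [_ _ _ h4 _]]] := weber_eigenspace k halpha hcos n w.
exists 2%N, (fun l x => \col_i (E x i l)%:C) => psi /eigenfunctionP[[K s] [eta he] _].
rewrite zE in he; have [C EC] := h4 _ _ _ he s.
exists (fun l => C l 0 +i* C l 1) => x.
apply/colP => i; rewrite sum_I2 -[in LHS](toMK psi) mxE EC !mulmx2E !mxE.
by apply/eqP; rewrite eq_complex /=; apply/andP; split; apply/eqP; ring.
Qed.

Lemma eigenfunction_weber w z psi : k != 0 -> alpha * tan omega0 != 0 ->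
  eigenfunction (L w) z psi -> forall j, rexpr (fun x => psi x j 0).
Proof.
move=> k0 g0 h j; have [n zE] := eigenfunction_form h.
have [E [H [_ _ _ h4 h5]]] := weber_eigenspace k halpha hcos n w.
have [[K s] [eta he] _] := (eigenfunctionP w z psi).1 h.
rewrite zE in he; have [C EC] := h4 _ _ _ he s.
have e i l : rexpr (fun x => (E x i l)%:C) := (h5 k0 g0 i l).1.
apply: rexpr_ext (rexprD (rexprM (rexpr_cst (C 0 0 +i* C 0 1)) (e j 0))
   (rexprM (rexpr_cst (C 1 0 +i* C 1 1)) (e j 1))) _ => x.
rewrite -[in RHS](toMK psi) mxE EC !mulmx2E.
by apply/eqP; rewrite eq_complex /=; apply/andP; split; apply/eqP; ring.
Qed.

End SchrodingerForm.

Theorem proposition3 (R : realType) (alpha k omega0 omega1 : R)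
    (halpha : 0 < alpha) (hcos : cos omega0 != 0) :
  let gamma := alpha * tan omega0 in
  let L := operatorL alpha k omega0 omega1 in
  [/\ spectrum L = [set (2 * n%:R * alpha)%:C | n in [set: nat]],
      discrete_spectrum L = spectrum L &
      k != 0 -> gamma != 0 ->
      forall (lambda : R[i]) (psi : R -> 'cV[R[i]]_2),
        eigenfunction L lambda psi ->
        forall j : 'I_2, exists2 F : R[i] -> R[i],
          weber_expressible F & forall x : R, psi x j 0 = F x%:C].
Proof.
move=> gamma L; split.
- exact: spectrumE.
- apply/seteqP; split=> z; first by case=> /isolatedS.
  move=> sz; split; first exact: spectrum_isolated.
    move: sz; rewrite spectrumE // => -[n _ <-].
    exact: eigenvalue_exists.
  exact: eigenspace_finite.
- move=> k0 g0 lambda psi h j.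
  exact: (eigenfunction_weber halpha hcos k0 g0 h j).
Qed.
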